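(* Let $T>0$ and $M=[T/\Delta t]$. There exist a positive integer $k_2$ and a constant $C>0$, independent of $h$, $\Delta t$, $T$ and $\varepsilon$, such that if $\Delta t\le\frac{\varepsilon}{2\sqrt2\,A^{1/2}}$, then the numerical solution $(\phi^m)$ of the scheme described in the context satisfies $$\max_{0\le m\le M}\|\phi^m_{\bf F}\|_{H^2}\le \hat C_{2,\varepsilon}:=C\varepsilon^{-k_2}.$$
   Context: Grid and operators. $\Omega=(0,L)^3$ with periodic boundary conditions; $N=2K+1$ is odd, $h=L/N$, $x_i=y_i=z_i=(i-\tfrac12)h$. $\mathcal V_{\rm per}$ is the space of real grid functions $f=(f_{i,j,k})_{(i,j,k)\in\mathbb Z^3}$ that are $N$-periodic in each index; $\langle f,g\rangle=h^3\sum_{i,j,k=1}^N f_{i,j,k}g_{i,j,k}$, $\|f\|_2^2=\langle f,f\rangle$, $\|f\|_4^4=\langle f^4,1\rangle$. $(D_x^2f)_{i,j,k}=(f_{i+1,j,k}-2f_{i,j,k}+f_{i-1,j,k})/h^2$ (similarly $D_y^2,D_z^2$), and the long stencil fourth order operators are $\mathcal D^2_{x,(4)}=D_x^2(1-\frac{h^2}{12}D_x^2)$ (similarly in $y,z$), $\Delta_{h,(4)}=\mathcal D^2_{x,(4)}+\mathcal D^2_{y,(4)}+\mathcal D^2_{z,(4)}$, with $\|\nabla_{h,(4)}f\|_2^2=\langle f,-\Delta_{h,(4)}f\rangle$. For $f\in\mathcal V_{\rm per}$ with discrete Fourier expansion $f_{i,j,k}=\sum_{\ell,m,n=-K}^K\hat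 f^N_{\ell,m,n}e^{2\pi\mathrm i(\ell x_i+my_j+nz_k)/L}$, its continuous extension is $f_{\bf F}(x,y,z)=\sum_{\ell,m,n=-K}^K\hat f^N_{\ell,m,n}e^{2\pi\mathrm i(\ell x+my+nz)/L}$. $\|\cdot\|_{H^m}$ is the usual Sobolev norm on $\Omega$. Numerical scheme. $\Phi$ is the exact ($\Omega$-periodic) solution of the Cahn-Hilliard equation $\phi_t=\Delta(\varepsilon^{-1}(\phi^3-\phi)-\varepsilon\Delta\phi)$ with sufficiently smooth initial datum $\phi_0$, and $\Phi_N(\cdot,t)$ is the truncation of the Fourier series of $\Phi(\cdot,t)$ to modes $-K\le\ell,m,n\le K$. With time step $\Delta t>0$, interface parameter $0<\varepsilon<1$ and a fixed constant $A\ge\frac1{16}$, set $\phi^0_{i,j,k}=\Phi_N(x_i,y_j,z_k,0)$, $\mu_h^0=\varepsilon^{-1}((\phi^0)^3-\phi^0)-\varepsilon\Delta_{h,(4)}\phi^0$, $\phi^{-1}=\phi^0-\Delta t\,\Delta_{h,(4)}\mu_h^0$, and for $n\ge0$ let $\phi^{n+1}\in\mathcal V_{\rm per}$ be the (unique) solution of $$\frac{\frac32\phi^{n+1}-2\phi^n+\frac12\phi^{n-1}}{\Delta t}=\Delta_{h,(4)}\mu^{n+1},$$ $$\mu^{n+1}=\varepsilon^{-1}\left((\phi^{n+1})^3-2\phi^n+\phi^{n-1}\right)-\varepsilon\Delta_{h,(4)}\phi^{n+1}-A\varepsilon^{-2}\Delta t\,\Delta_{h,(4)}(\phi^{n+1}-\phi^n).$$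 The initial data are assumed regular enough that $E_h(\phi^0)+\frac{\Delta t}{4}\|\nabla_{h,(4)}\mu_h^0\|_2^2+\frac{\Delta t^2}{2}\|\Delta_{h,(4)}\mu_h^0\|_2^2\le\tilde C_0$ with $\tilde C_0$ independent of $h$, where $E_h(\phi)=\varepsilon^{-1}(\frac14\|\phi\|_4^4-\frac12\|\phi\|_2^2)+\frac\varepsilon2\|\nabla_{h,(4)}\phi\|_2^2$. Constants may depend on $L$, $A$, $\tilde C_0$ and Sobolev norms of $\phi_0$. *)

(* Defs.v *)
From HB Require Import structures.
From mathcomp Require Import all_boot all_order all_algebra.
From mathcomp Require Import all_classical all_reals all_analysis.
From mathcomp Require Import complex.
Set Implicit Arguments.
Unset Strict Implicit.
Unset Printing Implicit Defensive.
Import Order.TTheory GRing.Theory Num.Theory.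
Import numFieldNormedType.Exports.
Local Open Scope classical_set_scope.
Local Open Scope complex_scope.
Local Open Scope ring_scope.

Definition fun3 (R : Type) := R -> R -> R -> R.

Section Continuum.
Variable R : realType.
Implicit Types (L : R) (u : fun3 R).

Definition uncurry3 u (p : R * R * R) : R := u p.1.1 p.1.2 p.2.

Definition dx u : fun3 R := fun x y z => derive1 (fun s : R => u s y z) x.
Definition dy u : fun3 R := fun x y z => derive1 (fun s : R => u x s z) y.
Definition dz u : fun3 R := fun x y z => derive1 (fun s : R => u x y s) z.

Definition partial (a b c : nat) u : fun3 R := iter a dx (iter b dy (iter c dz u)).

Definition laplacian u : fun3 R :=
  fun x y z => dx (dx u) x y z + dy (dy u) x y z + dz (dz u) x y z.

Fixpoint class_C (s : nat) u : Prop :=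
  continuous (uncurry3 u) /\
  if s is s'.+1 then
    (forall x y z : R,
       [/\ derivable (fun t : R => u t y z) x 1,
           derivable (fun t : R => u x t z) y 1 &
           derivable (fun t : R => u x y t) z 1]) /\
    [/\ class_C s' (dx u), class_C s' (dy u) & class_C s' (dz u)]
  else True.

Definition periodic3 L u : Prop := forall x y z : R,
  [/\ u (x + L) y z = u x y z, u x (y + L) z = u x y z &
      u x y (z + L) = u x y z].

Definition Omega L : set (R * R * R) := (`]0, L[ `*` `]0, L[) `*` `]0, L[.

Definition integral_Omega L u : R :=
  \int[((@lebesgue_measure R \x @lebesgue_measure R) \x @lebesgue_measure R)%E]_(p in Omega L)
    uncurry3 u p.

(* The classical partial derivatives are the weak ones for the functions, of
   class C^m, to which this norm is applied. *)
Definition sobolev_norm L (m : nat) u : R :=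
  Num.sqrt (\sum_(a < m.+1) \sum_(b < m.+1) \sum_(c < m.+1 | (a + b + c <= m)%N)
    integral_Omega L (fun x y z => partial a b c u x y z ^+ 2)).

(* Classical L-periodic solution, on [0, +oo[, of
     phi_t = Delta (eps^-1 (phi^3 - phi) - eps Delta phi),  phi(0) = phi0. *)
Definition cahn_hilliard_solution L (eps : R) (phi0 : fun3 R) (Phi : R -> fun3 R) : Prop :=
  [/\ Phi 0 = phi0,
      forall t : R, 0 <= t -> periodic3 L (Phi t),
      {within [set q : R * (R * R * R) | 0 <= q.1],
        continuous (fun q : R * (R * R * R) => uncurry3 (Phi q.1) q.2)},
      forall t : R, 0 < t -> class_C 4 (Phi t) &
      forall t x y z : R, 0 < t ->
        is_derive t 1 (fun s : R => Phi s x y z)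
          (laplacian (fun x' y' z' =>
             eps^-1 * (Phi t x' y' z' ^+ 3 - Phi t x' y' z')
             - eps * laplacian (Phi t) x' y' z') x y z)].

End Continuum.

(* Grid functions are functions on Z^3; the space V_per is cut out by [Vper]. *)
Definition grid (R : Type) := int -> int -> int -> R.

Section Grid.
Variable R : realType.
Implicit Types (L h eps dt A : R) (f g phi mu : grid R).

Definition gridN (K : nat) : nat := (2 * K).+1.
Definition gridh L (K : nat) : R := L / (gridN K)%:R.

Definition Vper (N : nat) f : Prop := forall i j k : int,
  [/\ f (i + N%:Z) j k = f i j k, f i (j + N%:Z) k = f i j k &
      f i j (k + N%:Z) = f i j k].

Definition node h (i : int) : R := (i%:~R - 2%:R^-1) * h.

Definition inner h (N : nat) f g : R :=
  h ^+ 3 * \sum_(1 <= i < N.+1) \sum_(1 <= j < N.+1) \sum_(1 <= k < N.+1)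
    f i%:Z j%:Z k%:Z * g i%:Z j%:Z k%:Z.

Definition norm2_sq h N f : R := inner h N f f.
Definition norm4_pow4 h N f : R :=
  inner h N (fun i j k => f i j k ^+ 4) (fun _ _ _ => 1).

Definition D2x h f : grid R := fun i j k =>
  (f (i + 1) j k - 2 * f i j k + f (i - 1) j k) / h ^+ 2.
Definition D2y h f : grid R := fun i j k =>
  (f i (j + 1) k - 2 * f i j k + f i (j - 1) k) / h ^+ 2.
Definition D2z h f : grid R := fun i j k =>
  (f i j (k + 1) - 2 * f i j k + f i j (k - 1)) / h ^+ 2.

Definition D2x4 h f : grid R :=
  D2x h (fun i j k => f i j k - h ^+ 2 / 12 * D2x h f i j k).
Definition D2y4 h f : grid R :=
  D2y h (fun i j k => f i j k - h ^+ 2 / 12 * D2y h f i j k).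
Definition D2z4 h f : grid R :=
  D2z h (fun i j k => f i j k - h ^+ 2 / 12 * D2z h f i j k).

Definition Lap4 h f : grid R := fun i j k =>
  D2x4 h f i j k + D2y4 h f i j k + D2z4 h f i j k.

Definition grad4_sq h N f : R := inner h N f (fun i j k => - Lap4 h f i j k).

Definition energy h N eps phi : R :=
  eps^-1 * (norm4_pow4 h N phi / 4 - norm2_sq h N phi / 2)
  + eps / 2 * grad4_sq h N phi.

Definition cis (t : R) : R[i] := cos t +i* sin t.

Definition phase L (l m n : int) (x y z : R) : R :=
  2 * pi * (l%:~R * x + m%:~R * y + n%:~R * z) / L.

Definition modes (K : nat) : seq int := [seq l%:Z - K%:Z | l <- iota 0 (gridN K)].

(* Trigonometric polynomial with coefficients c.  All the coefficients used
   below are Hermitian (c (-l) (-m) (-n) is the conjugate of c l m n), so that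
   the sum is real and [Re] is only a change of type. *)
Definition trig_poly L (K : nat) (c : int -> int -> int -> R[i]) : fun3 R :=
  fun x y z => complex.Re (\sum_(l <- modes K) \sum_(m <- modes K) \sum_(n <- modes K)
    c l m n * cis (phase L l m n x y z)).

(* Coefficients of the discrete Fourier expansion
   f_ijk = \sum_(|l|, |m|, |n| <= K) fhat_lmn exp (2 pi i (l x_i + m y_j + n z_k) / L),
   obtained by inverting it. *)
Definition dft L (K : nat) f (l m n : int) : R[i] :=
  ((gridN K)%:R ^+ 3)^-1 *
  \sum_(1 <= i < (gridN K).+1) \sum_(1 <= j < (gridN K).+1) \sum_(1 <= k < (gridN K).+1)
    (f i%:Z j%:Z k%:Z)%:C *
    cis (- phase L l m n (node (gridh L K) i%:Z) (node (gridh L K) j%:Z)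
                         (node (gridh L K) k%:Z)).

Definition extension L K f : fun3 R := trig_poly L K (dft L K f).

(* L^-3 \int_Omega u(x,y,z) exp (- 2 pi i (l x + m y + n z) / L) *)
Definition fourier_coef L (u : fun3 R) (l m n : int) : R[i] :=
  let I w := (L ^+ 3)^-1 * integral_Omega L w in
  I (fun x y z => u x y z * cos (phase L l m n x y z)) -i*
  I (fun x y z => u x y z * sin (phase L l m n x y z)).

Definition fourier_truncation L K (u : fun3 R) : fun3 R :=
  trig_poly L K (fourier_coef L u).

Definition grid_restriction h (u : fun3 R) : grid R :=
  fun i j k => u (node h i) (node h j) (node h k).

Definition mu_init h eps phi : grid R := fun i j k =>
  eps^-1 * (phi i j k ^+ 3 - phi i j k) - eps * Lap4 h phi i j k.

(* mu^{n+1} as a function of p = phi^{n+1}, q = phi^n, r = phi^{n-1} *)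
Definition mu_step h eps dt A (p q r : grid R) : grid R := fun i j k =>
  eps^-1 * (p i j k ^+ 3 - 2 * q i j k + r i j k)
  - eps * Lap4 h p i j k
  - A * eps ^- 2 * dt * Lap4 h (fun i' j' k' => p i' j' k' - q i' j' k') i j k.

Definition initial_energy_bound h N eps dt (C0 : R) (phi0 : grid R) : Prop :=
  let mu0 := mu_init h eps phi0 in
  energy h N eps phi0 + dt / 4 * grad4_sq h N mu0
  + dt ^+ 2 / 2 * norm2_sq h N (Lap4 h mu0) <= C0.

(* The sequence phi is indexed by the integers n >= -1. *)
Definition bdf2_solution L K eps dt A (Phi0 : fun3 R) (phi : int -> grid R) : Prop :=
  let h := gridh L K in
  [/\ phi 0 = grid_restriction h (fourier_truncation L K Phi0),
      phi (-1) = (fun i j k =>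
        phi 0 i j k - dt * Lap4 h (mu_init h eps (phi 0)) i j k) &
      forall n : nat,
        Vper (gridN K) (phi (n%:Z + 1)) /\
        forall i j k : int,
          (3 / 2 * phi (n%:Z + 1) i j k - 2 * phi n%:Z i j k
           + 1 / 2 * phi (n%:Z - 1) i j k) / dt
          = Lap4 h (mu_step h eps dt A
                      (phi (n%:Z + 1)) (phi n%:Z) (phi (n%:Z - 1))) i j k].

End Grid.

(* Main.v *)
Require Import Defs.
From HB Require Import structures.
From mathcomp Require Import all_boot all_order all_algebra.
From mathcomp Require Import all_classical all_reals all_analysis.
From mathcomp Require Import measurable_realfun complex.
From mathcomp Require Import ring lra zify.
Set Implicit Arguments.
Unset Strict Implicit.
Unset Printing Implicit Defensive.
Import Order.TTheory GRing.Theory Num.Theory.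
Import numFieldNormedType.Exports Normc.
Local Open Scope classical_set_scope.
Local Open Scope complex_scope.
Local Open Scope ring_scope.

(**
The iterates are bounded in H^1 by an energy that decreases at each step, and
then in H^2 by a recursion with damping.  Neither bound grows with the number
of steps, and every constant is a polynomial in 1 / eps.

Energy.  A difference of two consecutive iterates is a discrete Laplacian, say
phi^n - phi^(n-1) = - Lap psi^n, and the scheme itself provides the potential
psi^(n+1) = psi^n / 3 - (2 dt / 3) mu^(n+1).  The discrete Dirichlet integral of
psi^n thus plays the role of the squared H^-1 norm of the difference, and the
Laplacian never has to be inverted.  Testing the scheme with psi^(n+1) shows
([energy_step]) that

  E_h(phi^n) + (4 dt)^-1 ||grad psi^n||^2 + (2 eps)^-1 ||phi^n - phi^(n-1)||^2

does not increase.  The explicit concave term is interpolated between H^-1 and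
H^1, and A >= 1/16 is what the stabilising term needs to absorb its H^1 part.
As the double well is bounded below, this bounds the H^1 norm ([H1_bound]).

H^2 estimate.  The scheme is tested with Delta^2 phi^(n+1).  The discrete time
derivative is controlled by the G-norm of BDF2 ([bdf_identity]), the surface
diffusion dissipates eps ||Delta^2 phi^(n+1)||^2, and the cubic term is subcritical:
if m bounds the squared H^1 norm, then ([cube_eta])

  ||Delta (phi^3)||^2 <= eta ||phi||_(H^4)^2 + C m^13 / eta^5  for all eta > 0.

This follows from (u^3)'' = 3 u^2 u'' + 6 u (u')^2, where both terms are bounded
in L^2 by a multiple of sup |u|^2 ||u''|| ([norm2_fdiff2_cube]), from a discrete
Agmon inequality for sup |u| ([sup_bound]) and from interpolation between H^1
and H^4.  The condition dt <= eps / (2 sqrt 2 sqrt A), which says that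
A dt^2 <= eps^2 / 8, makes the functional of the recursion smaller than a
multiple of the dissipation; the recursion is then damped ([H2_step]) and its
solutions stay below a fixed barrier ([damped_bound]).

Fourier analysis.  Discrete norms are weighted sums of squared discrete Fourier
coefficients, so that inequalities between quadratic norms reduce to
inequalities between symbols.  By Jordan's inequality the symbol of
- Delta_(h,(4)) controls the squares of the wave numbers, and the H^2 norm of
the continuous extension is bounded by the discrete one
([sobolev_extension]).

Initial data.  The recursion starts from phi^0 and phi^(-1), for which
the discrete H^4 norms have to be bounded uniformly in h, so that eight
differences of phi^0 are needed.  Integration by parts on the periodic cell
makes the Fourier coefficients of the initial datum decay ([fourier_decay]),
hence the iterated differences of its truncated Fourier series are bounded
([truncation_diff_bounded]).
*)


(** * Measurability of continuous functions of several variables *)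
Section Measurability.
Variable R : realType.
Local Notation mu := (@lebesgue_measure R).
Local Notation T2 := (R * R)%type.
Local Notation T3 := (R * R * R)%type.

(** Boxes with rational centre and radius form a countable base of the topology,
and they are measurable for the product sigma-algebra. *)
Lemma open3_measurable (U : set T3) : open U -> measurable U.
Proof.
move=> oU.
pose box (p q r e : rat) : set T3 :=
  (ball (ratr p : R) (ratr e : R) `*` ball (ratr q : R) (ratr e : R)) `*`
   ball (ratr r : R) (ratr e : R).
pose F p q r e : set T3 := if `[< box p q r e `<=` U >] then box p q r e else set0.
rewrite (_ : U = \bigcup_p \bigcup_q \bigcup_r \bigcup_e F p q r e).
  apply: bigcupT_measurable_rat => p; apply: bigcupT_measurable_rat => q.
  apply: bigcupT_measurable_rat => r; apply: bigcupT_measurable_rat => e.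
  rewrite /F; case: ifPn => // _; apply: measurableX; last by apply: open_measurable; exact: ball_open.
  by apply: measurableX; apply: open_measurable; exact: ball_open.
apply/seteqP; split => [[[x y] z] Uxyz|xyz [p _ [q _ [r _ [e _]]]]]; last first.
  by rewrite /F; case: asboolP => // boxU /boxU.
have /nbhs_ballP[d /= d0 dU] : nbhs (x, y, z) U by exact: open_nbhs_nbhs.
have [e e0 ed] : exists2 e : rat, 0 < (ratr e : R) & (ratr e : R) < d / 2.
  have := @rat_in_itvoo R 0 (d / 2) _.
  rewrite divr_gt0// => /(_ isT)[e]; rewrite in_itv/= => /andP[? ?].
  by exists e.
have near_rat (t : R) : exists p : rat, `|(ratr p : R) - t| < ratr e.
  have := @rat_in_itvoo R (t - ratr e) (t + ratr e) _.
  have -> : (t - ratr e < t + ratr e :> R) by lra.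
  move=> /(_ isT)[p]; rewrite in_itv/= => /andP[? ?]; exists p.
  by rewrite ltr_norml; apply/andP; split; lra.
have [p px] := near_rat x; have [q qy] := near_rat y; have [r rz] := near_rat z.
exists p => //; exists q => //; exists r => //; exists e => //.
rewrite /F; case: asboolP => [_|]; first by repeat split.
case => -[[x' y'] z'] /= [[]] /= ; rewrite /ball /= => x'p y'q z'r; apply: dU.
rewrite /ball /= /prod_ball /= /ball /=.
by repeat split; rewrite /ball /=;
  move: px qy rz x'p y'q z'r; rewrite !ltr_norml => /andP[? ?] /andP[? ?] /andP[? ?]
   /andP[? ?] /andP[? ?] /andP[? ?]; apply/andP; split; lra.
Qed.

Lemma continuous3_measurable (f : T3 -> R) : continuous f -> measurable_fun setT f.
Proof.
move=> /continuousP cf; apply: (measurability _ (RGenOpens.measurableE R)).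
move=> _ [_ [a [b ->] <-]]; rewrite setTI; apply: open3_measurable.
exact/cf/interval_open.
Qed.

Lemma continuous2_measurable (f : T2 -> R) : continuous f -> measurable_fun setT f.
Proof.
move=> cf.
have cf3 : continuous (f \o (fst : T3 -> T2)).
  by move=> p; apply: continuous_comp; [exact: cvg_fst|exact: cf].
have -> : f = (f \o (fst : T3 -> T2)) \o (fun p => (p, 0)) by [].
apply: measurableT_comp; first exact: continuous3_measurable.
exact: pair2_measurable.
Qed.

End Measurability.

Lemma funext3 (A B C D : Type) (f g : A -> B -> C -> D) :
  (forall i j k, f i j k = g i j k) -> f = g.
Proof.
by move=> fg; apply/funext => i; apply/funext => j; apply/funext => k; exact: fg.
Qed.

Lemma eq_ler (T : numDomainType) (x y : T) : x = y -> x <= y.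
Proof. by move=> ->. Qed.

(** * Integrals over the periodic cell *)
Section IntegralOmega.
Variable R : realType.
Local Notation mu := (@lebesgue_measure R).
Local Notation T2 := (R * R)%type.
Local Notation T3 := (R * R * R)%type.
Local Notation mu2 := (mu \x mu)%E.
Local Notation mu3 := ((mu \x mu) \x mu)%E.
Implicit Types (u v : fun3 R) (L : R).

Definition square L : set T2 := `]0, L[ `*` `]0, L[.

Lemma measurable_square L : measurable (square L).
Proof. by apply: measurableX; exact: measurable_itv. Qed.

Lemma measurable_Omega L : measurable (Omega L).
Proof. by apply: measurableX; [exact: measurable_square|exact: measurable_itv]. Qed.

Lemma mu2_square L : 0 < L -> mu2 (square L) = (L ^+ 2)%:E.
Proof.
move=> L0; rewrite /square product_measure1E; [|exact: measurable_itv..].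
by rewrite /= lebesgue_measure_itv/= lte_fin L0 oppr0 addr0 -EFinM expr2.
Qed.

Lemma mu3_Omega L : 0 < L -> mu3 (Omega L) = (L ^+ 3)%:E.
Proof.
move=> L0; rewrite /Omega product_measure1E; [|exact: measurable_square|exact: measurable_itv].
rewrite [X in (X * _)%E](mu2_square L0).
by rewrite /= lebesgue_measure_itv/= lte_fin L0 oppr0 adde0 -EFinM -exprSr.
Qed.

Lemma itv_oo_cc L : `]0, L[ `<=` (`[0, L] : set R).
Proof. by move=> x /=; rewrite !in_itv/= => /andP[/ltW-> /ltW->]. Qed.

(** The function is bounded on the closed cell, which is compact, and the cell has
finite measure. *)
Lemma continuous3_integrable L (f : T3 -> R) : 0 < L -> continuous f ->
  mu3.-integrable (Omega L) (EFin \o f).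
Proof.
move=> L0 cf; apply: measurable_bounded_integrable.
- exact: measurable_Omega.
- exact: (eq_ind_r (fun a => (a < +oo)%E) (ltry _) (mu3_Omega L0)).
- by apply: measurable_funS (continuous3_measurable cf).
- pose A : set T3 := (`[0, L] `*` `[0, L]) `*` `[0, L].
  have cA : compact A by do 2 (apply: compact_setX; last exact: segment_compact);
                         exact: segment_compact.
  have /compact_bounded[M [Mr mrt]] : compact (f @` A).
    by apply: continuous_compact => //; exact: continuous_subspaceT.
  exists M; split => // N MN x [[/= xL1 xL2] xL3]; apply: (mrt _ MN).
  by exists x => //; split => //; first split; exact: itv_oo_cc.
Qed.

Lemma continuous2_integrable L (f : T2 -> R) : 0 < L -> continuous f ->
  mu2.-integrable (square L) (EFin \o f).
Proof.
move=> L0 cf; apply: measurable_bounded_integrable.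
- exact: measurable_square.
- exact: (eq_ind_r (fun a => (a < +oo)%E) (ltry _) (mu2_square L0)).
- by apply: measurable_funS (continuous2_measurable cf).
- pose A : set T2 := (`[0, L] `*` `[0, L]).
  have cA : compact A by apply: compact_setX; exact: segment_compact.
  have /compact_bounded[M [Mr mrt]] : compact (f @` A).
    by apply: continuous_compact => //; exact: continuous_subspaceT.
  exists M; split => // N MN x [/= xL1 xL2]; apply: (mrt _ MN).
  by exists x => //; split => //; exact: itv_oo_cc.
Qed.

Definition cont3 u := continuous (uncurry3 u).

Lemma cont3D u v : cont3 u -> cont3 v -> cont3 (fun x y z => u x y z + v x y z).
Proof. by move=> cu cv p; apply: continuousD; [exact: cu|exact: cv]. Qed.

Lemma cont3M u v : cont3 u -> cont3 v -> cont3 (fun x y z => u x y z * v x y z).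
Proof. by move=> cu cv p; apply: continuousM; [exact: cu|exact: cv]. Qed.

Lemma cont3_cst (a : R) : cont3 (fun _ _ _ => a).
Proof. by move=> p; exact: cst_continuous. Qed.

Lemma cont3_sum (I : Type) (s : seq I) (F : I -> fun3 R) :
  (forall i, cont3 (F i)) -> cont3 (fun x y z => \sum_(i <- s) F i x y z).
Proof.
move=> cF; elim: s => [|i s IHs].
  have -> : (fun x y z => \sum_(i <- [::]) F i x y z) = (fun _ _ _ => 0).
    by apply: funext3 => x y z; rewrite big_nil.
  exact: cont3_cst.
have -> : (fun x y z => \sum_(j <- i :: s) F j x y z) =
          (fun x y z => F i x y z + \sum_(j <- s) F j x y z).
  by apply: funext3 => x y z; rewrite big_cons.
exact: cont3D.
Qed.

Lemma cont3_sqr u : cont3 u -> cont3 (fun x y z => u x y z ^+ 2).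
Proof. by move=> cu; exact: cont3M. Qed.

Lemma integral_OmegaD L u v : 0 < L -> cont3 u -> cont3 v ->
  integral_Omega L (fun x y z => u x y z + v x y z) =
  integral_Omega L u + integral_Omega L v.
Proof.
move=> L0 cu cv; rewrite /integral_Omega -RintegralD//.
- exact: measurable_Omega.
- exact: continuous3_integrable.
- exact: continuous3_integrable.
Qed.

Lemma integral_OmegaZ L (a : R) u : 0 < L -> cont3 u ->
  integral_Omega L (fun x y z => a * u x y z) = a * integral_Omega L u.
Proof.
move=> L0 cu; rewrite /integral_Omega -RintegralZl//.
- exact: measurable_Omega.
- exact: continuous3_integrable.
Qed.

Lemma integral_Omega_cst L (a : R) : 0 < L ->
  integral_Omega L (fun _ _ _ => a) = a * L ^+ 3.
Proof.
move=> L0; rewrite /integral_Omega Rintegral_cst; last exact: measurable_Omega.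
by congr (_ * _); exact: (congr1 fine (mu3_Omega L0)).
Qed.

Lemma integral_Omega_sum L (I : Type) (s : seq I) (F : I -> fun3 R) : 0 < L ->
  (forall i, cont3 (F i)) ->
  integral_Omega L (fun x y z => \sum_(i <- s) F i x y z) =
  \sum_(i <- s) integral_Omega L (F i).
Proof.
move=> L0 cF; elim: s => [|i s IHs].
  rewrite big_nil -[RHS](mul0r (L ^+ 3)) -integral_Omega_cst//; congr integral_Omega.
  by apply: funext3 => x y z; rewrite big_nil.
rewrite big_cons -IHs -integral_OmegaD//; last exact: cont3_sum.
congr integral_Omega.
by apply: funext3 => x y z; rewrite big_cons.
Qed.

Lemma le_integral_Omega L u v : 0 < L -> cont3 u -> cont3 v ->
  (forall x y z, u x y z <= v x y z) -> integral_Omega L u <= integral_Omega L v.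
Proof.
move=> L0 cu cv uv; apply: le_Rintegral.
- exact: measurable_Omega.
- exact: continuous3_integrable.
- exact: continuous3_integrable.
- by move=> [[x y] z] _; exact: uv.
Qed.

Lemma integral_Omega_ge0 L u : (forall x y z, 0 <= u x y z) -> 0 <= integral_Omega L u.
Proof. by move=> u0; apply: Rintegral_ge0 => -[[x y] z] _; exact: u0. Qed.

(** Fundamental theorem of calculus: periodicity makes the boundary terms cancel. *)
Lemma integral_derive1_periodic L (f : R -> R) : 0 < L ->
  (forall x, derivable f x 1) -> continuous (derive1 f) -> f L = f 0 ->
  (\int[mu]_(x in `]0%R, L[) (derive1 f x)%:E = 0)%E.
Proof.
move=> L0 df cf fL.
have cff : continuous f.
  by move=> x; apply: differentiable_continuous; exact/derivable1_diffP.
rewrite integral_itv_bndo_bndc; last first.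
  by apply/measurable_EFinP; apply: measurable_funS (continuous_measurable_fun cf).
rewrite integral_itv_obnd_cbnd; last first.
  by apply/measurable_EFinP; apply: measurable_funS (continuous_measurable_fun cf).
rewrite (@continuous_FTC2 _ (derive1 f) f)//.
- by rewrite fL subee.
- exact: continuous_subspaceT.
- split; first by move=> x _; exact: (@df x).
  + by apply: cvg_at_right_filter; exact: cff.
  + by apply: cvg_at_left_filter; exact: cff.
Qed.

(** The two cases are those of a slice, along a coordinate axis, of a derivative
extended by zero outside the cell: the line misses the cell or crosses it. *)
Lemma integral_patch_derive1 L (f : R -> R) (g : R -> \bar R) : 0 < L ->
  (forall x, derivable f x 1) -> continuous (derive1 f) -> f L = f 0 ->
  g = cst 0%E \/ g = (EFin \o derive1 f) \_ (`]0, L[ : set R) ->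
  (\int[mu]_x g x = 0)%E.
Proof.
move=> L0 df cf fL [->|->]; first by rewrite integral0.
by rewrite -integral_mkcond; exact: integral_derive1_periodic.
Qed.

End IntegralOmega.

(** * Integrals of derivatives of periodic functions *)
Section SigmaFiniteProduct.
Local Open Scope ereal_scope.
Context d1 d2 (T1 : measurableType d1) (T2 : measurableType d2) (R : realType).
Variables (m1 : {sigma_finite_measure set T1 -> \bar R}).
Variables (m2 : {sigma_finite_measure set T2 -> \bar R}).

Lemma product_sigma_finite : sigma_finite setT (m1 \x m2).
Proof.
have /sigma_finiteP[F [TF ndF Foo]] := sigma_finiteT m1.
have /sigma_finiteP[G [TG ndG Goo]] := sigma_finiteT m2.
exists (fun n => F n `*` G n).
  rewrite -setXTT TF TG predeqE => -[x y]; split.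
    move=> [/= [n _ Fnx] [k _ Gky]]; exists (maxn n k) => //; split.
    - by move: x Fnx; exact/subsetPset/ndF/leq_maxl.
    - by move: y Gky; exact/subsetPset/ndG/leq_maxr.
  by move=> [n _ []/= ? ?]; split; exists n.
move=> k; have [? ?] := Foo k; have [? ?] := Goo k.
split; first exact: measurableX.
by rewrite product_measure1E// lte_mul_pinfty// ge0_fin_numE.
Qed.

(** Fubini's theorem in three variables is that in two variables for the pair made
of the first two variables and of the third one, and it asks for a sigma-finite
structure on the product of the first two measures.  The structure is packed by
hand because canonical inference, from a product measure, selects an instance
that is meant for subprobabilities. *)
Definition sf_product : {sigma_finite_measure set (T1 * T2)%type -> \bar R} :=
  HB.pack (m1 \x m2) (Measure_isSigmaFinite.Build _ _ _ (m1 \x m2) product_sigma_finite).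

End SigmaFiniteProduct.

Section TripleFubini.
Local Open Scope ereal_scope.
Context d (T : measurableType d) (R : realType).
Variables (m : {sigma_finite_measure set T -> \bar R}) (f : T * T * T -> \bar R).
Hypothesis imf : ((m \x m) \x m).-integrable setT f.

Lemma triple_integral0_z : (forall x y, \int[m]_z f (x, y, z) = 0) ->
  \int[(m \x m) \x m]_p f p = 0.
Proof.
by move=> f0; rewrite -(@integral12_prod_meas1 _ _ _ _ _ (sf_product m m) m _ imf) integral0_eq// => -[x y] _; exact: f0.
Qed.

Hypothesis imf2 : forall z, (m \x m).-integrable setT (fun q => f (q, z)).

(** To integrate first in another variable than the last one, Fubini's theorem is
applied a second time on the planes of constant [z], whence the hypothesis on
the slices. *)
Lemma triple_integral0_y : (forall x z, \int[m]_y f (x, y, z) = 0) ->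
  \int[(m \x m) \x m]_p f p = 0.
Proof.
move=> f0; rewrite -(@integral21_prod_meas1 _ _ _ _ _ (sf_product m m) m _ imf) integral0_eq// => z _.
rewrite /fubini_G -(@integral12_prod_meas1 _ _ _ _ _ m m _ (imf2 z)) integral0_eq// => x _.
exact: f0.
Qed.

Lemma triple_integral0_x : (forall y z, \int[m]_x f (x, y, z) = 0) ->
  \int[(m \x m) \x m]_p f p = 0.
Proof.
move=> f0; rewrite -(@integral21_prod_meas1 _ _ _ _ _ (sf_product m m) m _ imf) integral0_eq// => z _.
rewrite /fubini_G -(@integral21_prod_meas1 _ _ _ _ _ m m _ (imf2 z)) integral0_eq// => y _.
exact: f0.
Qed.

End TripleFubini.

Section PeriodicDerivative.
Variable R : realType.
Local Notation mu := (@lebesgue_measure R).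
Local Notation mu2 := (mu \x mu)%E.
Local Notation mu3 := ((mu \x mu) \x mu)%E.
Implicit Types (u v : fun3 R) (L : R).

Lemma patch_OmegaE L u (x y z : R) :
  ((EFin \o uncurry3 u) \_ (Omega L)) (x, y, z) =
  if [&& 0 < x < L, 0 < y < L & 0 < z < L] then (u x y z)%:E else 0%E.
Proof.
rewrite patchE; congr (if _ then _ else _); rewrite /Omega !in_setX /=.
by rewrite !mem_setE !in_itv/= -!andbA.
Qed.

Lemma patch_squareE L (f : R * R -> R) (x y : R) :
  ((EFin \o f) \_ (square L)) (x, y) =
  if [&& 0 < x < L & 0 < y < L] then (f (x, y))%:E else 0%E.
Proof.
rewrite patchE; congr (if _ then _ else _); rewrite /square !in_setX /=.
by rewrite !mem_setE !in_itv/=.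
Qed.

Lemma patch_itvE L (f : R -> R) (x : R) :
  ((EFin \o f) \_ (`]0, L[ : set R)) x = if 0 < x < L then (f x)%:E else 0%E.
Proof. by rewrite patchE; congr (if _ then _ else _); rewrite !mem_setE !in_itv/=. Qed.

Lemma continuous_pair (T U V : topologicalType) (f : T -> U) (g : T -> V) :
  continuous f -> continuous g -> continuous (fun x => (f x, g x)).
Proof. by move=> cf cg x; apply: cvg_pair; [exact: cf|exact: cg]. Qed.

Lemma cont3_comp (T : topologicalType) u (f g h : T -> R) : cont3 u ->
  continuous f -> continuous g -> continuous h -> continuous (fun s => u (f s) (g s) (h s)).
Proof.
move=> cu cf cg ch x; apply: (@continuous_comp _ _ _ (fun s => (f s, g s, h s)) (uncurry3 u)).
  exact: (continuous_pair (continuous_pair cf cg) ch).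
exact: cu.
Qed.

Lemma cont3_slice_x u y z : cont3 u -> continuous (fun s => u s y z).
Proof.
by move=> cu; apply: cont3_comp => // x; [exact: cvg_id|exact: cst_continuous..].
Qed.

Lemma cont3_slice_y u x z : cont3 u -> continuous (fun s => u x s z).
Proof.
by move=> cu; apply: cont3_comp => // y;
  [exact: cst_continuous|exact: cvg_id|exact: cst_continuous].
Qed.

Lemma cont3_slice_z u x y : cont3 u -> continuous (fun s => u x y s).
Proof.
by move=> cu; apply: cont3_comp => // z;
  [exact: cst_continuous|exact: cst_continuous|exact: cvg_id].
Qed.

Lemma cont3_slice_xy u z : cont3 u -> continuous (fun q : R * R => u q.1 q.2 z).
Proof.
by move=> cu; apply: cont3_comp => // q;
  [exact: cvg_fst|exact: cvg_snd|exact: cst_continuous].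
Qed.

Let integrable_patch L u : 0 < L -> cont3 u ->
  mu3.-integrable setT ((EFin \o uncurry3 u) \_ (Omega L)).
Proof.
move=> L0 cu; rewrite -integrable_mkcond; last exact: measurable_Omega.
exact: continuous3_integrable.
Qed.

Let integrable_patch2 L (f : R * R -> R) : 0 < L -> continuous f ->
  mu2.-integrable setT ((EFin \o f) \_ (square L)).
Proof.
move=> L0 cu; rewrite -integrable_mkcond; last exact: measurable_square.
exact: continuous2_integrable.
Qed.

Let integrable_patch_slice L u z : 0 < L -> cont3 u ->
  mu2.-integrable setT (fun q => ((EFin \o uncurry3 u) \_ (Omega L)) (q, z)).
Proof.
move=> L0 cu; have [h|h] := boolP (0 < z < L); last first.
  rewrite (_ : (fun _ => _) = cst 0%E); first exact: integrable0.
  by apply/funext => -[x y]; rewrite patch_OmegaE (negbTE h) !andbF.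
rewrite (_ : (fun _ => _) = (EFin \o (fun q => u q.1 q.2 z)) \_ (square L)).
  by apply: integrable_patch2 => //; exact: cont3_slice_xy.
by apply/funext => -[x y]; rewrite patch_OmegaE patch_squareE h andbT.
Qed.

Lemma integral_Omega_dz L v : 0 < L -> cont3 (dz v) ->
  (forall x y z, derivable (fun s => v x y s) z 1) ->
  (forall x y, v x y L = v x y 0) -> integral_Omega L (dz v) = 0.
Proof.
move=> L0 cv dv pv; rewrite /integral_Omega /Rintegral integral_mkcond.
apply: (congr1 fine (_ : _ = 0%E)).
apply: (triple_integral0_z (integrable_patch L0 cv)) => x y.
apply: (@integral_patch_derive1 _ L (v x y)) => //.
- exact: (@cont3_slice_z (dz v) x y).
- have [h|h] := boolP ((0 < x < L) && (0 < y < L)); [right|left]; apply/funext => z.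
  + by rewrite patch_OmegaE patch_itvE; move: h => /andP[-> ->].
  + by rewrite patch_OmegaE andbA (negbTE h).
Qed.

Lemma integral_Omega_dx L v : 0 < L -> cont3 (dx v) ->
  (forall x y z, derivable (fun s => v s y z) x 1) ->
  (forall y z, v L y z = v 0 y z) -> integral_Omega L (dx v) = 0.
Proof.
move=> L0 cv dv pv; rewrite /integral_Omega /Rintegral integral_mkcond.
apply: (congr1 fine (_ : _ = 0%E)).
apply: (triple_integral0_x (integrable_patch L0 cv)) => [z|y z].
  exact: integrable_patch_slice.
apply: (@integral_patch_derive1 _ L (fun s => v s y z)) => //.
- exact: (@cont3_slice_x (dx v) y z).
- have [h|h] := boolP ((0 < y < L) && (0 < z < L)); [right|left]; apply/funext => x.
  + by rewrite patch_OmegaE patch_itvE h andbT.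
  + by rewrite patch_OmegaE (negbTE h) andbF.
Qed.

Lemma integral_Omega_dy L v : 0 < L -> cont3 (dy v) ->
  (forall x y z, derivable (fun s => v x s z) y 1) ->
  (forall x z, v x L z = v x 0 z) -> integral_Omega L (dy v) = 0.
Proof.
move=> L0 cv dv pv; rewrite /integral_Omega /Rintegral integral_mkcond.
apply: (congr1 fine (_ : _ = 0%E)).
apply: (triple_integral0_y (integrable_patch L0 cv)) => [z|x z].
  exact: integrable_patch_slice.
apply: (@integral_patch_derive1 _ L (fun s => v x s z)) => //.
- exact: (@cont3_slice_y (dy v) x z).
- have [h|h] := boolP ((0 < x < L) && (0 < z < L)); [right|left]; apply/funext => y.
  + by rewrite patch_OmegaE patch_itvE; move: h => /andP[-> ->]; rewrite andbT.
  + by rewrite patch_OmegaE andbCA (negbTE h) andbF.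
Qed.

End PeriodicDerivative.

(** * Trigonometric polynomials *)
Section Phases.
Variable R : realType.
Implicit Types (L x y z : R) (l m n : int) (u v : fun3 R) (K : nat).

Definition wavenum L l : R := 2 * pi * l%:~R / L.

Lemma phaseE L l m n x y z :
  phase L l m n x y z = wavenum L l * x + wavenum L m * y + wavenum L n * z.
Proof. by rewrite /phase /wavenum; ring. Qed.

Lemma is_derive_affine (k b x : R) : is_derive x 1 (fun s => k * s + b) k.
Proof.
have -> : (fun s => k * s + b) = (k \*: (@id R)) \+ cst b by apply/funext.
have H1 : is_derive x 1 (k \*: (@id R)) (k *: 1) by apply: is_deriveZ.
have := @is_deriveD _ _ _ (k \*: (@id R)) (cst b) x 1 (k *: 1) 0 H1 (is_derive_cst _ _ _).
by rewrite addr0 /GRing.scale /= mulr1.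
Qed.

Lemma is_derive_cos_comp (f : R -> R) x k : is_derive x 1 f k ->
  is_derive x 1 (fun s => cos (f s)) (- (k * sin (f x))).
Proof.
move=> df; have := @is_derive1_comp _ cos f x _ _ (is_derive_cos (f x)) df.
by rewrite mulNr mulrC.
Qed.

Lemma is_derive_sin_comp (f : R -> R) x k : is_derive x 1 f k ->
  is_derive x 1 (fun s => sin (f s)) (k * cos (f x)).
Proof.
move=> df; have := @is_derive1_comp _ sin f x _ _ (is_derive_sin (f x)) df.
by rewrite mulrC.
Qed.

Lemma is_deriveM1 (f g : R -> R) x a b : is_derive x 1 f a -> is_derive x 1 g b ->
  is_derive x 1 (fun s => f s * g s) (a * g x + f x * b).
Proof.
move=> df dg; have := is_deriveM df dg; rewrite /GRing.scale /= => H.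
by rewrite addrC [a * _]mulrC.
Qed.

Lemma is_deriveZ1 (f : R -> R) x a k : is_derive x 1 f a ->
  is_derive x 1 (fun s => k * f s) (k * a).
Proof. by move=> df; have := is_deriveZ k df. Qed.

Lemma is_deriveD1 (f g : R -> R) x a b : is_derive x 1 f a -> is_derive x 1 g b ->
  is_derive x 1 (fun s => f s + g s) (a + b).
Proof. by move=> df dg; have := is_deriveD df dg. Qed.

Lemma is_derive_trig_sum (I : Type) (s : seq I) (a b k : I -> R) (ph : I -> R -> R) x :
  (forall q, is_derive x 1 (ph q) (k q)) ->
  is_derive x 1 (fun t => \sum_(q <- s) (a q * cos (ph q t) - b q * sin (ph q t)))
    (\sum_(q <- s) (- (b q * k q) * cos (ph q x) - (a q * k q) * sin (ph q x))).
Proof.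
move=> dph; elim: s => [|q s IHs].
  have -> : (fun t : R => \sum_(q <- [::]) (a q * cos (ph q t) - b q * sin (ph q t))) = cst 0.
    by apply/funext => t; rewrite big_nil.
  by rewrite big_nil; exact: is_derive_cst.
have -> : (fun t : R => \sum_(j <- q :: s) (a j * cos (ph j t) - b j * sin (ph j t))) =
  (fun t => (a q * cos (ph q t) + (- b q) * sin (ph q t)) +
     \sum_(j <- s) (a j * cos (ph j t) - b j * sin (ph j t))).
  by apply/funext => t; rewrite big_cons mulNr.
rewrite big_cons; apply: is_deriveD1 => //.
have := is_deriveD1 (is_deriveZ1 (a q) (is_derive_cos_comp (dph q)))
                    (is_deriveZ1 (- b q) (is_derive_sin_comp (dph q))).
set X := (X in is_derive _ _ _ X) => H; set Y := (X in is_derive _ _ _ X).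
by have -> : Y = X by rewrite /X /Y; ring.
Qed.

Lemma is_derive_derive1 (f : R -> R) x a : is_derive x 1 f a -> derive1 f x = a.
Proof. by move=> df; rewrite derive1E; exact: derive_val. Qed.

(** The three directions, so that the partial derivatives are treated
simultaneously. *)
Inductive axis := AxX | AxY | AxZ.
Implicit Types a : axis.

Definition coord a (T : Type) (x y z : T) : T :=
  match a with AxX => x | AxY => y | AxZ => z end.

Definition slice a u x y z : R -> R :=
  match a with
  | AxX => fun s => u s y z | AxY => fun s => u x s z | AxZ => fun s => u x y s
  end.

Definition partial1 a : fun3 R -> fun3 R :=
  match a with AxX => @dx R | AxY => @dy R | AxZ => @dz R end.

Definition derive_along a u u' :=
  forall x y z, is_derive (coord a x y z) 1 (slice a u x y z) (u' x y z).

Definition derivable_along a u :=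
  forall x y z, derivable (slice a u x y z) (coord a x y z) 1.

Lemma sliceE a u x y z : slice a u x y z (coord a x y z) = u x y z.
Proof. by case: a. Qed.

Lemma partial1E a u u' : derive_along a u u' -> partial1 a u = u'.
Proof.
by case: a => du; apply: funext3 => x y z; exact: (is_derive_derive1 (du x y z)).
Qed.

Lemma derive_along_partial1 a u : derivable_along a u -> derive_along a u (partial1 a u).
Proof.
by case: a => du x y z; rewrite /= ?/dx ?/dy ?/dz derive1E; apply: derivableP; exact: du.
Qed.

Lemma derive_alongM a u u' v v' : derive_along a u u' -> derive_along a v v' ->
  derive_along a (fun x y z => u x y z * v x y z)
    (fun x y z => u' x y z * v x y z + u x y z * v' x y z).
Proof.
move=> du dv x y z; have := is_deriveM1 (du x y z) (dv x y z).
by rewrite !sliceE; case: a {du dv}.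
Qed.

Lemma derive_along_phase a L l m n :
  derive_along a (phase L l m n) (fun _ _ _ => wavenum L (coord a l m n)).
Proof.
move=> x y z; pose b := phase L l m n x y z - wavenum L (coord a l m n) * coord a x y z.
have -> : slice a (phase L l m n) x y z = (fun s => wavenum L (coord a l m n) * s + b).
  by rewrite /b; case: a {b}; apply/funext => s; rewrite /= !phaseE; ring.
exact: is_derive_affine.
Qed.

Definition triples (s : seq int) : seq (int * int * int) :=
  [seq (lm, n) | lm <- [seq (l, m) | l <- s, m <- s], n <- s].

Lemma sum_triples (V : nmodType) (s : seq int) (F : int -> int -> int -> V) :
  \sum_(l <- s) \sum_(m <- s) \sum_(n <- s) F l m n =
  \sum_(q <- triples s) F q.1.1 q.1.2 q.2.
Proof. by rewrite /triples big_allpairs_dep big_allpairs_dep. Qed.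

Lemma uniq_triples s : uniq s -> uniq (triples s).
Proof.
move=> us; apply: allpairs_uniq => //; last by move=> [? ?] [? ?] _ _ [-> ->].
by apply: allpairs_uniq => // -[? ?] [? ?] _ _ [-> ->].
Qed.

Lemma mem_triples s q : q \in triples s -> [/\ q.1.1 \in s, q.1.2 \in s & q.2 \in s].
Proof.
case: q => -[l m] n /allpairsP[[lm n'] [lmK nK [Elm ->]]].
by move: lmK; rewrite -Elm => /allpairsP[[l' m'] [lK mK [-> ->]]].
Qed.

Definition modes3 K := triples (modes K).

Lemma sum_modes3 (V : nmodType) K (F : int -> int -> int -> V) :
  \sum_(l <- modes K) \sum_(m <- modes K) \sum_(n <- modes K) F l m n =
  \sum_(q <- modes3 K) F q.1.1 q.1.2 q.2.
Proof. exact: sum_triples. Qed.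

Lemma uniq_modes K : uniq (modes K).
Proof.
rewrite /modes map_inj_uniq ?iota_uniq// => i j.
by move/(congr1 (fun t => t + K%:Z)); rewrite !subrK => -[].
Qed.

Lemma uniq_modes3 K : uniq (modes3 K).
Proof. exact: uniq_triples (uniq_modes K). Qed.

Definition mode_phase L (q : int * int * int) x y z : R := phase L q.1.1 q.1.2 q.2 x y z.

Lemma Re_sum (I : Type) (s : seq I) (F : I -> R[i]) :
  complex.Re (\sum_(i <- s) F i) = \sum_(i <- s) complex.Re (F i).
Proof.
elim: s => [|i s IHs]; first by rewrite !big_nil.
by rewrite !big_cons -IHs; case: (F i); case: (\sum_(j <- s) F j).
Qed.

Definition coef3 (c : int -> int -> int -> R[i]) (q : int * int * int) := c q.1.1 q.1.2 q.2.

Lemma trig_polyE L K c x y z : trig_poly L K c x y z =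
  \sum_(q <- modes3 K) (complex.Re (coef3 c q) * cos (mode_phase L q x y z) -
                        complex.Im (coef3 c q) * sin (mode_phase L q x y z)).
Proof.
rewrite /trig_poly (@sum_modes3 R[i] K (fun l m n => c l m n * cis (phase L l m n x y z))).
rewrite Re_sum; apply: eq_bigr => q _; rewrite /coef3 /cis /mode_phase.
by case: (c _ _ _).
Qed.

Lemma partial1_trig_poly a L K c : partial1 a (trig_poly L K c) =
  trig_poly L K (fun l m n => c l m n * (0 +i* wavenum L (coord a l m n))).
Proof.
apply: partial1E => x y z.
have -> : slice a (trig_poly L K c) x y z = (fun s => \sum_(q <- modes3 K)
    (complex.Re (coef3 c q) * cos (slice a (mode_phase L q) x y z s) -
     complex.Im (coef3 c q) * sin (slice a (mode_phase L q) x y z s))).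
  by case: a; apply/funext => s; rewrite /= trig_polyE.
have := is_derive_trig_sum (modes3 K) (fun q => complex.Re (coef3 c q))
  (fun q => complex.Im (coef3 c q)) (fun q => derive_along_phase a L q.1.1 q.1.2 q.2 x y z).
set X := (X in is_derive _ _ _ X) => H; rewrite trig_polyE; set Y := (Y in is_derive _ _ _ Y).
suff -> : Y = X by exact: H.
apply: eq_bigr => q _; rewrite -/(mode_phase L q) sliceE /coef3.
by case: (c _ _ _) => u v /=; ring.
Qed.

Lemma iter_partial1_trig_poly a d L K c : iter d (partial1 a) (trig_poly L K c) =
  trig_poly L K (fun l m n => c l m n * (0 +i* wavenum L (coord a l m n)) ^+ d).
Proof.
elim: d => [|d IHd] /=; first by congr trig_poly; apply: funext3 => l m n; rewrite expr0 mulr1.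
rewrite IHd partial1_trig_poly; congr trig_poly.
by apply: funext3 => l m n; rewrite exprSr mulrA.
Qed.

Definition sqnormc (c : R[i]) : R := complex.Re c ^+ 2 + complex.Im c ^+ 2.

Lemma sqnormc_ge0 c : 0 <= sqnormc c. Proof. by rewrite addr_ge0// sqr_ge0. Qed.

Lemma sqnormcM c d : sqnormc (c * d) = sqnormc c * sqnormc d.
Proof. by case: c => a b; case: d => a' b'; rewrite /sqnormc /=; ring. Qed.

Lemma partial_trig_poly L K c (a b d : nat) :
  partial a b d (trig_poly L K c) = trig_poly L K (fun l m n => c l m n *
    ((0 +i* wavenum L n) ^+ d * (0 +i* wavenum L m) ^+ b * (0 +i* wavenum L l) ^+ a)).
Proof.
rewrite /partial (iter_partial1_trig_poly AxZ) (iter_partial1_trig_poly AxY) (iter_partial1_trig_poly AxX).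
by congr trig_poly; apply: funext3 => l m n; rewrite !mulrA.
Qed.

Lemma sqnormc_iwavenumX (k : R) j : sqnormc ((0 +i* k) ^+ j) = k ^+ (2 * j).
Proof.
elim: j => [|j IHj]; first by rewrite /sqnormc !expr0 /=; ring.
by rewrite exprS sqnormcM IHj mulnS exprD /sqnormc /=; ring.
Qed.

End Phases.

(** * Fourier coefficients of derivatives *)
Section FourierIntegrals.
Variable R : realType.
Implicit Types (a : axis) (L x y z : R) (l m n : int) (u v : fun3 R) (K : nat).

Lemma periodic_int (f : R -> R) (T : R) : periodic f T ->
  forall (l : int) (a : R), f (a + T * l%:~R) = f a.
Proof.
move=> pf; case=> n a.
  by rewrite -[RHS](periodicn pf n) -mulr_natr.
rewrite -[LHS](periodicn pf n.+1) -mulr_natr NegzE; congr f.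
by rewrite rmorphN /= -natz; ring.
Qed.

Lemma cosD2pil l (a : R) : cos (a + 2 * pi * l%:~R) = cos a.
Proof. by apply: (@periodic_int cos); rewrite mulr_natl; exact: cosD2pi. Qed.

Lemma sinD2pil l (a : R) : sin (a + 2 * pi * l%:~R) = sin a.
Proof. by apply: (@periodic_int sin); rewrite mulr_natl; exact: sinD2pi. Qed.

Lemma wavenumL L l : L != 0 -> wavenum L l * L = 2 * pi * l%:~R.
Proof. by move=> L0; rewrite /wavenum divfK. Qed.

Lemma phaseDx L l m n x y z : L != 0 ->
  phase L l m n (x + L) y z = phase L l m n x y z + 2 * pi * l%:~R.
Proof. by move=> L0; rewrite !phaseE -(wavenumL l L0); ring. Qed.
Lemma phaseDy L l m n x y z : L != 0 ->
  phase L l m n x (y + L) z = phase L l m n x y z + 2 * pi * m%:~R.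
Proof. by move=> L0; rewrite !phaseE -(wavenumL m L0); ring. Qed.
Lemma phaseDz L l m n x y z : L != 0 ->
  phase L l m n x y (z + L) = phase L l m n x y z + 2 * pi * n%:~R.
Proof. by move=> L0; rewrite !phaseE -(wavenumL n L0); ring. Qed.

Lemma cont3_phase L l m n : cont3 (phase L l m n).
Proof.
have -> : phase L l m n = (fun x y z => wavenum L l * x + wavenum L m * y + wavenum L n * z).
  by apply: funext3 => x y z; rewrite phaseE.
apply: cont3D; first apply: cont3D; apply: cont3M; try exact: cont3_cst.
- by move=> p; apply: (@continuous_comp _ _ _ fst fst); exact: cvg_fst.
- by move=> p; apply: (@continuous_comp _ _ _ fst snd); [exact: cvg_fst|exact: cvg_snd].
- by move=> p; exact: cvg_snd.
Qed.

Definition cosph L l m n : fun3 R := fun x y z => cos (phase L l m n x y z).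
Definition sinph L l m n : fun3 R := fun x y z => sin (phase L l m n x y z).

Lemma cont3_cosph L l m n : cont3 (cosph L l m n).
Proof.
move=> p; apply: (@continuous_comp _ _ _ (uncurry3 (phase L l m n)) (@cos R)).
  exact: cont3_phase.
exact: continuous_cos.
Qed.

Lemma cont3_sinph L l m n : cont3 (sinph L l m n).
Proof.
move=> p; apply: (@continuous_comp _ _ _ (uncurry3 (phase L l m n)) (@sin R)).
  exact: cont3_phase.
exact: continuous_sin.
Qed.

Lemma periodic3_cosph L l m n : L != 0 -> periodic3 L (cosph L l m n).
Proof. by move=> L0 x y z; rewrite /cosph phaseDx// phaseDy// phaseDz// !cosD2pil. Qed.

Lemma periodic3_sinph L l m n : L != 0 -> periodic3 L (sinph L l m n).
Proof. by move=> L0 x y z; rewrite /sinph phaseDx// phaseDy// phaseDz// !sinD2pil. Qed.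

Lemma derive_along_cosph a L l m n : derive_along a (cosph L l m n)
  (fun x y z => - wavenum L (coord a l m n) * sinph L l m n x y z).
Proof.
move=> x y z; have := is_derive_cos_comp (derive_along_phase a L l m n x y z).
by rewrite sliceE mulNr; case: a.
Qed.

Lemma derive_along_sinph a L l m n : derive_along a (sinph L l m n)
  (fun x y z => wavenum L (coord a l m n) * cosph L l m n x y z).
Proof.
move=> x y z; have := is_derive_sin_comp (derive_along_phase a L l m n x y z).
by rewrite sliceE; case: a.
Qed.

Lemma integral_derive_along0 a L v v' : 0 < L -> cont3 v' -> derive_along a v v' ->
  periodic3 L v -> integral_Omega L v' = 0.
Proof.
move=> L0 cv' dv pv; rewrite -(partial1E dv) in cv' *.
have ex x y z := @ex_derive _ _ _ _ _ _ _ (dv x y z).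
case: a {dv} cv' ex => cv' ex.
- by apply: integral_Omega_dx => // y z; have [+ _ _] := pv 0 y z; rewrite add0r.
- by apply: integral_Omega_dy => // x z; have [_ + _] := pv x 0 z; rewrite add0r.
- by apply: integral_Omega_dz => // x y; have [_ _ +] := pv x y 0; rewrite add0r.
Qed.

(** The product of the two periodic functions is periodic, so that its derivative
has zero integral. *)
Lemma integral_parts a L u u' w w' : 0 < L -> cont3 u -> cont3 u' -> derive_along a u u' ->
  periodic3 L u -> cont3 w -> cont3 w' -> derive_along a w w' -> periodic3 L w ->
  integral_Omega L (fun x y z => u' x y z * w x y z) =
  - integral_Omega L (fun x y z => u x y z * w' x y z).
Proof.
move=> L0 cu cu' du pu cw cw' dw pw; apply/eqP; rewrite -addr_eq0; apply/eqP.
rewrite -integral_OmegaD//; [|exact: cont3M..].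
apply: (integral_derive_along0 L0 _ (derive_alongM du dw)).
  by apply: cont3D; exact: cont3M.
by move=> x y z; have [-> -> ->] := pu x y z; have [-> -> ->] := pw x y z.
Qed.

Let cont3_kcos L l m n k : cont3 (fun x y z => k * cosph L l m n x y z).
Proof. by apply: cont3M; [exact: cont3_cst|exact: cont3_cosph]. Qed.
Let cont3_ksin L l m n k : cont3 (fun x y z => k * sinph L l m n x y z).
Proof. by apply: cont3M; [exact: cont3_cst|exact: cont3_sinph]. Qed.

Let integral_kM L u v k : 0 < L -> cont3 u -> cont3 v ->
  integral_Omega L (fun x y z => u x y z * (k * v x y z)) =
  k * integral_Omega L (fun x y z => u x y z * v x y z).
Proof.
move=> L0 cu cv; rewrite -integral_OmegaZ//; last exact: cont3M.
by congr integral_Omega; apply: funext3 => x y z; ring.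
Qed.

(** Integration by parts exchanges the cosine and sine coefficients, up to sign, and
multiplies them by the wave number. *)
Lemma sqnormc_fourier_derive a L l m n u u' : 0 < L ->
  cont3 u -> cont3 u' -> derive_along a u u' -> periodic3 L u ->
  sqnormc (fourier_coef L u' l m n) = wavenum L (coord a l m n) ^+ 2 * sqnormc (fourier_coef L u l m n).
Proof.
move=> L0 cu cu' du pu; have L0' : L != 0 by rewrite gt_eqF.
have Ic := integral_parts L0 cu cu' du pu (@cont3_cosph L l m n) (@cont3_ksin L l m n _)
  (derive_along_cosph a L l m n) (periodic3_cosph l m n L0').
have Is := integral_parts L0 cu cu' du pu (@cont3_sinph L l m n) (@cont3_kcos L l m n _)
  (derive_along_sinph a L l m n) (periodic3_sinph l m n L0').
rewrite integral_kM// in Ic; last exact: cont3_sinph.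
rewrite integral_kM// in Is; last exact: cont3_cosph.
by rewrite /sqnormc /fourier_coef /= Ic Is; ring.
Qed.

(** If one of the wave numbers is not zero, then the sine and the cosine are
derivatives of periodic functions in the corresponding direction. *)
Lemma integral_phase0 L q : 0 < L -> q != (0, 0, 0) ->
  integral_Omega L (cosph L q.1.1 q.1.2 q.2) = 0 /\
  integral_Omega L (sinph L q.1.1 q.1.2 q.2) = 0.
Proof.
move=> L0 q0; have L0' : L != 0 by rewrite gt_eqF.
case: q q0 => -[l m] n q0 /=.
have [a ka] : exists a, coord a l m n != 0.
  have [l0|] := eqVneq l 0; last by exists AxX.
  have [m0|] := eqVneq m 0; last by exists AxY.
  by exists AxZ; apply: contraNneq q0 => /= ->; rewrite l0 m0.
have {}ka : wavenum L (coord a l m n) != 0.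
  by rewrite !mulf_neq0// ?intr_eq0 ?invr_eq0// gt_eqF// pi_gt0.
have zero k (I : R) : k != 0 -> k * I = 0 -> I = 0.
  by move=> k0 /eqP; rewrite mulf_eq0 (negbTE k0) => /eqP.
split.
- apply: (zero _ _ ka); rewrite -integral_OmegaZ//; last exact: cont3_cosph.
  exact: integral_derive_along0 L0 (@cont3_kcos _ _ _ _ _) (derive_along_sinph a L l m n)
    (periodic3_sinph l m n L0').
- apply: (zero (- wavenum L (coord a l m n))); first by rewrite oppr_eq0.
  rewrite -integral_OmegaZ//; last exact: cont3_sinph.
  exact: integral_derive_along0 L0 (@cont3_ksin _ _ _ _ _) (derive_along_cosph a L l m n)
    (periodic3_cosph l m n L0').
Qed.

End FourierIntegrals.

(** * Decay of Fourier coefficients *)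
Section FourierDecay.
Variable R : realType.
Implicit Types (a : axis) (L x y z : R) (l m n : int) (u v : fun3 R) (K : nat).

Let derive1_shift (f : R -> R) L : (forall t, derivable f t 1) -> (forall t, f (t + L) = f t) ->
  forall t, derive1 f (t + L) = derive1 f t.
Proof.
move=> df pf t; apply/esym/is_derive_derive1.
have H : is_derive (1 * t + L) 1 f (derive1 f (t + L)).
  by rewrite mul1r derive1E; apply: derivableP; exact: df.
have := @is_derive1_comp _ f (fun s => 1 * s + L) t _ _ H (is_derive_affine 1 L t).
rewrite mulr1 (_ : f \o _ = f)//.
by apply/funext => s /=; rewrite mul1r pf.
Qed.

Lemma periodic3_partial1 a L u : derivable_along a u -> periodic3 L u -> periodic3 L (partial1 a u).
Proof.
case: a => du pu x y z; split.
- by apply: (derive1_shift (fun t => du t y z)) => t; case: (pu t y z).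
- by congr (derive1 _ _); apply/funext => s; case: (pu s y z).
- by congr (derive1 _ _); apply/funext => s; case: (pu s y z).
- by congr (derive1 _ _); apply/funext => s; case: (pu x s z).
- by apply: (derive1_shift (fun t => du x t z)) => t; case: (pu x t z).
- by congr (derive1 _ _); apply/funext => s; case: (pu x s z).
- by congr (derive1 _ _); apply/funext => s; case: (pu x y s).
- by congr (derive1 _ _); apply/funext => s; case: (pu x y s).
- by apply: (derive1_shift (fun t => du x y t)) => t; case: (pu x y t).
Qed.

Lemma class_C_cont3 s u : class_C s u -> cont3 u.
Proof. by case: s => [|s] []. Qed.

Lemma class_C_partial1 a s u : class_C s.+1 u -> derivable_along a u /\ class_C s (partial1 a u).
Proof. by move=> /= [_ [du [cx cy cz]]]; case: a; split => // x y z; case: (du x y z). Qed.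

Lemma fourier_iter_partial1 a L l m n d s u : 0 < L -> class_C (d + s) u -> periodic3 L u ->
  [/\ class_C s (iter d (partial1 a) u), periodic3 L (iter d (partial1 a) u) &
      sqnormc (fourier_coef L (iter d (partial1 a) u) l m n) =
      wavenum L (coord a l m n) ^+ (2 * d) * sqnormc (fourier_coef L u l m n)].
Proof.
move=> L0; elim: d s => [|d IHd] s cu pu.
  by split => //=; rewrite muln0 expr0 mul1r.
have {IHd}[cd pp Ed] := IHd s.+1 ltac:(by rewrite addnS) pu.
have [dd cdd] := class_C_partial1 a cd.
split => //=; first exact: periodic3_partial1.
rewrite (sqnormc_fourier_derive _ _ _ L0 (class_C_cont3 cd) (class_C_cont3 cdd) (derive_along_partial1 dd) pp).
by rewrite Ed mulnS exprD mulrA.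
Qed.

Lemma fourier_partial L l m n (a b d s : nat) u : 0 < L -> class_C (d + (b + (a + s))) u ->
  periodic3 L u ->
  cont3 (partial a b d u) /\ sqnormc (fourier_coef L (partial a b d u) l m n) =
      wavenum L l ^+ (2 * a) * wavenum L m ^+ (2 * b) * wavenum L n ^+ (2 * d) *
      sqnormc (fourier_coef L u l m n).
Proof.
move=> L0 cu pu; have [c1 p1 e1] := fourier_iter_partial1 AxZ l m n L0 cu pu.
have [c2 p2 e2] := fourier_iter_partial1 AxY l m n L0 c1 p1.
have [c3 p3 e3] := fourier_iter_partial1 AxX l m n L0 c2 p2.
split; first exact: class_C_cont3 c3.
by apply: etrans e3 _; rewrite e2 e1 !mulrA.
Qed.

(** Since [|u w| <= (u^2 + 1) / 2] if [|w| <= 1], the mean square of [u] bounds its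
Fourier coefficients. *)
Lemma sqnormc_fourier_le L l m n u (I : R) : 0 < L -> cont3 u ->
  integral_Omega L (fun x y z => u x y z ^+ 2) <= I ->
  sqnormc (fourier_coef L u l m n) <= 2 * ((I / L ^+ 3 + 1) / 2) ^+ 2.
Proof.
move=> L0 cu uI; have L30 : 0 < L ^+ 3 by rewrite exprn_gt0.
have bnd w : cont3 w -> (forall x y z, `|w x y z| <= 1) ->
  ((L ^+ 3)^-1 * integral_Omega L (fun x y z => u x y z * w x y z)) ^+ 2 <=
  ((I / L ^+ 3 + 1) / 2) ^+ 2.
  move=> cw w1; rewrite -real_normK ?num_real// ler_pXn2r ?nnegrE//; last first.
    rewrite divr_ge0// addr_ge0// divr_ge0 ?(ltW L30)//; apply: le_trans uI.
    by apply: integral_Omega_ge0 => x y z; exact: sqr_ge0.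
  have cus : cont3 (fun x y z => 2^-1 * (u x y z ^+ 2 + 1)).
    apply: (@cont3M _ (fun _ _ _ => 2^-1) (fun x y z => u x y z ^+ 2 + 1)).
      exact: cont3_cst.
    by apply: cont3D; [exact: cont3_sqr|exact: cont3_cst].
  have E : integral_Omega L (fun x y z => 2^-1 * (u x y z ^+ 2 + 1)) <= 2^-1 * (I + L ^+ 3).
    rewrite integral_OmegaZ//; last by apply: cont3D; [exact: cont3_sqr|exact: cont3_cst].
    rewrite ler_pM2l ?invr_gt0// integral_OmegaD//; [|exact: cont3_sqr|exact: cont3_cst].
    by rewrite integral_Omega_cst// mul1r lerD2r.
  have bw x y z : `|u x y z * w x y z| <= 2^-1 * (u x y z ^+ 2 + 1).
    rewrite normrM; have := w1 x y z; have := normr_ge0 (w x y z).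
    have := normr_ge0 (u x y z); rewrite -[u x y z ^+ 2]real_normK ?num_real//.
    set p := `|u x y z|; set q := `|w x y z| => p0 q0 q1.
    have pq : p * q <= p by rewrite ler_piMr.
    have := sqr_ge0 (p - 1); rewrite sqrrB expr1n mulr1 => p1.
    by move: p1 pq; lra.
  have U : integral_Omega L (fun x y z => u x y z * w x y z) <= 2^-1 * (I + L ^+ 3).
    apply: le_trans E; apply: le_integral_Omega => //; first exact: cont3M.
    by move=> x y z; exact: le_trans (ler_norm _) (bw x y z).
  have V : - integral_Omega L (fun x y z => u x y z * w x y z) <= 2^-1 * (I + L ^+ 3).
    rewrite -mulN1r -integral_OmegaZ//; last exact: cont3M.
    apply: le_trans E; apply: le_integral_Omega => //.
      by apply: cont3M; [exact: cont3_cst|exact: cont3M].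
    by move=> x y z; rewrite mulN1r; apply: le_trans (bw x y z); rewrite -normrN ler_norm.
  rewrite normrM ger0_norm ?invr_ge0 ?(ltW L30)// mulrC ler_pdivrMr//.
  have -> : (I / L ^+ 3 + 1) / 2 * L ^+ 3 = 2^-1 * (I + L ^+ 3) by field; rewrite gt_eqF.
  by rewrite ler_norml; apply/andP; split=> //; rewrite lerNl.
rewrite /sqnormc /fourier_coef /= sqrrN mulrDl mul1r lerD//; apply: bnd.
- exact: cont3_cosph.
- by move=> x y z; exact: cos_max.
- exact: cont3_sinph.
- by move=> x y z; exact: sin_max.
Qed.

Lemma sobolev_partial_le L s u (B : R) (a b d : nat) : (a + b + d <= s)%N ->
  sobolev_norm L s u <= B ->
  integral_Omega L (fun x y z => partial a b d u x y z ^+ 2) <= B ^+ 2.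
Proof.
move=> abd uB.
pose F (a b c : nat) := integral_Omega L (fun x y z => partial a b c u x y z ^+ 2).
have F0 (a' b' c : nat) : 0 <= F a' b' c by apply: integral_Omega_ge0 => x y z; exact: sqr_ge0.
have S0 : 0 <= \sum_(a < s.+1) \sum_(b < s.+1) \sum_(c < s.+1 | (a + b + c <= s)%N) F a b c.
  by apply: sumr_ge0 => i _; apply: sumr_ge0 => j _; exact: sumr_ge0.
have -> : B ^+ 2 = `|B| ^+ 2 by rewrite real_normK ?num_real.
apply: (@le_trans _ _ (sobolev_norm L s u ^+ 2)); last first.
  have N0 : 0 <= sobolev_norm L s u by exact: sqrtr_ge0.
  by rewrite ler_pXn2r ?nnegrE//; exact: le_trans uB (ler_norm B).
rewrite /sobolev_norm sqr_sqrtr//.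
have aS : (a < s.+1)%N by lia.
have bS : (b < s.+1)%N by lia.
have dS : (d < s.+1)%N by lia.
rewrite (bigD1 (Ordinal aS))//= (bigD1 (Ordinal bS))//= (bigD1 (Ordinal dS))//= -!addrA.
rewrite lerDl; apply: addr_ge0; first by apply: sumr_ge0 => i _; exact: F0.
apply: addr_ge0; first by apply: sumr_ge0 => i _; apply: sumr_ge0 => j _; exact: F0.
by apply: sumr_ge0 => i _; apply: sumr_ge0 => j _; apply: sumr_ge0 => k _; exact: F0.
Qed.

(** Each derivative multiplies a Fourier coefficient by a wave number, and the
coefficients of the derivatives are bounded by the Sobolev norm. *)
Lemma fourier_decay L s u (B : R) l m n (a b d : nat) : 0 < L -> class_C s u -> periodic3 L u ->
  sobolev_norm L s u <= B -> (a + b + d <= s)%N ->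
  wavenum L l ^+ (2 * a) * wavenum L m ^+ (2 * b) * wavenum L n ^+ (2 * d) *
      sqnormc (fourier_coef L u l m n) <= 2 * ((B ^+ 2 / L ^+ 3 + 1) / 2) ^+ 2.
Proof.
move=> L0 cu pu uB abd.
have [cp <-] : cont3 (partial a b d u) /\ sqnormc (fourier_coef L (partial a b d u) l m n) =
      wavenum L l ^+ (2 * a) * wavenum L m ^+ (2 * b) * wavenum L n ^+ (2 * d) *
      sqnormc (fourier_coef L u l m n).
  apply: (@fourier_partial L l m n a b d (s - (a + b + d))) => //.
  by have -> : (d + (b + (a + (s - (a + b + d)))))%N = s by lia.
by apply: sqnormc_fourier_le => //; exact: sobolev_partial_le uB.
Qed.

Lemma integral_cosph L q : 0 < L ->
  integral_Omega L (cosph L q.1.1 q.1.2 q.2) = if q == (0, 0, 0) then L ^+ 3 else 0.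
Proof.
move=> L0; case: eqP => [->|/eqP q0]; last by have [] := integral_phase0 L0 q0.
rewrite /= -[RHS]mul1r -integral_Omega_cst//; congr integral_Omega; apply: funext3 => x y z.
by rewrite /cosph /phase !mul0r !addr0 mulr0 mul0r cos0.
Qed.

Lemma integral_sinph L q : 0 < L -> integral_Omega L (sinph L q.1.1 q.1.2 q.2) = 0.
Proof.
move=> L0; have [->|q0] := eqVneq q (0, 0, 0); last by have [] := integral_phase0 L0 q0.
rewrite /= -(mul0r (L ^+ 3)) -integral_Omega_cst//; congr integral_Omega; apply: funext3 => x y z.
by rewrite /sinph /phase !mul0r !addr0 mulr0 mul0r sin0.
Qed.

Lemma sum_sqr_mul (I : Type) (s : seq I) (F : I -> R) :
  (\sum_(i <- s) F i) ^+ 2 = \sum_(i <- s) \sum_(j <- s) F i * F j.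
Proof. by rewrite expr2 big_distrl /=; apply: eq_bigr => i _; rewrite big_distrr. Qed.

Let sub3 (q q' : int * int * int) := (q.1.1 - q'.1.1, q.1.2 - q'.1.2, q.2 - q'.2).

Let mode_phaseB L q q' x y z : mode_phase L (sub3 q q') x y z = mode_phase L q x y z - mode_phase L q' x y z.
Proof. by rewrite /mode_phase /phase /= !rmorphB /=; ring. Qed.

(** With [U] and [V] the real and imaginary parts of the complex sum, the double
sum that expands [U^2 + V^2] involves the phases through their differences only,
so that the off-diagonal terms integrate to zero.  Neglecting [V^2] makes this an
inequality, for arbitrary coefficients. *)
Lemma integral_trig_poly_sqr L K c : 0 < L ->
  integral_Omega L (fun x y z => trig_poly L K c x y z ^+ 2) <=
  L ^+ 3 * \sum_(q <- modes3 K) sqnormc (coef3 c q).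
Proof.
move=> L0.
pose a q := complex.Re (coef3 c q); pose b q := complex.Im (coef3 c q).
pose U x y z := \sum_(q <- modes3 K) (a q * cos (mode_phase L q x y z) - b q * sin (mode_phase L q x y z)).
pose V x y z := \sum_(q <- modes3 K) (a q * sin (mode_phase L q x y z) + b q * cos (mode_phase L q x y z)).
pose G q q' := fun x y z => (a q * a q' + b q * b q') * cosph L (q.1.1 - q'.1.1) (q.1.2 - q'.1.2) (q.2 - q'.2) x y z
  + (a q * b q' - b q * a q') * sinph L (q.1.1 - q'.1.1) (q.1.2 - q'.1.2) (q.2 - q'.2) x y z.
have UV x y z : U x y z ^+ 2 + V x y z ^+ 2 = \sum_(q <- modes3 K) \sum_(q' <- modes3 K) G q q' x y z.
  rewrite /U /V !sum_sqr_mul -big_split /=; apply: eq_bigr => q _.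
  rewrite -big_split /=; apply: eq_bigr => q' _.
  have := mode_phaseB L q q' x y z; rewrite /G /cosph /sinph {1}/mode_phase /= => ->.
  by rewrite cosB sinB; ring.
have cG q q' : cont3 (G q q').
  by apply: cont3D; apply: cont3M; [exact: cont3_cst|exact: cont3_cosph|
    exact: cont3_cst|exact: cont3_sinph].
have cS : cont3 (fun x y z => \sum_(q <- modes3 K) \sum_(q' <- modes3 K) G q q' x y z).
  by do 2 (apply: cont3_sum => ?).
have cU : cont3 U.
  apply: cont3_sum => q; rewrite /mode_phase.
  have -> : (fun x y z => a q * cos (phase L q.1.1 q.1.2 q.2 x y z) -
                         b q * sin (phase L q.1.1 q.1.2 q.2 x y z)) =
    (fun x y z => a q * cosph L q.1.1 q.1.2 q.2 x y z + (- b q) * sinph L q.1.1 q.1.2 q.2 x y z).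
    by apply: funext3 => x y z; rewrite mulNr.
  by apply: cont3D; apply: cont3M; [exact: cont3_cst|exact: cont3_cosph|
    exact: cont3_cst|exact: cont3_sinph].
have -> : trig_poly L K c = U by apply: funext3 => x y z; rewrite trig_polyE.
apply: (@le_trans _ _ (integral_Omega L (fun x y z => \sum_(q <- modes3 K) \sum_(q' <- modes3 K) G q q' x y z))).
  apply: le_integral_Omega => //; first exact: cont3_sqr.
  by move=> x y z; rewrite -UV lerDl sqr_ge0.
rewrite integral_Omega_sum//; last by move=> q; exact: cont3_sum.
rewrite mulr_sumr; apply: eq_ler; apply: eq_big_seq => q qK.
rewrite integral_Omega_sum// (bigD1_seq q)//=; last exact: uniq_modes3.
have IG q' : integral_Omega L (G q q') = (a q * a q' + b q * b q') * (if q == q' then L ^+ 3 else 0).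
  rewrite /G integral_OmegaD//; [|by apply: cont3M; [exact: cont3_cst|exact: cont3_cosph]|
    by apply: cont3M; [exact: cont3_cst|exact: cont3_sinph]].
  rewrite !integral_OmegaZ//; [|exact: cont3_sinph|exact: cont3_cosph].
  rewrite (integral_sinph (sub3 q q') L0) (integral_cosph (sub3 q q') L0) mulr0 addr0.
  suff -> : (sub3 q q' == (0, 0, 0)) = (q == q') by [].
  by case: q q' {qK} => -[l m] n [[l' m'] n']; rewrite /sub3 /= !xpair_eqE !subr_eq0.
rewrite IG eqxx big1 ?addr0; first by rewrite /sqnormc /a /b; ring.
by move=> q' qq'; rewrite IG eq_sym (negbTE qq') mulr0.
Qed.

End FourierDecay.

(** * Discrete Fourier transform *)
Section DFT.
Variable R : realType.
Implicit Types (f g : grid R) (l m n : int).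

Lemma cisD (a b : R) : cis (a + b) = cis a * cis b.
Proof. by rewrite /cis cosD sinD; apply/eqP; rewrite eq_complex /=; apply/andP; split; apply/eqP; ring. Qed.

Lemma cis0 : cis (0 : R) = 1.
Proof. by rewrite /cis cos0 sin0. Qed.

Lemma cisN (a : R) : cis (- a) = (cis a)^*.
Proof. by rewrite /cis cosN sinN. Qed.

Lemma conj_cisN (b a : R) : (b%:C * cis (- a))^* = b%:C * cis a.
Proof.
rewrite /cis cosN sinN; apply/eqP; rewrite eq_complex /=.
by apply/andP; split; apply/eqP; ring.
Qed.

Lemma cisX (a : R) j : cis (j%:R * a) = cis a ^+ j.
Proof.
elim: j => [|j IHj]; first by rewrite mul0r cis0 expr0.
by rewrite exprS -IHj -cisD; congr cis; rewrite -natr1; ring.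
Qed.

Lemma cis2pil l : cis (2 * pi * l%:~R : R) = 1.
Proof. by rewrite -[2 * _ * _]add0r /cis cosD2pil sinD2pil cos0 sin0. Qed.

Lemma cisD2pil l (a : R) : cis (a + 2 * pi * l%:~R) = cis a.
Proof. by rewrite cisD cis2pil mulr1. Qed.

Lemma sqnormc_cis (a : R) : sqnormc (cis a) = 1.
Proof. by rewrite /sqnormc /cis /= cos2Dsin2. Qed.

Lemma sqnormc_cisB1 (a : R) : sqnormc (cis a - 1) = 2 - 2 * cos a.
Proof. by rewrite /sqnormc /cis /= subr0; have := cos2Dsin2 a; lra. Qed.

Lemma half_cosE (a : R) : 2 - 2 * cos a = 4 * sin (a / 2) ^+ 2.
Proof.
have -> : cos a = cos ((a / 2) *+ 2) by rewrite -mulr_natr divfK// pnatr_eq0.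
rewrite cos_mulr2n; have := cos2Dsin2 (a / 2); lra.
Qed.

Variable (K : nat).
Local Notation N := (gridN K).

Lemma gridN_gt0 : 0 < N%:R :> R. Proof. by rewrite ltr0n. Qed.

(** Geometric sum of ratio [cis th], where [th] is [2 pi d / N].  The ratio is not 1,
because [0 < |th / 2| < pi] and therefore [sin (th / 2)] does not vanish. *)
Lemma sum_modes_cis (d : int) : (`|d| < N)%N ->
  \sum_(l <- modes K) cis (2 * pi * l%:~R * d%:~R / N%:R : R) = if d == 0 then N%:R else 0.
Proof.
move=> dN; case: eqP => [->|/eqP d0].
  rewrite (eq_bigr (fun _ => 1)); last by move=> l _; rewrite mulr0 mul0r cis0.
  by rewrite big_const_seq count_predT size_map size_iota iter_addr_0.
pose th : R := 2 * pi * d%:~R / N%:R.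
have N0 := gridN_gt0.
rewrite /modes big_map (eq_bigr (fun l : nat => cis (- (K%:R * th)) * cis th ^+ l)); last first.
  move=> l _; rewrite -cisX -cisD; congr cis.
  by rewrite rmorphB /= -!natz /th; ring.
rewrite -big_distrr /=.
suff -> : \sum_(i <- iota 0 N) cis th ^+ i = 0 by rewrite mulr0.
have th1 : cis th != 1.
  apply: contraTneq isT => E; have : sqnormc (cis th - 1) = 0 by rewrite E subrr /sqnormc /=; ring.
  rewrite sqnormc_cisB1 half_cosE => /eqP; rewrite mulf_eq0 pnatr_eq0/= expf_eq0/= => /eqP s0.
  have : 0 < `|th / 2| < pi.
    rewrite normr_gt0 /th; apply/andP; split.
      rewrite !mulf_neq0// ?invr_eq0 ?intr_eq0// ?pnatr_eq0// ?gt_eqF// ?pi_gt0//.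
    have -> : 2 * pi * d%:~R / N%:R / 2 = pi * (d%:~R / N%:R) :> R.
      by field; rewrite gt_eqF.
    rewrite normrM gtr0_norm ?pi_gt0// gtr_pMr ?pi_gt0// normrM (gtr0_norm (x := _^-1)) ?invr_gt0//.
    by rewrite ltr_pdivrMr// mul1r -intr_norm -abszE -pmulrn ltr_nat.
  move=> /sin_gt0_pi; suff -> : sin `|th / 2| = 0 by rewrite ltxx.
  by case: (ger0P (th / 2)) => _ //; rewrite sinN s0 oppr0.
have : (cis th - 1) * \sum_(i <- iota 0 N) cis th ^+ i = 0.
  rewrite -[iota 0 N]/(index_iota 0 N) big_mkord -subrX1 -cisX.
  have -> : N%:R * th = 2 * pi * d%:~R by rewrite /th; field; rewrite gt_eqF.
  by rewrite cis2pil subrr.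
by move=> /eqP; rewrite mulf_eq0 subr_eq0 (negbTE th1) => /eqP.
Qed.

Definition pts : seq int := [seq i%:Z | i <- index_iota 1 N.+1].
Definition pts3 := triples pts.

Lemma sum_pts3 (V : nmodType) (F : int -> int -> int -> V) :
  \sum_(1 <= i < N.+1) \sum_(1 <= j < N.+1) \sum_(1 <= k < N.+1) F i%:Z j%:Z k%:Z =
  \sum_(q <- pts3) F q.1.1 q.1.2 q.2.
Proof.
rewrite -sum_triples /pts big_map; apply: eq_bigr => i _.
by rewrite big_map; apply: eq_bigr => j _; rewrite big_map.
Qed.

Lemma uniq_pts : uniq pts.
Proof. by rewrite /pts map_inj_uniq ?iota_uniq// => i j []. Qed.

Lemma uniq_pts3 : uniq pts3. Proof. exact: uniq_triples uniq_pts. Qed.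

Lemma pts_dist i j : i \in pts -> j \in pts -> (`|i - j| < N)%N.
Proof.
move=> /mapP[a + ->] /mapP[b + ->]; rewrite !mem_index_iota => aN bN.
by lia.
Qed.

Variable (L : R).
Hypothesis L0 : 0 < L.
Local Notation h := (gridh L K).

Lemma gridh_gt0 : 0 < h. Proof. by rewrite /gridh divr_gt0// gridN_gt0. Qed.

Lemma gridhN : h * N%:R = L. Proof. by rewrite /gridh divfK// gt_eqF// gridN_gt0. Qed.

Definition node_phase (k p : int * int * int) : R :=
  phase L k.1.1 k.1.2 k.2 (node h p.1.1) (node h p.1.2) (node h p.2).

Definition hat f (k : int * int * int) : R[i] := dft L K f k.1.1 k.1.2 k.2.

Lemma hatE f k : hat f k =
  (N%:R ^+ 3)^-1 * \sum_(p <- pts3) (f p.1.1 p.1.2 p.2)%:C * cis (- node_phase k p).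
Proof.
rewrite /hat /dft; congr (_ * _).
exact: (sum_pts3 (fun i j k' => (f i j k')%:C *
    cis (- phase L k.1.1 k.1.2 k.2 (node h i) (node h j) (node h k')))).
Qed.

Lemma wavenum_gridh l : wavenum L l * h = 2 * pi * l%:~R / N%:R.
Proof. by rewrite /wavenum /gridh; field; rewrite !gt_eqF// gridN_gt0. Qed.

Definition freq (k e : int * int * int) : R :=
  2 * pi * (k.1.1 * e.1.1 + k.1.2 * e.1.2 + k.2 * e.2)%:~R / N%:R.

Definition sub3 (p q : int * int * int) := (p.1.1 - q.1.1, p.1.2 - q.1.2, p.2 - q.2).
Definition add3 (p q : int * int * int) := (p.1.1 + q.1.1, p.1.2 + q.1.2, p.2 + q.2).

Lemma freqE k e : freq k e = 2 * pi * k.1.1%:~R * e.1.1%:~R / N%:R +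
  2 * pi * k.1.2%:~R * e.1.2%:~R / N%:R + 2 * pi * k.2%:~R * e.2%:~R / N%:R.
Proof. by rewrite /freq !rmorphD !rmorphM /=; ring. Qed.

Lemma node_phaseD k p e : node_phase k (add3 p e) = node_phase k p + freq k e.
Proof.
rewrite /node_phase !phaseE /node /= !rmorphD /=.
have T l e' : 2 * pi * l%:~R * e' / N%:R = wavenum L l * h * e' :> R by rewrite wavenum_gridh; ring.
by rewrite freqE !T; ring.
Qed.

Lemma node_phaseB k p q : node_phase k q - node_phase k p = freq k (sub3 q p).
Proof.
have -> : q = add3 p (sub3 q p).
  by case: p q => -[a b] c [[a' b'] c']; rewrite /add3 /sub3 /= !subrKC.
rewrite node_phaseD addrC addKr; congr freq.
by case: p q => -[a b] c [[a' b'] c']; rewrite /add3 /sub3 /= !subrKC.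
Qed.

Lemma sum_modes3_cis p q : p \in pts3 -> q \in pts3 ->
  \sum_(k <- modes3 K) cis (node_phase k q - node_phase k p) = if p == q then N%:R ^+ 3 else 0.
Proof.
move=> /mem_triples[p1 p2 p3] /mem_triples[q1 q2 q3].
under eq_bigr do rewrite node_phaseB freqE !cisD.
rewrite -(sum_modes3 K (fun l m n => cis (2 * pi * l%:~R * (sub3 q p).1.1%:~R / N%:R) *
  cis (2 * pi * m%:~R * (sub3 q p).1.2%:~R / N%:R) *
  cis (2 * pi * n%:~R * (sub3 q p).2%:~R / N%:R))).
under eq_bigr do under eq_bigr do rewrite -big_distrr /=.
under eq_bigr do rewrite -big_distrl -big_distrr /=.
rewrite -!big_distrl /= !sum_modes_cis; [|exact: pts_dist..].
rewrite !subr_eq0; case: p q {p1 p2 p3 q1 q2 q3} => -[a b] c [[a' b'] c'] /=.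
rewrite !xpair_eqE (eq_sym a) (eq_sym b) (eq_sym c).
by case: (a' == a); case: (b' == b); case: (c' == c); rewrite /= ?(mul0r, mulr0)//; ring.
Qed.

(** Real scalar product of the plane; [rdotE] relates it to the Hermitian one. *)
Definition rdot (c d : R[i]) : R := complex.Re c * complex.Re d + complex.Im c * complex.Im d.

Lemma rdotE c d : rdot c d = complex.Re (c * d^*).
Proof. by case: c => a b; case: d => a' b'; rewrite /rdot /=; ring. Qed.

Lemma rdotcc c : rdot c c = sqnormc c. Proof. by rewrite /rdot /sqnormc -!expr2. Qed.

Lemma innerE f g : inner h N f g = h ^+ 3 * \sum_(p <- pts3) f p.1.1 p.1.2 p.2 * g p.1.1 p.1.2 p.2.
Proof. by rewrite /inner; congr (_ * _); exact: (sum_pts3 (fun i j k => f i j k * g i j k)). Qed.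

Lemma conjc_sum (I : Type) (s : seq I) (F : I -> R[i]) :
  (\sum_(i <- s) F i)^* = \sum_(i <- s) (F i)^*.
Proof. exact: rmorph_sum. Qed.

Theorem parseval f g : inner h N f g = L ^+ 3 * \sum_(k <- modes3 K) rdot (hat f k) (hat g k).
Proof.
have N0 : N%:R != 0 :> R by rewrite gt_eqF// gridN_gt0.
under eq_bigr do rewrite rdotE.
rewrite -Re_sum.
have -> : \sum_(k <- modes3 K) hat f k * (hat g k)^* =
    ((N%:R ^+ 3)^-1 * \sum_(p <- pts3) f p.1.1 p.1.2 p.2 * g p.1.1 p.1.2 p.2)%:C.
  pose F p : R[i] := (f p.1.1 p.1.2 p.2)%:C; pose G p : R[i] := (g p.1.1 p.1.2 p.2)%:C.
  pose M : R[i] := N%:R ^+ 3.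
  have M0 : M != 0 by rewrite expf_neq0// pnatr_eq0.
  have MJ : M^* = M by rewrite /M rmorphXn rmorph_nat.
  have T k : hat f k * (hat g k)^* = \sum_(p <- pts3) \sum_(q <- pts3)
      M^-1 * M^-1 * (F p * G q) * cis (node_phase k q - node_phase k p).
    have JM S : (M^-1 * S)^* = M^-1 * S^*.
      by rewrite -[in RHS]MJ -conjc_inv; exact: (rmorphM (@conjc R)).
    rewrite !hatE JM conjc_sum mulrACA big_distrl /= mulr_sumr.
    apply: eq_bigr => p _; rewrite big_distrr /= mulr_sumr; apply: eq_bigr => q _.
    rewrite conj_cisN.
    by rewrite cisD /F /G; ring.
  under eq_bigr do rewrite T.
  rewrite exchange_big /=; under eq_bigr do rewrite exchange_big /=.
  rewrite rmorphM /= rmorph_sum /= fmorphV rmorphXn /= rmorph_nat -/M mulr_sumr.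
  apply: eq_big_seq => p pN; rewrite (bigD1_seq p)//=; last exact: uniq_pts3.
  rewrite [X in _ + X]big_seq_cond [X in _ + X]big1 ?addr0; last first.
    move=> q /andP[qN qp]; rewrite -mulr_sumr sum_modes3_cis// eq_sym (negbTE qp).
    by rewrite mulr0.
  rewrite -mulr_sumr sum_modes3_cis// eqxx -/M rmorphM /= -/(F p) -/(G p).
  by field.
rewrite /= innerE mulrA; congr (_ * _).
by rewrite /gridh exprMn exprVn.
Qed.

End DFT.

(** * Translations and differences as Fourier multipliers *)
Section PeriodicSums.
Variable K : nat.
Local Notation N := (gridN K).
Implicit Types e : int * int * int.

Lemma sum_shift1 (V : zmodType) (F : int -> V) (a : int) : (forall i, F (i + N%:Z) = F i) ->
  \sum_(1 <= i < N.+1) F (i%:Z + a) = \sum_(1 <= i < N.+1) F i%:Z.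
Proof.
have S1 (G : int -> V) : (forall i, G (i + N%:Z) = G i) ->
    \sum_(1 <= i < N.+1) G (i%:Z + 1) = \sum_(1 <= i < N.+1) G i%:Z.
  move=> pG; rewrite [LHS]big_nat_recr//= [RHS]big_ltn//= addrC [in RHS]big_add1 /=.
  have -> : G (N%:Z + 1) = G 1 by rewrite addrC pG.
  by congr (_ + _); apply: eq_bigr => i _; congr G; lia.
move=> pF; elim/int_rec: a => [|n IHn|n IHn].
- by apply: eq_bigr => i _; rewrite addr0.
- rewrite -IHn -(S1 (fun i => F (i + n%:Z))); last by move=> i; rewrite addrAC pF.
  by apply: eq_bigr => i _; congr F; lia.
- rewrite -IHn -(S1 (fun i => F (i + - n.+1%:Z))); last by move=> i; rewrite addrAC pF.
  by apply: eq_bigr => i _; congr F; lia.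
Qed.

Definition per3 (V : Type) (F : int -> int -> int -> V) := forall i j k : int,
  [/\ F (i + N%:Z) j k = F i j k, F i (j + N%:Z) k = F i j k & F i j (k + N%:Z) = F i j k].

Lemma sum_shift3 (V : zmodType) (F : int -> int -> int -> V) e : per3 F ->
  \sum_(p <- pts3 K) F (p.1.1 + e.1.1) (p.1.2 + e.1.2) (p.2 + e.2) =
  \sum_(p <- pts3 K) F p.1.1 p.1.2 p.2.
Proof.
move=> pF; rewrite -!(sum_pts3 K).
rewrite -(sum_pts3 K (fun i j k => F (i + e.1.1) (j + e.1.2) (k + e.2))).
rewrite (@sum_shift1 _ (fun i => \sum_(1 <= j < N.+1) \sum_(1 <= k < N.+1)
  F i (j%:Z + e.1.2) (k%:Z + e.2)) e.1.1); last first.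
  by move=> i; apply: eq_bigr => j _; apply: eq_bigr => k _; case: (pF i (j%:Z + e.1.2) (k%:Z + e.2)).
apply: eq_bigr => i _.
rewrite (@sum_shift1 _ (fun j => \sum_(1 <= k < N.+1) F i%:Z j (k%:Z + e.2)) e.1.2); last first.
  by move=> j; apply: eq_bigr => k _; case: (pF i%:Z j (k%:Z + e.2)).
apply: eq_bigr => j _.
by apply: (@sum_shift1 _ (fun k => F i%:Z j%:Z k) e.2) => k; case: (pF i%:Z j%:Z k).
Qed.

End PeriodicSums.

Section Shifts.
Variable R : realType.
Variables (L : R) (K : nat).
Hypothesis L0 : 0 < L.
Local Notation N := (gridN K).
Local Notation h := (gridh L K).
Local Notation hat := (hat K L).
Local Notation node_phase := (node_phase K L).
Local Notation freq := (freq R K).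
Implicit Types (f g : grid R) (e p k : int * int * int).

Definition opp3 e : int * int * int := (- e.1.1, - e.1.2, - e.2).
Definition translate e f : grid R := fun i j l => f (i + e.1.1) (j + e.1.2) (l + e.2).

Definition ex : int * int * int := (1, 0, 0).
Definition ey : int * int * int := (0, 1, 0).
Definition ez : int * int * int := (0, 0, 1).

Lemma Vper_translate e f : Vper N f -> Vper N (translate e f).
Proof.
move=> pf i j k; have [p1 p2 p3] := pf (i + e.1.1) (j + e.1.2) (k + e.2).
by split; rewrite /translate addrAC.
Qed.

Lemma Vper_map1 (op : R -> R) f : Vper N f -> Vper N (fun i j l => op (f i j l)).
Proof. by move=> pf i j k; have [-> -> ->] := pf i j k. Qed.

Lemma Vper_map2 (op : R -> R -> R) f g : Vper N f -> Vper N g ->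
  Vper N (fun i j l => op (f i j l) (g i j l)).
Proof. by move=> pf pg i j k; have [-> -> ->] := pf i j k; have [-> -> ->] := pg i j k. Qed.

Lemma sum_translate e f : Vper N f ->
  \sum_(p <- pts3 K) translate e f p.1.1 p.1.2 p.2 = \sum_(p <- pts3 K) f p.1.1 p.1.2 p.2.
Proof. exact: sum_shift3. Qed.

Lemma freqNe k e : freq k (opp3 e) = - freq k e.
Proof. by rewrite !freqE /= !rmorphN /=; ring. Qed.

Lemma freq_int k l1 l2 l3 : freq k (l1 * N%:Z, l2 * N%:Z, l3 * N%:Z) =
  2 * pi * (k.1.1 * l1 + k.1.2 * l2 + k.2 * l3)%:~R.
Proof.
have N0 := gridN_gt0 R K; rewrite freqE /= !rmorphD !rmorphM /= -pmulrn.
by field; rewrite gt_eqF.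
Qed.

Lemma cisB2pil l (a : R) : cis (a - 2 * pi * l%:~R) = cis a.
Proof. by rewrite -[RHS](@cisD2pil R (- l)) rmorphN /= mulrN. Qed.

(** The translation is moved to the exponential by re-indexing the sum over one
period. *)
Lemma hat_translate e f k : Vper N f -> hat (translate e f) k = cis (freq k e) * hat f k.
Proof.
move=> pf; rewrite !hatE// [RHS]mulrCA; congr (_ * _).
pose F i j l := (f i j l)%:C * cis (- node_phase k (add3 (i, j, l) (opp3 e))).
have pF : per3 K F.
  move=> i j l; have [p1 p2 p3] := pf i j l.
  have T (a b c a' b' c' : int) : - node_phase k (add3 (i + a' * N%:Z, j + b' * N%:Z, l + c' * N%:Z) (opp3 e)) =
     - node_phase k (add3 (i, j, l) (opp3 e)) - 2 * pi * (k.1.1 * a' + k.1.2 * b' + k.2 * c')%:~R.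
    rewrite -freq_int -opprD -node_phaseD//; congr (- node_phase k _); rewrite /add3 /=.
    by congr (_, _, _); lia.
  split; rewrite /F.
  - by rewrite p1; congr (_ * _); rewrite -[RHS](cisB2pil (k.1.1 * 1 + k.1.2 * 0 + k.2 * 0)) -(T 0 0 0 1 0 0) ?mul1r ?mul0r ?addr0.
  - by rewrite p2; congr (_ * _); rewrite -[RHS](cisB2pil (k.1.1 * 0 + k.1.2 * 1 + k.2 * 0)) -(T 0 0 0 0 1 0) ?mul1r ?mul0r ?addr0.
  - by rewrite p3; congr (_ * _); rewrite -[RHS](cisB2pil (k.1.1 * 0 + k.1.2 * 0 + k.2 * 1)) -(T 0 0 0 0 0 1) ?mul1r ?mul0r ?addr0.
transitivity (\sum_(p <- pts3 K) F (p.1.1 + e.1.1) (p.1.2 + e.1.2) (p.2 + e.2)).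
  apply: eq_bigr => p _; rewrite /F /translate; congr (_ * cis (- node_phase k _)).
  by case: p => -[a b] c; rewrite /add3 /=; congr (_, _, _); lia.
rewrite sum_shift3// mulr_sumr; apply: eq_bigr => p _.
rewrite /F node_phaseD// freqNe mulrCA; congr (_ * _); rewrite -cisD.
by congr cis; case: p => -[a b] c /=; ring.
Qed.

Lemma hat_lin (a b : R) f g k :
  hat (fun i j l => a * f i j l + b * g i j l) k = a%:C * hat f k + b%:C * hat g k.
Proof.
rewrite !hatE// [a%:C * _]mulrCA [b%:C * _]mulrCA -mulrDr; congr (_ * _).
rewrite !mulr_sumr -big_split /=; apply: eq_bigr => p _.
by rewrite rmorphD !rmorphM /=; ring.
Qed.

Definition fdiff e f : grid R := fun i j l => (translate e f i j l - f i j l) / h.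
Definition fdiff2 e f : grid R := fun i j l =>
  (translate e f i j l - 2 * f i j l + translate (opp3 e) f i j l) / h ^+ 2.

Lemma Vper_fdiff e f : Vper N f -> Vper N (fdiff e f).
Proof. by move=> pf; apply: (Vper_map2 (fun a b => (a - b) / h)) => //; exact: Vper_translate. Qed.

Lemma Vper_fdiff2 e f : Vper N f -> Vper N (fdiff2 e f).
Proof.
move=> pf; apply: (Vper_map2 (fun a b => (a + b) / h ^+ 2)); last exact: Vper_translate.
by apply: (Vper_map2 (fun a b => a - 2 * b)) => //; exact: Vper_translate.
Qed.

(** Symbol of [- fdiff2 e]; also the squared modulus of that of [fdiff e]. *)
Definition symb2 e k : R := (2 - 2 * cos (freq k e)) / h ^+ 2.

Lemma sqnormc_real (a : R) (c : R[i]) : sqnormc (a%:C * c) = a ^+ 2 * sqnormc c.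
Proof. by rewrite sqnormcM /sqnormc /=; ring. Qed.

Lemma sqnormc_hat_fdiff e f k : Vper N f -> sqnormc (hat (fdiff e f) k) = symb2 e k * sqnormc (hat f k).
Proof.
move=> pf; have -> : fdiff e f = fun i j l => h^-1 * translate e f i j l + (- h^-1) * f i j l.
  by apply: funext3 => i j l; rewrite /fdiff; ring.
rewrite hat_lin hat_translate// rmorphN mulNr -mulrBr.
have -> : cis (freq k e) * hat f k - hat f k = (cis (freq k e) - 1) * hat f k by ring.
by rewrite sqnormc_real sqnormcM sqnormc_cisB1 /symb2 exprVn; ring.
Qed.

Lemma hat_fdiff2 e f k : Vper N f -> hat (fdiff2 e f) k = (- symb2 e k)%:C * hat f k.
Proof.
move=> pf; have -> : fdiff2 e f = fun i j l => (h ^- 2) * (fun i j l =>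
   1 * translate e f i j l + 1 * translate (opp3 e) f i j l) i j l + (- 2 * h ^- 2) * f i j l.
  by apply: funext3 => i j l; rewrite /fdiff2; ring.
rewrite hat_lin hat_lin !hat_translate// freqNe /symb2 cisN.
set F := hat f k; set H := h ^- 2.
have E : (cis (freq k e) + (cis (freq k e))^*) = (2 * cos (freq k e))%:C.
  by rewrite /cis; apply/eqP; rewrite eq_complex /=; apply/andP; split; apply/eqP; ring.
transitivity (H%:C * ((cis (freq k e) + (cis (freq k e))^*) + (- 2)%:C) * F).
  by rewrite rmorph1 !rmorphM; ring.
by rewrite E -rmorphD -rmorphM; congr (_%:C * _); rewrite /H; ring.
Qed.

Definition fdiff4 e f : grid R := fdiff2 e (fun i j l => f i j l - h ^+ 2 / 12 * fdiff2 e f i j l).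

(** Symbol of [- fdiff4 e]. *)
Definition symb4 e k : R := symb2 e k * (1 + h ^+ 2 / 12 * symb2 e k).

Lemma hat_fdiff4 e f k : Vper N f -> hat (fdiff4 e f) k = (- symb4 e k)%:C * hat f k.
Proof.
move=> pf; rewrite /fdiff4 hat_fdiff2; last first.
  by apply: (Vper_map2 (fun a b => a - h ^+ 2 / 12 * b)) => //; exact: Vper_fdiff2.
have -> : (fun i j l => f i j l - h ^+ 2 / 12 * fdiff2 e f i j l) =
   fun i j l => 1 * f i j l + (- (h ^+ 2 / 12)) * fdiff2 e f i j l.
  by apply: funext3 => i j l; ring.
rewrite hat_lin hat_fdiff2// mulrA -rmorphM -mulrDl -rmorphD mulrA -rmorphM.
by congr (_%:C * _); rewrite /symb4; ring.
Qed.

Lemma Vper_fdiff4 e f : Vper N f -> Vper N (fdiff4 e f).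
Proof.
move=> pf; apply: Vper_fdiff2; apply: (Vper_map2 (fun a b => a - h ^+ 2 / 12 * b)) => //.
exact: Vper_fdiff2.
Qed.

Lemma D2xE f : D2x h f = fdiff2 ex f.
Proof. by apply: funext3 => i j l; rewrite /D2x /fdiff2 /translate /= !oppr0 !addr0. Qed.
Lemma D2yE f : D2y h f = fdiff2 ey f.
Proof. by apply: funext3 => i j l; rewrite /D2y /fdiff2 /translate /= !oppr0 !addr0. Qed.
Lemma D2zE f : D2z h f = fdiff2 ez f.
Proof. by apply: funext3 => i j l; rewrite /D2z /fdiff2 /translate /= !oppr0 !addr0. Qed.

Lemma Lap4E f : Lap4 h f = fun i j l => fdiff4 ex f i j l + fdiff4 ey f i j l + fdiff4 ez f i j l.
Proof.
apply: funext3 => i j l; rewrite /Lap4 /D2x4 /D2y4 /D2z4 /fdiff4.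
by rewrite !D2xE !D2yE !D2zE.
Qed.

(** Symbol of [- Lap4]. *)
Definition symbLap k : R := symb4 ex k + symb4 ey k + symb4 ez k.

Lemma Vper_Lap4 f : Vper N f -> Vper N (Lap4 h f).
Proof.
move=> pf; rewrite Lap4E; apply: (Vper_map2 (fun a b => a + b)); last exact: Vper_fdiff4.
by apply: (Vper_map2 (fun a b => a + b)); exact: Vper_fdiff4.
Qed.

Lemma hat_Lap4 f k : Vper N f -> hat (Lap4 h f) k = (- symbLap k)%:C * hat f k.
Proof.
move=> pf; rewrite Lap4E.
have -> : (fun i j l => fdiff4 ex f i j l + fdiff4 ey f i j l + fdiff4 ez f i j l) =
  fun i j l => 1 * (fun i j l => 1 * fdiff4 ex f i j l + 1 * fdiff4 ey f i j l) i j l + 1 * fdiff4 ez f i j l.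
  by apply: funext3 => i j l; ring.
rewrite hat_lin hat_lin !hat_fdiff4// !mul1r -!mulrDl -!rmorphD; congr (_%:C * _).
by rewrite /symbLap; ring.
Qed.

Lemma symb2_ge0 e k : 0 <= symb2 e k.
Proof.
by rewrite /symb2 divr_ge0 ?sqr_ge0// subr_ge0 ler_piMr// cos_le1.
Qed.

Lemma gridh2_symb2_le4 e k : h ^+ 2 * symb2 e k <= 4.
Proof.
rewrite /symb2 mulrC divfK ?expf_neq0 ?gt_eqF ?gridh_gt0//.
by have := cos_geN1 (freq k e); lra.
Qed.

Lemma symb2_le_symb4 e k : symb2 e k <= symb4 e k.
Proof. by rewrite /symb4 ler_peMr ?symb2_ge0// lerDl mulr_ge0 ?symb2_ge0// divr_ge0 ?sqr_ge0. Qed.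

(** As [h^2 symb2 <= 4], the factor [1 + h^2 symb2 / 12] due to the fourth order
correction lies between 1 and 4/3: long and short stencils are equivalent. *)
Lemma symb4_le_symb2 e k : symb4 e k <= 4 / 3 * symb2 e k.
Proof.
rewrite /symb4 mulrC ler_wpM2r ?symb2_ge0//.
by have := gridh2_symb2_le4 e k; rewrite mulrAC; lra.
Qed.

Lemma symb4_ge0 e k : 0 <= symb4 e k. Proof. exact: le_trans (symb2_ge0 e k) (symb2_le_symb4 e k). Qed.

Lemma symbLap_ge0 k : 0 <= symbLap k. Proof. by rewrite /symbLap !addr_ge0// symb4_ge0. Qed.

Lemma symb2_le_symbLap e k : e \in [:: ex; ey; ez] -> symb2 e k <= symbLap k.
Proof.
have := symb4_ge0 ex k; have := symb4_ge0 ey k; have := symb4_ge0 ez k.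
have := symb2_le_symb4 e k; rewrite /symbLap !inE => H a b c /or3P[] /eqP E; move: H; rewrite E => H; lra.
Qed.

End Shifts.

(** * Discrete Sobolev norms *)
Section Weights.
Variable R : realType.
Variables (L : R) (K : nat).
Hypothesis L0 : 0 < L.
Local Notation N := (gridN K).
Local Notation h := (gridh L K).
Local Notation hat := (hat K L).
Local Notation symb2 := (symb2 L K).
Local Notation symbLap := (symbLap L K).
Local Notation inner := (inner h N).
Local Notation norm2 := (norm2_sq h N).
Implicit Types (f g : grid R) (k : int * int * int) (w : int * int * int -> R).

(** All the quadratic norms of grid functions below have this form, which reduces
inequalities between them to inequalities between weights. *)
Definition wnorm2 w f : R := L ^+ 3 * \sum_(k <- modes3 K) w k * sqnormc (hat f k).

Lemma wnorm2_ge0 w f : (forall k, 0 <= w k) -> 0 <= wnorm2 w f.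
Proof.
move=> w0; rewrite mulr_ge0 ?exprn_ge0 ?(ltW L0)// sumr_ge0// => k _.
by rewrite mulr_ge0// sqnormc_ge0.
Qed.

Lemma le_wnorm2 w1 w2 f : (forall k, w1 k <= w2 k) -> wnorm2 w1 f <= wnorm2 w2 f.
Proof.
move=> w12; rewrite ler_pM2l ?exprn_gt0// ler_sum// => k _.
by rewrite ler_wpM2r// sqnormc_ge0.
Qed.

Lemma wnorm2D w1 w2 f : wnorm2 (fun k => w1 k + w2 k) f = wnorm2 w1 f + wnorm2 w2 f.
Proof.
by rewrite /wnorm2 -mulrDr -big_split /=; congr (_ * _); apply: eq_bigr => k _; rewrite mulrDl.
Qed.

Lemma wnorm2Z a w f : wnorm2 (fun k => a * w k) f = a * wnorm2 w f.
Proof.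
rewrite /wnorm2 [RHS]mulrCA; congr (_ * _); rewrite mulr_sumr; apply: eq_bigr => k _.
by rewrite mulrA.
Qed.

Lemma eq_wnorm2 w1 w2 f : w1 =1 w2 -> wnorm2 w1 f = wnorm2 w2 f.
Proof. by move=> w12; congr (_ * _); apply: eq_bigr => k _; rewrite w12. Qed.

Lemma norm2_wnorm2 f : norm2 f = wnorm2 (fun => 1) f.
Proof.
rewrite /norm2_sq parseval//; congr (_ * _); apply: eq_bigr => k _.
by rewrite mul1r rdotcc.
Qed.

Lemma wnorm2_symbol w (s : int * int * int -> R) f g :
  (forall k, sqnormc (hat g k) = s k * sqnormc (hat f k)) -> wnorm2 w g = wnorm2 (fun k => w k * s k) f.
Proof. by move=> gf; congr (_ * _); apply: eq_bigr => k _; rewrite gf mulrA. Qed.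

Lemma wnorm2_Lap4 w f : Vper N f -> wnorm2 w (Lap4 h f) = wnorm2 (fun k => w k * symbLap k ^+ 2) f.
Proof. by move=> pf; apply: wnorm2_symbol => k; rewrite hat_Lap4// sqnormc_real sqrrN. Qed.

Lemma wnorm2_fdiff w e f : Vper N f -> wnorm2 w (fdiff L K e f) = wnorm2 (fun k => w k * symb2 e k) f.
Proof. by move=> pf; apply: wnorm2_symbol => k; rewrite sqnormc_hat_fdiff. Qed.

Lemma wnorm2_fdiff2 w e f : Vper N f -> wnorm2 w (fdiff2 L K e f) = wnorm2 (fun k => w k * symb2 e k ^+ 2) f.
Proof. by move=> pf; apply: wnorm2_symbol => k; rewrite hat_fdiff2// sqnormc_real sqrrN. Qed.

Lemma rdot_real a (c d : R[i]) : rdot c (a%:C * d) = a * rdot c d.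
Proof. by case: c => x y; case: d => x' y'; rewrite /rdot /=; ring. Qed.

Lemma rdotC (c d : R[i]) : rdot c d = rdot d c.
Proof. by rewrite /rdot [X in X + _]mulrC [X in _ + X]mulrC. Qed.

Lemma inner_Lap4 f g : Vper N f -> Vper N g -> inner f (Lap4 h g) = inner (Lap4 h f) g.
Proof.
move=> pf pg; rewrite !parseval//; congr (_ * _); apply: eq_bigr => k _.
by rewrite !hat_Lap4// rdot_real [RHS]rdotC rdot_real rdotC.
Qed.

Lemma hatN f k : hat (fun i j l => - f i j l) k = - hat f k.
Proof.
have -> : (fun i j l => - f i j l) = (fun i j l => (- 1) * f i j l + 0 * f i j l).
  by apply: funext3 => i j l; ring.
by rewrite hat_lin// rmorph0 mul0r addr0 rmorphN rmorph1 mulN1r.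
Qed.

Lemma grad4_wnorm2 f : Vper N f -> grad4_sq h N f = wnorm2 symbLap f.
Proof.
move=> pf; rewrite /grad4_sq parseval//; congr (_ * _); apply: eq_bigr => k _.
rewrite hatN hat_Lap4// -mulNr -rmorphN opprK rdot_real rdotcc//.
Qed.

Lemma grad4_ge0 f : Vper N f -> 0 <= grad4_sq h N f.
Proof. by move=> pf; rewrite grad4_wnorm2// wnorm2_ge0// => k; exact: symbLap_ge0. Qed.

Lemma norm2_Lap4 f : Vper N f -> norm2 (Lap4 h f) = wnorm2 (fun k => symbLap k ^+ 2) f.
Proof. by move=> pf; rewrite norm2_wnorm2 wnorm2_Lap4//; apply: eq_wnorm2 => k; rewrite mul1r. Qed.

Lemma norm2_Lap42 f : Vper N f -> norm2 (Lap4 h (Lap4 h f)) = wnorm2 (fun k => symbLap k ^+ 4) f.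
Proof.
move=> pf; rewrite norm2_Lap4; last exact: Vper_Lap4.
by rewrite wnorm2_Lap4//; apply: eq_wnorm2 => k; rewrite -exprD.
Qed.

(** Square of the discrete Sobolev norm [||(1 - Lap4)^(j/2) f||]. *)
Definition hnorm2 (j : nat) f : R := wnorm2 (fun k => (1 + symbLap k) ^+ j) f.

Lemma hnorm2_ge0 j f : 0 <= hnorm2 j f.
Proof. by apply: wnorm2_ge0 => k; rewrite exprn_ge0// addr_ge0// symbLap_ge0. Qed.

Lemma hnorm2_0 f : hnorm2 0 f = norm2 f.
Proof. by rewrite norm2_wnorm2; apply: eq_wnorm2 => k; rewrite expr0. Qed.

Lemma hnorm2_1 f : Vper N f -> hnorm2 1 f = norm2 f + grad4_sq h N f.
Proof. by move=> pf; rewrite norm2_wnorm2 grad4_wnorm2// -wnorm2D; apply: eq_wnorm2 => k; rewrite expr1. Qed.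

Lemma hnorm2_le j1 j2 f : (j1 <= j2)%N -> hnorm2 j1 f <= hnorm2 j2 f.
Proof. by move=> j12; apply: le_wnorm2 => k; rewrite ler_weXn2l// lerDl symbLap_ge0. Qed.

Lemma hnorm2_2_le f : Vper N f -> hnorm2 2 f <= 2 * (norm2 f + norm2 (Lap4 h f)).
Proof.
move=> pf; rewrite norm2_wnorm2 norm2_Lap4// -wnorm2D -wnorm2Z; apply: le_wnorm2 => k.
have := symbLap_ge0 L K k; have := sqr_ge0 (1 - symbLap k); nra.
Qed.

Lemma hnorm2_4_le f : Vper N f -> hnorm2 4 f <= 8 * (norm2 f + norm2 (Lap4 h (Lap4 h f))).
Proof.
move=> pf; rewrite norm2_wnorm2 norm2_Lap42// -wnorm2D -wnorm2Z; apply: le_wnorm2 => k.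
set x := symbLap k; have x0 : 0 <= x by exact: symbLap_ge0.
have h1 : (1 + x) ^+ 2 <= 2 * (1 + x ^+ 2) by have := sqr_ge0 (1 - x); nra.
have h2 : (1 + x ^+ 2) ^+ 2 <= 2 * (1 + x ^+ 4).
  by rewrite (exprM x 2 2); have := sqr_ge0 (1 - x ^+ 2); nra.
have -> : (1 + x) ^+ 4 = ((1 + x) ^+ 2) ^+ 2 by rewrite -exprM.
apply: (@le_trans _ _ ((2 * (1 + x ^+ 2)) ^+ 2)).
  by apply: lerXn2r; rewrite ?nnegrE ?sqr_ge0// mulr_ge0// addr_ge0// sqr_ge0.
by rewrite exprMn; lra.
Qed.

Lemma hnorm2_fdiff j e f : Vper N f -> e \in [:: ex; ey; ez] -> hnorm2 j (fdiff L K e f) <= hnorm2 j.+1 f.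
Proof.
move=> pf eE; rewrite /hnorm2 wnorm2_fdiff//; apply: le_wnorm2 => k; rewrite exprSr.
have SL : symb2 e k <= symbLap k by exact: symb2_le_symbLap.
have L1 : 0 <= 1 + symbLap k by rewrite addr_ge0// symbLap_ge0.
by apply: ler_wpM2l; [exact: exprn_ge0|lra].
Qed.

Lemma norm2_fdiff2 e f : Vper N f -> e \in [:: ex; ey; ez] -> norm2 (fdiff2 L K e f) <= hnorm2 2 f.
Proof.
move=> pf eE; rewrite norm2_wnorm2 wnorm2_fdiff2//; apply: le_wnorm2 => k; rewrite mul1r.
have SL : symb2 e k <= symbLap k by exact: symb2_le_symbLap.
have a := symbLap_ge0 L K k; have b := symb2_ge0 L K e k; apply: lerXn2r; rewrite ?nnegrE; lra.
Qed.

(** [16 / 3 = 3 * (4 / 3)^2]: a factor 3 for the square of a sum of three terms, and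
the square of the constant of [symb4_le_symb2]. *)
Lemma norm2_Lap4_le g : Vper N g ->
  norm2 (Lap4 h g) <= 16 / 3 * (norm2 (fdiff2 L K ex g) + norm2 (fdiff2 L K ey g) + norm2 (fdiff2 L K ez g)).
Proof.
move=> pg; rewrite norm2_Lap4// !norm2_wnorm2 !wnorm2_fdiff2// -!wnorm2D -wnorm2Z; apply: le_wnorm2 => k.
have sq3 (a b c : R) : (a + b + c) ^+ 2 <= 3 * (a ^+ 2 + b ^+ 2 + c ^+ 2).
  by have := sqr_ge0 (a - b); have := sqr_ge0 (b - c); have := sqr_ge0 (a - c); nra.
have sS e : symb4 L K e k ^+ 2 <= 16 / 9 * symb2 e k ^+ 2.
  have -> : 16 / 9 * symb2 e k ^+ 2 = (4 / 3 * symb2 e k) ^+ 2 by field.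
  have e0 := symb2_ge0 L K e k; have e1 := symb4_ge0 L K e k; have e2 := @symb4_le_symb2 R L K L0 e k.
  by apply: lerXn2r; rewrite ?nnegrE; lra.
rewrite !mul1r; apply: le_trans (sq3 _ _ _) _.
by have := sS ex; have := sS ey; have := sS ez; lra.
Qed.

(** The symbol satisfies [x^2 <= eta x^4 + 1 / (4 eta)]. *)
Lemma norm2_Lap4_interp f eta : 0 < eta -> Vper N f ->
  norm2 (Lap4 h f) <= eta * norm2 (Lap4 h (Lap4 h f)) + (4 * eta)^-1 * norm2 f.
Proof.
move=> eta0 pf; rewrite norm2_Lap4// norm2_Lap42// norm2_wnorm2 -!wnorm2Z -wnorm2D; apply: le_wnorm2 => k.
set x := symbLap k ^+ 2; rewrite mulr1 (exprM _ 2 2) -/x.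
rewrite -subr_ge0.
have -> : eta * x ^+ 2 + (4 * eta)^-1 - x = eta * (x - (2 * eta)^-1) ^+ 2.
  by field; rewrite gt_eqF.
by rewrite mulr_ge0 ?sqr_ge0// ltW.
Qed.

(** The discriminant of the nonnegative quadratic function [Q] is nonpositive. *)
Lemma sum_CS (I : Type) (s : seq I) (a b : I -> R) :
  (\sum_(i <- s) a i * b i) ^+ 2 <= (\sum_(i <- s) a i ^+ 2) * (\sum_(i <- s) b i ^+ 2).
Proof.
set A := \sum_(i <- s) a i ^+ 2; set B := \sum_(i <- s) b i ^+ 2; set C := \sum_(i <- s) _.
have A0 : 0 <= A by apply: sumr_ge0 => i _; exact: sqr_ge0.
have B0 : 0 <= B by apply: sumr_ge0 => i _; exact: sqr_ge0.
have Q t : 0 <= A - 2 * t * C + t ^+ 2 * B.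
  have -> : A - 2 * t * C + t ^+ 2 * B = \sum_(i <- s) (a i - t * b i) ^+ 2.
    rewrite /A /B /C !mulr_sumr -sumrB -big_split /=; apply: eq_bigr => i _; ring.
  by apply: sumr_ge0 => i _; exact: sqr_ge0.
have [B_eq0|Bn0] := eqVneq B 0.
  rewrite B_eq0 mulr0 in Q *.
  have [C0|Cn0] := eqVneq C 0; first by rewrite C0 expr0n.
  (* [Q] is affine in [t] and becomes negative at this point *)
  have := Q ((A + 1) / (2 * C)); rewrite mulr0 addr0.
  have -> : 2 * ((A + 1) / (2 * C)) * C = A + 1 by field.
  by lra.
have Bp : 0 < B by rewrite lt_neqAle eq_sym Bn0.
have := Q (C / B); have -> : A - 2 * (C / B) * C + (C / B) ^+ 2 * B = (A * B - C ^+ 2) / B by field.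
by rewrite pmulr_lge0 ?invr_gt0// subr_ge0.
Qed.

(** The norms are log-convex in [j]: Cauchy-Schwarz for the weights
[(1 + x)^(j+1) = (1 + x)^(j/2) (1 + x)^(j/2+1)]. *)
Lemma hnorm2_CS j f : hnorm2 j.+1 f ^+ 2 <= hnorm2 j f * hnorm2 j.+2 f.
Proof.
have P k : 0 <= 1 + symbLap k by rewrite addr_ge0// symbLap_ge0.
pose r k := Num.sqrt ((1 + symbLap k) ^+ j * sqnormc (hat f k)).
have r2 k : r k ^+ 2 = (1 + symbLap k) ^+ j * sqnormc (hat f k).
  by rewrite sqr_sqrtr// mulr_ge0 ?exprn_ge0// sqnormc_ge0.
have H := sum_CS (modes3 K) r (fun k => (1 + symbLap k) * r k).
rewrite /hnorm2 /wnorm2 exprMn [leRHS]mulrACA -[X in _ <= X * _]expr2 ler_pM2l ?exprn_gt0//.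
apply: le_trans (le_trans _ H) _.
- apply: eq_ler; congr (_ ^+ 2); apply: eq_bigr => k _.
  by rewrite mulrCA -expr2 r2 mulrA -exprS.
- apply: eq_ler; congr (_ * _); apply: eq_bigr => k _.
    by rewrite r2.
  by rewrite exprMn r2 mulrA -exprD.
Qed.

(** [hnorm2 3] is eliminated between two consecutive instances of [hnorm2_CS]. *)
Lemma hnorm2_interp f : hnorm2 2 f ^+ 3 <= hnorm2 1 f ^+ 2 * hnorm2 4 f.
Proof.
have a1 := hnorm2_ge0 1 f; have a2 := hnorm2_ge0 2 f; have a4 := hnorm2_ge0 4 f; have a3 := hnorm2_ge0 3 f.
have h1 := hnorm2_CS 1 f; have h2 := hnorm2_CS 2 f.
have [->|n0] := eqVneq (hnorm2 2 f) 0; first by rewrite expr0n mulr_ge0// sqr_ge0.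
have p2 : 0 < hnorm2 2 f by rewrite lt_neqAle eq_sym n0.
rewrite -(ler_pM2r p2) -exprSr.
apply: (@le_trans _ _ ((hnorm2 1 f * hnorm2 3 f) ^+ 2)).
  by rewrite (exprM _ 2 2) lerXn2r// nnegrE ?sqr_ge0// mulr_ge0.
apply: (@le_trans _ _ (hnorm2 1 f ^+ 2 * (hnorm2 2 f * hnorm2 4 f))).
  by rewrite exprMn; apply: ler_wpM2l h2; exact: sqr_ge0.
by rewrite [hnorm2 2 f * _]mulrC mulrA.
Qed.

End Weights.

(** * Second differences of a cube *)
Section CubicEstimate.
Variable R : realType.
Variables (L : R) (K : nat).
Hypothesis L0 : 0 < L.
Local Notation N := (gridN K).
Local Notation h := (gridh L K).
Local Notation norm2 := (norm2_sq h N).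
Implicit Types (f g : grid R) (e : int * int * int).

Definition grid_sum f : R := \sum_(p <- pts3 K) f p.1.1 p.1.2 p.2.

Lemma norm2E f : norm2 f = h ^+ 3 * grid_sum (fun i j k => f i j k ^+ 2).
Proof. by rewrite /norm2_sq innerE//. Qed.

Lemma grid_sum_translate e f : Vper N f -> grid_sum (translate e f) = grid_sum f.
Proof. exact: sum_translate. Qed.

Lemma le_grid_sum f g : (forall i j k, f i j k <= g i j k) -> grid_sum f <= grid_sum g.
Proof. by move=> fg; apply: ler_sum => p _; exact: fg. Qed.

Lemma grid_sumD f g : grid_sum (fun i j k => f i j k + g i j k) = grid_sum f + grid_sum g.
Proof. by rewrite /grid_sum big_split. Qed.

Lemma grid_sumZ a f : grid_sum (fun i j k => a * f i j k) = a * grid_sum f.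
Proof. by rewrite /grid_sum mulr_sumr. Qed.

Lemma eq_grid_sum f g : (forall i j k, f i j k = g i j k) -> grid_sum f = grid_sum g.
Proof. by move=> fg; apply: eq_bigr => p _; exact: fg. Qed.

Lemma grid_sum_ge0 f : (forall i j k, 0 <= f i j k) -> 0 <= grid_sum f.
Proof. by move=> f0; apply: sumr_ge0 => p _; exact: f0. Qed.

Lemma grid_sum_cst (a : R) : h ^+ 3 * grid_sum (fun _ _ _ => a) = L ^+ 3 * a.
Proof.
rewrite /grid_sum big_const_seq count_predT iter_addr_0 /pts3 !size_allpairs /pts size_map size_iota.
by rewrite subn1 /= -(mulr_natl a) !natrM -[in RHS](gridhN K L); ring.
Qed.

Lemma translate_opp3 e f : translate (opp3 e) (translate e f) = f.
Proof. by apply: funext3 => i j k; rewrite /translate /= !subrK. Qed.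

Section Direction.
Variables (e : int * int * int) (f : grid R) (F : R).
Hypotheses (pf : Vper N f) (fF : forall i j k, f i j k ^+ 2 <= F).

Let P := fdiff L K e f.
Let Q := translate (opp3 e) P.
Let D := fdiff2 L K e f.
Let h0 : h != 0. Proof. by rewrite gt_eqF// gridh_gt0. Qed.
Let pP : Vper N P. Proof. exact: Vper_fdiff. Qed.

Let fsh i j k : translate e f i j k = f i j k + h * P i j k.
Proof. by rewrite /P /fdiff; field. Qed.

Let fshm i j k : translate (opp3 e) f i j k = f i j k - h * Q i j k.
Proof.
have -> : Q i j k = (f i j k - translate (opp3 e) f i j k) / h.
  by rewrite /Q /P /fdiff /translate /= !subrK.
by field.
Qed.

Let DE i j k : D i j k = (P i j k - Q i j k) / h.
Proof. by rewrite /D /fdiff2 fsh fshm; field. Qed.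

Let sum_Q4 : grid_sum (fun i j k => Q i j k ^+ 4) = grid_sum (fun i j k => P i j k ^+ 4).
Proof.
rewrite -[RHS](@grid_sum_translate (opp3 e)); last by apply: (Vper_map1 (fun a => a ^+ 4)).
exact: eq_grid_sum.
Qed.

(** Discrete form of [int (u')^4 = - 3 int u (u')^2 u''], where [P^2 + P Q + Q^2] is
the counterpart of [3 (u')^2], followed by Young's inequality: half of the left
hand side reappears on the right and is absorbed. *)
Lemma grid_sum_P4 : grid_sum (fun i j k => P i j k ^+ 4) <= 9 * F * grid_sum (fun i j k => D i j k ^+ 2).
Proof.
have T3 : grid_sum (fun i j k => P i j k ^+ 3 * translate e f i j k) = grid_sum (fun i j k => Q i j k ^+ 3 * f i j k).
  rewrite -[LHS](@grid_sum_translate (opp3 e)); last first.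
    by apply: (Vper_map2 (fun a b => a ^+ 3 * b)) => //; exact: Vper_translate.
  by apply: eq_grid_sum => i j k; rewrite -[in RHS](translate_opp3 e f).
have E : grid_sum (fun i j k => P i j k ^+ 4) =
    grid_sum (fun i j k => - (f i j k * D i j k) * (P i j k ^+ 2 + P i j k * Q i j k + Q i j k ^+ 2)).
  transitivity (h^-1 * (grid_sum (fun i j k => P i j k ^+ 3 * translate e f i j k) +
                        grid_sum (fun i j k => - (P i j k ^+ 3 * f i j k)))).
    by rewrite -grid_sumD -grid_sumZ; apply: eq_grid_sum => i j k; rewrite fsh; field.
  rewrite T3 -grid_sumD -grid_sumZ; apply: eq_grid_sum => i j k; rewrite DE; field => //.
have U i j k : - (f i j k * D i j k) * (P i j k ^+ 2 + P i j k * Q i j k + Q i j k ^+ 2) <=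
    (4^-1 * P i j k ^+ 4 + 4^-1 * Q i j k ^+ 4) + 9 / 2 * F * D i j k ^+ 2.
  have := fF i j k; set a := f i j k; set p := P i j k; set q := Q i j k; set d := D i j k => aF.
  have adF : a ^+ 2 * d ^+ 2 <= F * d ^+ 2 by rewrite ler_wpM2r// sqr_ge0.
  set t := `|a * d|; have t2 : t ^+ 2 = a ^+ 2 * d ^+ 2 by rewrite real_normK ?num_real// exprMn.
  have t0 : 0 <= t by exact: normr_ge0.
  apply: (@le_trans _ _ (t * (3 / 2 * (p ^+ 2 + q ^+ 2)))).
    have g0 : 0 <= p ^+ 2 + p * q + q ^+ 2 by have := sqr_ge0 (p + q); have := sqr_ge0 (p - q); nra.
    apply: (@le_trans _ _ (t * (p ^+ 2 + p * q + q ^+ 2))).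
      by apply: ler_wpM2r => //; rewrite /t -normrN ler_norm.
    by apply: ler_wpM2l => //; have := sqr_ge0 (p - q); nra.
  rewrite (exprM p 2 2) (exprM q 2 2).
  have := sqr_ge0 (p ^+ 2 / 2 - 3 / 2 * t); have := sqr_ge0 (q ^+ 2 / 2 - 3 / 2 * t).
  by set p2 := p ^+ 2; set q2 := q ^+ 2; nra.
have V : grid_sum (fun i j k => P i j k ^+ 4) <=
   (4^-1 * grid_sum (fun i j k => P i j k ^+ 4) + 4^-1 * grid_sum (fun i j k => Q i j k ^+ 4)) +
   9 / 2 * F * grid_sum (fun i j k => D i j k ^+ 2).
  rewrite {1}E -!grid_sumZ -!grid_sumD; exact: le_grid_sum.
rewrite sum_Q4 in V; lra.
Qed.

(** Discrete form of [(u^3)'' = 3 u^2 u'' + 6 u (u')^2]; the second term is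
controlled by [grid_sum_P4].  The constant is [27 + 2 * 27 * 9]. *)
Lemma norm2_fdiff2_cube : norm2 (fdiff2 L K e (fun i j k => f i j k ^+ 3)) <= 513 * F ^+ 2 * norm2 D.
Proof.
have F0 : 0 <= F by apply: le_trans (fF 0 0 0); exact: sqr_ge0.
rewrite !norm2E mulrCA; apply: ler_wpM2l; first by rewrite exprn_ge0// ltW// gridh_gt0.
have U i j k : fdiff2 L K e (fun i j k => f i j k ^+ 3) i j k ^+ 2 <=
   (27 * F ^+ 2 * D i j k ^+ 2 + 27 * F * P i j k ^+ 4) + 27 * F * Q i j k ^+ 4.
  have fp := fF (i + e.1.1) (j + e.1.2) (k + e.2).
  have fm := fF (i + (opp3 e).1.1) (j + (opp3 e).1.2) (k + (opp3 e).2).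
  rewrite -[f _ _ _]/(translate e f i j k) in fp; rewrite -[f _ _ _]/(translate (opp3 e) f i j k) in fm.
  have f0 := fF i j k.
  have -> : fdiff2 L K e (fun i j k => f i j k ^+ 3) i j k =
     3 * f i j k ^+ 2 * D i j k + P i j k ^+ 2 * (translate e f i j k + 2 * f i j k) +
     Q i j k ^+ 2 * (translate (opp3 e) f i j k + 2 * f i j k).
    rewrite /fdiff2 -[translate e _ i j k]/(translate e f i j k ^+ 3) -[translate (opp3 e) _ i j k]/(translate (opp3 e) f i j k ^+ 3).
    by rewrite !fsh !fshm DE; field.
  move: f0 fp fm; set a := f i j k; set b := translate e f i j k; set c := translate _ f i j k.
  set d := D i j k; set p := P i j k; set q := Q i j k => f0 fp fm.
  have sq3 (x y z : R) : (x + y + z) ^+ 2 <= 3 * (x ^+ 2 + y ^+ 2 + z ^+ 2).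
    by have := sqr_ge0 (x - y); have := sqr_ge0 (y - z); have := sqr_ge0 (x - z); nra.
  apply: le_trans (sq3 _ _ _) _.
  have s1 (u : R) : u ^+ 2 <= F -> (u + 2 * a) ^+ 2 <= 9 * F.
    by move=> uF; have := sqr_ge0 (u - a); nra.
  have e1 : (3 * a ^+ 2 * d) ^+ 2 <= 9 * F ^+ 2 * d ^+ 2.
    have -> : (3 * a ^+ 2 * d) ^+ 2 = 9 * (a ^+ 2) ^+ 2 * d ^+ 2 by ring.
    apply: ler_wpM2r; first exact: sqr_ge0.
    by apply: ler_wpM2l => //; apply: lerXn2r; rewrite ?nnegrE ?sqr_ge0.
  have e2 (u v : R) : u ^+ 2 <= F -> (v ^+ 2 * (u + 2 * a)) ^+ 2 <= 9 * F * v ^+ 4.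
    move=> uF; rewrite exprMn -exprM mulrC; apply: ler_wpM2r; last exact: s1.
    by rewrite (exprM v 2 2) sqr_ge0.
  by have := e2 b p fp; have := e2 c q fm; lra.
have := le_grid_sum U; rewrite !grid_sumD !grid_sumZ sum_Q4.
have := grid_sum_P4; set T := grid_sum (fun i j k => D i j k ^+ 2); set X := grid_sum (fun i j k => P i j k ^+ 4).
move=> XT H; apply: (le_trans H).
have : 54 * F * X <= 54 * F * (9 * F * T) by apply: ler_wpM2l => //; rewrite mulr_ge0.
by rewrite expr2; lra.
Qed.

End Direction.
End CubicEstimate.

(** * Discrete Agmon inequality *)
Section Agmon.
Variable R : realType.
Variables (L : R) (K : nat).
Hypothesis L0 : 0 < L.
Local Notation N := (gridN K).
Local Notation h := (gridh L K).
Local Notation norm2 := (norm2_sq h N).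
Local Notation hnorm2 := (hnorm2 L K).
Implicit Types (f g : grid R).

(** In [agmon_vector], [2 / L^2] comes from the mean value over a period and 8 from
the total variation. *)
Definition agmonC : R := 2 / L ^+ 2 + 8.

Lemma agmonC_gt0 : 0 < agmonC.
Proof. by rewrite /agmonC addr_gt0// divr_gt0// exprn_gt0. Qed.

Lemma sum_CS2 (I J : Type) (s : seq I) (t : seq J) (a b : I -> J -> R) :
  (\sum_(i <- s) \sum_(j <- t) a i j * b i j) ^+ 2 <=
  (\sum_(i <- s) \sum_(j <- t) a i j ^+ 2) * (\sum_(i <- s) \sum_(j <- t) b i j ^+ 2).
Proof.
have := sum_CS [seq (i, j) | i <- s, j <- t] (fun q => a q.1 q.2) (fun q => b q.1 q.2).
by rewrite !big_allpairs_dep.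
Qed.

Section OneDim.
Variables (T : Type) (s : seq T) (g : T -> int -> R).
Hypothesis pg : forall q i, g q (i + N%:Z) = g q i.

Let G i := \sum_(q <- s) g q i ^+ 2.
Let A := h * \sum_(1 <= j < N.+1) G j%:Z.
Let B := h * \sum_(1 <= j < N.+1) \sum_(q <- s) ((g q (j%:Z + 1) - g q j%:Z) / h) ^+ 2.

(** [G] differs from its mean [A / L] by at most its total variation [V], and
[V^2 <= 4 A B] by Cauchy-Schwarz, since [a^2 - b^2 = (a - b) (a + b)].  For
vector-valued sequences the same inequality applies to the restrictions of a grid
function to planes, to lines and to points. *)
Lemma agmon_vector (i : int) : G i ^+ 2 <= agmonC * (A * (A + B)).
Proof.
have h0 : 0 < h by exact: gridh_gt0.
have hn0 : h != 0 by rewrite gt_eqF.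
have G0 t : 0 <= G t by apply: sumr_ge0 => q _; exact: sqr_ge0.
have A0 : 0 <= A by rewrite mulr_ge0 ?(ltW h0)// sumr_ge0.
have B0 : 0 <= B by rewrite mulr_ge0 ?(ltW h0)// sumr_ge0// => t _; apply: sumr_ge0 => q _; exact: sqr_ge0.
have pG t : G (t + N%:Z) = G t by apply: eq_bigr => q _; rewrite pg.
pose V := \sum_(1 <= t < N.+1) `|G (t%:Z + 1) - G t%:Z|.
have V0 : 0 <= V by apply: sumr_ge0 => t _; exact: normr_ge0.
pose H (t : nat) := G (t%:Z + (i - 1)).
have VH : V = \sum_(1 <= t < N.+1) `|H t.+1 - H t|.
  rewrite /V -(sum_shift1 (F := fun t => `|G (t + 1) - G t|) (i - 1)); last first.
    by move=> t; rewrite addrAC !pG.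
  by apply: eq_bigr => t _; congr `|_ - _|; congr G; lia.
have HV m : (0 < m < N.+1)%N -> H 1%N - H m <= V.
  move=> /andP[m0 mN].
  have -> : H 1%N - H m = - (\sum_(1 <= t < m) (H t.+1 - H t)) by rewrite telescope_sumr// opprB.
  apply: le_trans (_ : \sum_(1 <= t < m) `|H t.+1 - H t| <= _).
    by apply: le_trans (ler_norm_sum _ _ _); rewrite -normrN ler_norm.
  rewrite VH [leRHS](@big_cat_nat _ _ _ m)//= ?lerDl; last exact: ltnW.
  by apply: sumr_ge0 => t _; exact: normr_ge0.
have GA : G i <= A / L + V.
  have -> : G i = H 1%N by rewrite /H; congr G; lia.
  have S1 : \sum_(1 <= m < N.+1) H 1%N <= \sum_(1 <= m < N.+1) (H m + V).
    by rewrite [leLHS]big_nat [leRHS]big_nat; apply: ler_sum => m /HV; lra.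
  rewrite big_split /= !sumr_const_nat subn1 /= in S1.
  have E : \sum_(1 <= m < N.+1) H m = \sum_(1 <= m < N.+1) G m%:Z by exact: sum_shift1.
  rewrite E -(mulr_natr (H 1%N)) -(mulr_natr V) in S1.
  have LE : A / L = (\sum_(1 <= m < N.+1) G m%:Z) / N%:R.
    by rewrite /A -[X in _ / X = _](gridhN K L); field; rewrite hn0 gt_eqF// gridN_gt0.
  have N0 := gridN_gt0 R K.
  by rewrite LE -(ler_pM2r N0) mulrDl divfK// gt_eqF.
have VAB : V ^+ 2 <= 4 * (A * B).
  pose a t q : R := `|(g q (t%:Z + 1) - g q t%:Z) / h|.
  pose b (t : nat) q : R := `|g q (t%:Z + 1) + g q t%:Z|.
  have VV : V <= h * \sum_(1 <= t < N.+1) \sum_(q <- s) a t q * b t q.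
    rewrite mulr_sumr; apply: ler_sum => t _; rewrite /G -sumrB mulr_sumr.
    apply: le_trans (ler_norm_sum _ _ _) _; apply: ler_sum => q _.
    rewrite subr_sqr normrM /a /b normrM (gtr0_norm (x := h^-1)) ?invr_gt0//.
    by apply: eq_ler; field.
  have CS := sum_CS2 (index_iota 1 N.+1) s a b.
  have V2 : V ^+ 2 <= h ^+ 2 * (\sum_(1 <= t < N.+1) \sum_(q <- s) a t q * b t q) ^+ 2.
    by rewrite -exprMn; apply: lerXn2r; rewrite ?nnegrE//; exact: le_trans VV.
  apply: (le_trans V2); apply: (@le_trans _ _ (h ^+ 2 * ((\sum_(1 <= t < N.+1) \sum_(q <- s) a t q ^+ 2) *
    (\sum_(1 <= t < N.+1) \sum_(q <- s) b t q ^+ 2)))).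
    by apply: ler_wpM2l => //; exact: sqr_ge0.
  have Ea : h * \sum_(1 <= t < N.+1) \sum_(q <- s) a t q ^+ 2 = B.
    by congr (_ * _); apply: eq_bigr => t _; apply: eq_bigr => q _; rewrite real_normK ?num_real.
  have Eb : h * \sum_(1 <= t < N.+1) \sum_(q <- s) b t q ^+ 2 <= 4 * A.
    have sh1 : \sum_(1 <= t < N.+1) G (t%:Z + 1) = \sum_(1 <= t < N.+1) G t%:Z by exact: sum_shift1.
    have -> : 4 * A = h * (\sum_(1 <= t < N.+1) 2 * (G (t%:Z + 1) + G t%:Z)).
      by rewrite -mulr_sumr big_split /= sh1 /A; ring.
    apply: ler_wpM2l; first exact: ltW.
    apply: ler_sum => t _; rewrite /G -big_split mulr_sumr; apply: ler_sum => q _ /=.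
    rewrite /b real_normK ?num_real//; have := sqr_ge0 (g q (t%:Z + 1) - g q t%:Z); nra.
  have -> : 4 * (A * B) = B * (4 * A) by ring.
  by rewrite expr2 mulrACA Ea; apply: ler_wpM2l.
have AL0 : 0 <= A / L by rewrite divr_ge0// ltW.
have s2 : G i ^+ 2 <= 2 * (A / L) ^+ 2 + 2 * V ^+ 2.
  apply: (@le_trans _ _ ((A / L + V) ^+ 2)).
    by apply: lerXn2r; rewrite ?nnegrE// addr_ge0.
  by have := sqr_ge0 (A / L - V); nra.
apply: (le_trans s2); rewrite /agmonC.
have -> : (A / L) ^+ 2 = A ^+ 2 / L ^+ 2 by rewrite exprMn exprVn.
have i0 : 0 <= 2 / L ^+ 2 by rewrite divr_ge0// sqr_ge0.
have AB0 : 0 <= A * B by exact: mulr_ge0.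
have : 0 <= 2 / L ^+ 2 * (A * B) by exact: mulr_ge0.
have := sqr_ge0 A; rewrite mulrDr mulrDl !mulrDr -expr2.
have -> : 2 * (A ^+ 2 / L ^+ 2) = 2 / L ^+ 2 * A ^+ 2 by ring.
lra.
Qed.

End OneDim.

Definition plane_sum f (i : int) : R := h ^+ 2 * \sum_(1 <= j < N.+1) \sum_(1 <= k < N.+1) f i j%:Z k%:Z ^+ 2.
Definition line_sum f (i j : int) : R := h * \sum_(1 <= k < N.+1) f i j k%:Z ^+ 2.

Let h0 : 0 < h. Proof. exact: gridh_gt0. Qed.

Lemma norm2_plane_sum f : norm2 f = h * \sum_(1 <= i < N.+1) plane_sum f i%:Z.
Proof.
rewrite /norm2_sq /inner /plane_sum -mulr_sumr mulrA -exprS; congr (_ * _).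
Qed.

Lemma plane_sum_line_sum f i : plane_sum f i = h * \sum_(1 <= j < N.+1) line_sum f i j%:Z.
Proof. by rewrite /plane_sum /line_sum -mulr_sumr mulrA -expr2. Qed.

(** The three directions are treated one after the other: the square of the L^2
norm on a plane is controlled by norms on the whole grid, that on a line by norms
on a plane, and the value at a point by norms on a line. *)
Lemma agmon_x f i : Vper N f ->
  plane_sum f i ^+ 2 <= agmonC * (norm2 f * (norm2 f + norm2 (fdiff L K ex f))).
Proof.
move=> pf.
pose s := [seq (j, k) | j <- index_iota 1 N.+1, k <- index_iota 1 N.+1].
pose g (q : nat * nat) i := f i q.1%:Z q.2%:Z.
have pg q t : g q (t + N%:Z) = g q t by case: (pf t q.1%:Z q.2%:Z).
have H := agmon_vector s pg i.
have E2 (u : int -> int -> int -> R) (t : int) :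
    \sum_(q <- s) u t q.1%:Z q.2%:Z = \sum_(1 <= j < N.+1) \sum_(1 <= k < N.+1) u t j%:Z k%:Z.
  by rewrite /s big_allpairs_dep.
have G2 t : \sum_(q <- s) g q t ^+ 2 = h ^- 2 * plane_sum f t.
  rewrite /plane_sum mulrA mulVf ?mul1r; last by rewrite expf_neq0// gt_eqF.
  exact: (E2 (fun i j k => f i j k ^+ 2)).
have D2 (t : nat) : \sum_(q <- s) ((g q (t%:Z + 1) - g q t%:Z) / h) ^+ 2 = h ^- 2 * plane_sum (fdiff L K ex f) t%:Z.
  rewrite /plane_sum mulrA mulVf ?mul1r; last by rewrite expf_neq0// gt_eqF.
  rewrite -(E2 (fun i j k => fdiff L K ex f i j k ^+ 2)); apply: eq_bigr => q _.
  by rewrite /g /fdiff /translate /= !addr0.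
have ES (u : int -> R) : \sum_(1 <= t < N.+1) h ^- 2 * u t%:Z = h ^- 2 * \sum_(1 <= t < N.+1) u t%:Z.
  by rewrite mulr_sumr.
rewrite G2 (eq_bigr _ (fun t _ => G2 t%:Z)) ES (eq_bigr _ (fun t _ => D2 t)) ES in H.
rewrite !norm2_plane_sum; set X := \sum_(1 <= t < N.+1) plane_sum f t in H *; set Y := \sum_(1 <= t < N.+1) _ in H *.
have c0 : 0 < (h ^- 2) ^+ 2 by rewrite exprn_gt0// invr_gt0 exprn_gt0.
rewrite -(ler_pM2l c0) -exprMn.
by have -> : (h ^- 2) ^+ 2 * (agmonC * (h * X * (h * X + h * Y))) =
  agmonC * (h * (h ^- 2 * X) * (h * (h ^- 2 * X) + h * (h ^- 2 * Y))) by ring.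
Qed.

Lemma agmon_y f i j : Vper N f ->
  line_sum f i j ^+ 2 <= agmonC * (plane_sum f i * (plane_sum f i + plane_sum (fdiff L K ey f) i)).
Proof.
move=> pf.
pose s := index_iota 1 N.+1.
pose g (q : nat) j := f i j q%:Z.
have pg q t : g q (t + N%:Z) = g q t by case: (pf i t q%:Z).
have H := agmon_vector s pg j.
have hn : h != 0 by rewrite gt_eqF.
have G2 t : \sum_(q <- s) g q t ^+ 2 = h^-1 * line_sum f i t.
  by rewrite /line_sum mulrA mulVf ?mul1r.
have D2 (t : nat) : \sum_(q <- s) ((g q (t%:Z + 1) - g q t%:Z) / h) ^+ 2 = h^-1 * line_sum (fdiff L K ey f) i t%:Z.
  rewrite /line_sum mulrA mulVf ?mul1r//; apply: eq_bigr => q _.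
  by rewrite /g /fdiff /translate /= !addr0.
have ES (u : int -> R) : \sum_(1 <= t < N.+1) h^-1 * u t%:Z = h^-1 * \sum_(1 <= t < N.+1) u t%:Z.
  by rewrite mulr_sumr.
rewrite G2 (eq_bigr _ (fun t _ => G2 t%:Z)) ES (eq_bigr _ (fun t _ => D2 t)) ES in H.
rewrite !plane_sum_line_sum; set X := \sum_(1 <= t < N.+1) line_sum f i t in H *; set Y := \sum_(1 <= t < N.+1) _ in H *.
have c0 : 0 < h^-1 ^+ 2 by rewrite exprn_gt0// invr_gt0.
rewrite -(ler_pM2l c0) -exprMn.
by have -> : h^-1 ^+ 2 * (agmonC * (h * X * (h * X + h * Y))) =
  agmonC * (h * (h^-1 * X) * (h * (h^-1 * X) + h * (h^-1 * Y))) by ring.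
Qed.

Lemma agmon_z f i j k : Vper N f ->
  (f i j k ^+ 2) ^+ 2 <= agmonC * (line_sum f i j * (line_sum f i j + line_sum (fdiff L K ez f) i j)).
Proof.
move=> pf.
pose g (q : unit) k := f i j k.
have pg q t : g q (t + N%:Z) = g q t by case: (pf i j t).
have H := agmon_vector [:: tt] pg k.
have E1 t : \sum_(q <- [:: tt]) g q t ^+ 2 = f i j t ^+ 2 by rewrite big_seq1.
have E2 (t : nat) : \sum_(q <- [:: tt]) ((g q (t%:Z + 1) - g q t%:Z) / h) ^+ 2 =
    fdiff L K ez f i j t%:Z ^+ 2 by rewrite big_seq1 /g /fdiff /translate /= !addr0.
rewrite E1 (eq_bigr _ (fun t _ => E1 t%:Z)) (eq_bigr _ (fun t _ => E2 t)) in H.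
exact: H.
Qed.

Let line_sum_ge0 f i j : 0 <= line_sum f i j.
Proof. by rewrite mulr_ge0 ?(ltW h0)// sumr_ge0// => k _; exact: sqr_ge0. Qed.
Let plane_sum_ge0 f i : 0 <= plane_sum f i.
Proof.
by rewrite mulr_ge0 ?sqr_ge0// sumr_ge0// => j _; apply: sumr_ge0 => k _; exact: sqr_ge0.
Qed.

Let sq_add (a b : R) : (a + b) ^+ 2 <= 2 * (a ^+ 2 + b ^+ 2).
Proof. by have := sqr_ge0 (a - b); nra. Qed.

Let n_ge0 j f : 0 <= hnorm2 j f. Proof. exact: hnorm2_ge0. Qed.

Lemma plane_sum_bound f i : Vper N f -> plane_sum f i ^+ 2 <= 2 * agmonC * (hnorm2 0 f * hnorm2 1 f).
Proof.
move=> pf; apply: le_trans (agmon_x i pf) _; rewrite -!hnorm2_0//.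
have D : hnorm2 0 (fdiff L K ex f) <= hnorm2 1 f by apply: hnorm2_fdiff; rewrite // inE eqxx.
have M : hnorm2 0 f <= hnorm2 1 f by exact: hnorm2_le.
have -> : 2 * agmonC * (hnorm2 0 f * hnorm2 1 f) = agmonC * (hnorm2 0 f * (hnorm2 1 f + hnorm2 1 f)) by ring.
by do 2 (apply: ler_wpM2l; first by rewrite // ltW// agmonC_gt0); lra.
Qed.

Lemma line_sum_bound f i j : Vper N f ->
  line_sum f i j ^+ 4 <= 16 * agmonC ^+ 4 * (hnorm2 0 f * hnorm2 1 f ^+ 2 * hnorm2 2 f).
Proof.
move=> pf; have pD : Vper N (fdiff L K ey f) by exact: Vper_fdiff.
have C0 := agmonC_gt0.
have a := plane_sum_bound i pf.
have b : plane_sum (fdiff L K ey f) i ^+ 2 <= 2 * agmonC * (hnorm2 1 f * hnorm2 2 f).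
  apply: le_trans (plane_sum_bound i pD) _; apply: ler_wpM2l; first by lra.
  by apply: ler_pM => //; apply: hnorm2_fdiff; rewrite // !inE eqxx ?orbT.
have M : 2 * agmonC * (hnorm2 0 f * hnorm2 1 f) <= 2 * agmonC * (hnorm2 1 f * hnorm2 2 f).
  by apply: ler_wpM2l; [lra|apply: ler_pM => //; exact: hnorm2_le].
have c : (plane_sum f i + plane_sum (fdiff L K ey f) i) ^+ 2 <= 8 * agmonC * (hnorm2 1 f * hnorm2 2 f).
  by apply: le_trans (sq_add _ _) _; lra.
rewrite (exprM _ 2 2); apply: le_trans (_ : (agmonC * (plane_sum f i * (plane_sum f i + plane_sum (fdiff L K ey f) i))) ^+ 2 <= _).
  apply: lerXn2r; rewrite ?nnegrE; [exact: sqr_ge0| |exact: agmon_y].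
  by apply: mulr_ge0; [exact: ltW|apply: mulr_ge0 => //; exact: addr_ge0].
have -> : 16 * agmonC ^+ 4 * (hnorm2 0 f * hnorm2 1 f ^+ 2 * hnorm2 2 f) =
   agmonC ^+ 2 * ((2 * agmonC * (hnorm2 0 f * hnorm2 1 f)) * (8 * agmonC * (hnorm2 1 f * hnorm2 2 f))) by ring.
rewrite (exprMn _ agmonC) (exprMn _ (plane_sum f i)); apply: ler_wpM2l; first exact: sqr_ge0.
by apply: ler_pM => //; exact: sqr_ge0.
Qed.

(** Each of the three applications of the one-dimensional inequality squares the
left hand side and loses at most one difference, whence the eighth power of
[f^2] and the norms up to the third one. *)
Lemma sup_bound f i j k : Vper N f ->
  (f i j k ^+ 2) ^+ 8 <= 4096 * agmonC ^+ 12 * (hnorm2 0 f * hnorm2 1 f ^+ 3 * hnorm2 2 f ^+ 3 * hnorm2 3 f).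
Proof.
move=> pf; have pD : Vper N (fdiff L K ez f) by exact: Vper_fdiff.
have C0 := agmonC_gt0.
have a := line_sum_bound i j pf.
have DD m : hnorm2 m (fdiff L K ez f) <= hnorm2 m.+1 f by apply: hnorm2_fdiff; rewrite // !inE eqxx ?orbT.
have b : line_sum (fdiff L K ez f) i j ^+ 4 <= 16 * agmonC ^+ 4 * (hnorm2 1 f * hnorm2 2 f ^+ 2 * hnorm2 3 f).
  apply: le_trans (line_sum_bound i j pD) _; apply: ler_wpM2l.
    by rewrite mulr_ge0// exprn_ge0// ltW.
  apply: ler_pM => //; first by rewrite mulr_ge0// exprn_ge0.
  apply: ler_pM => //; first exact: exprn_ge0.
  by apply: lerXn2r; rewrite ?nnegrE.
have M : hnorm2 0 f * hnorm2 1 f ^+ 2 * hnorm2 2 f <= hnorm2 1 f * hnorm2 2 f ^+ 2 * hnorm2 3 f.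
  apply: ler_pM => //; [by rewrite mulr_ge0// exprn_ge0| |exact: hnorm2_le].
  apply: ler_pM => //; [exact: exprn_ge0|exact: hnorm2_le|].
  by apply: lerXn2r; rewrite ?nnegrE//; exact: hnorm2_le.
have M' : 16 * agmonC ^+ 4 * (hnorm2 0 f * hnorm2 1 f ^+ 2 * hnorm2 2 f) <=
    16 * agmonC ^+ 4 * (hnorm2 1 f * hnorm2 2 f ^+ 2 * hnorm2 3 f).
  by apply: ler_wpM2l => //; rewrite mulr_ge0// exprn_ge0// ltW.
have c : (line_sum f i j + line_sum (fdiff L K ez f) i j) ^+ 4 <= 256 * agmonC ^+ 4 * (hnorm2 1 f * hnorm2 2 f ^+ 2 * hnorm2 3 f).
  have q : (line_sum f i j + line_sum (fdiff L K ez f) i j) ^+ 4 <= 8 * (line_sum f i j ^+ 4 + line_sum (fdiff L K ez f) i j ^+ 4).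
    set x := line_sum f i j; set y := line_sum _ i j; rewrite (exprM _ 2 2) (exprM x 2 2) (exprM y 2 2).
    apply: le_trans (_ : (2 * (x ^+ 2 + y ^+ 2)) ^+ 2 <= _).
      by apply: lerXn2r; rewrite ?nnegrE ?sqr_ge0// mulr_ge0// addr_ge0// sqr_ge0.
    by have := sq_add (x ^+ 2) (y ^+ 2); rewrite exprMn; lra.
  by apply: (le_trans q); lra.
have -> : 8%N = (2 * 4)%N by [].
rewrite exprM; apply: le_trans (_ : (agmonC * (line_sum f i j * (line_sum f i j + line_sum (fdiff L K ez f) i j))) ^+ 4 <= _).
  apply: lerXn2r; rewrite ?nnegrE; [exact: sqr_ge0| |exact: agmon_z].
  by apply: mulr_ge0; [exact: ltW|apply: mulr_ge0 => //; exact: addr_ge0].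
have -> : 4096 * agmonC ^+ 12 * (hnorm2 0 f * hnorm2 1 f ^+ 3 * hnorm2 2 f ^+ 3 * hnorm2 3 f) =
  agmonC ^+ 4 * ((16 * agmonC ^+ 4 * (hnorm2 0 f * hnorm2 1 f ^+ 2 * hnorm2 2 f)) *
              (256 * agmonC ^+ 4 * (hnorm2 1 f * hnorm2 2 f ^+ 2 * hnorm2 3 f))) by ring.
rewrite (exprMn _ agmonC) (exprMn _ (line_sum f i j)); apply: ler_wpM2l; first by rewrite exprn_ge0// ltW.
by apply: ler_pM => //; apply: exprn_ge0; rewrite ?addr_ge0.
Qed.

End Agmon.

(** * Cubic term *)
Section CubeEta.
Variable R : realType.
Variables (L : R) (K : nat).
Hypothesis L0 : 0 < L.
Local Notation N := (gridN K).
Local Notation h := (gridh L K).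
Local Notation norm2 := (norm2_sq h N).
Local Notation hnorm2 := (hnorm2 L K).
Implicit Types (f g : grid R).

Definition cubeC0 : R := 16 * 513.
Definition cubeC : R := cubeC0 ^+ 6 * 64 ^+ 3 * agmonC L ^+ 18.

Lemma cubeC0_gt0 : 0 < cubeC0. Proof. by apply: mulr_gt0; rewrite ltr0n. Qed.

Lemma cubeC_gt0 : 0 < cubeC.
Proof.
apply: mulr_gt0; last by apply: exprn_gt0; exact: agmonC_gt0.
by apply: mulr_gt0; apply: exprn_gt0; [exact: cubeC0_gt0|rewrite ltr0n].
Qed.

Lemma Vper_cube f : Vper N f -> Vper N (fun i j k => f i j k ^+ 3).
Proof. exact: (Vper_map1 (fun a => a ^+ 3)). Qed.

Lemma norm2_ge0 f : 0 <= norm2 f.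
Proof. by rewrite -hnorm2_0//; exact: hnorm2_ge0. Qed.

Lemma norm2_Lap4_cube f (F : R) : Vper N f -> (forall i j k, f i j k ^+ 2 <= F) ->
  norm2 (Lap4 h (fun i j k => f i j k ^+ 3)) <= cubeC0 * (F ^+ 2 * hnorm2 2 f).
Proof.
move=> pf fF; apply: le_trans (norm2_Lap4_le L0 (Vper_cube pf)) _.
have B e : e \in [:: ex; ey; ez] ->
    norm2 (fdiff2 L K e (fun i j k => f i j k ^+ 3)) <= 513 * F ^+ 2 * hnorm2 2 f.
  move=> eE; apply: le_trans (norm2_fdiff2_cube L0 e pf fF) _; apply: ler_wpM2l.
    by apply: mulr_ge0; [rewrite ler0n|exact: sqr_ge0].
  exact: norm2_fdiff2.
have := B ex; have := B ey; have := B ez; rewrite !inE !eqxx ?orbT /=.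
by rewrite /cubeC0 => /(_ isT) ? /(_ isT) ? /(_ isT) ?; lra.
Qed.

(** With [x] the squared H^4 norm and [F] the bound of [f^2], one has [y <= C F^2 hnorm2 2],
[F^8 <= C m^6 x^2] by [sup_bound] and [(hnorm2 2)^3 <= m^2 x] by interpolation.
The exponent of [x] in the resulting bound of [y] is 5/6, smaller than 1: the
cubic nonlinearity is subcritical. *)
Lemma cube_power f (m : R) : Vper N f -> hnorm2 1 f <= m ->
  norm2 (Lap4 h (fun i j k => f i j k ^+ 3)) ^+ 6 <= cubeC * m ^+ 13 * hnorm2 4 f ^+ 5.
Proof.
move=> pf m1; set y := norm2 _; set x := hnorm2 4 f.
have n0 j : 0 <= hnorm2 j f by exact: hnorm2_ge0.
have m0 : 0 <= m by exact: le_trans (n0 1%N) m1.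
have C0 := agmonC_gt0 L0.
pose Z := 4096 * agmonC L ^+ 12 * (hnorm2 0 f * hnorm2 1 f ^+ 3 * hnorm2 2 f ^+ 3 * hnorm2 3 f).
have Z0 : 0 <= Z.
  apply: mulr_ge0; first by apply: mulr_ge0; [rewrite ler0n|rewrite exprn_ge0// ltW].
  by do 3 (apply: mulr_ge0; rewrite ?exprn_ge0//).
pose F := Num.sqrt (Num.sqrt (Num.sqrt Z)).
have F0 : 0 <= F by exact: sqrtr_ge0.
have F8 : F ^+ 8 = Z by rewrite (exprM _ 2 4) sqr_sqrtr ?sqrtr_ge0// (exprM _ 2 2) !sqr_sqrtr ?sqrtr_ge0.
have fF i j k : f i j k ^+ 2 <= F.
  have := sup_bound L0 i j k pf; rewrite -/Z -F8.
  by rewrite ler_pXn2r// ?nnegrE ?sqr_ge0.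
have yF := norm2_Lap4_cube pf fF; rewrite -/y in yF.
have y0 : 0 <= y by exact: norm2_ge0.
pose a : R := 64; have a0 : 0 <= a by rewrite ler0n.
pose b : R := cubeC0; have b0 : 0 <= b by exact: ltW cubeC0_gt0.
have aE : 4096 = a ^+ 2 by rewrite /a; ring.
have n2 : hnorm2 2 f ^+ 3 <= m ^+ 2 * x.
  have I : hnorm2 2 f ^+ 3 <= hnorm2 1 f ^+ 2 * x by exact: hnorm2_interp.
  apply: (le_trans I); apply: ler_wpM2r; first exact: n0.
  by apply: lerXn2r; rewrite ?nnegrE.
have ZB : Z <= a ^+ 2 * agmonC L ^+ 12 * (m ^+ 6 * x ^+ 2).
  rewrite /Z aE; apply: ler_wpM2l.
    by apply: mulr_ge0; apply: exprn_ge0 => //; exact: ltW.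
  have -> : m ^+ 6 * x ^+ 2 = m * m ^+ 3 * (m ^+ 2 * x) * x by ring.
  have n01 : hnorm2 0 f <= m by apply: le_trans m1; exact: hnorm2_le.
  have n34 : hnorm2 3 f <= x by exact: hnorm2_le.
  apply: ler_pM => //; first by do 2 (apply: mulr_ge0; last by apply: exprn_ge0); exact: n0.
  apply: ler_pM => //; [by apply: mulr_ge0 => //; exact: exprn_ge0|exact: exprn_ge0|].
  apply: ler_pM => //; first exact: exprn_ge0.
  by apply: lerXn2r; rewrite ?nnegrE.
have x0 : 0 <= x by exact: n0.
(* the twelfth power clears the eighth root in [F] and the cube root in [hnorm2 2] *)
have N12 : y ^+ 12 <= (cubeC * m ^+ 13 * x ^+ 5) ^+ 2.
  have -> : (cubeC * m ^+ 13 * x ^+ 5) ^+ 2 =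
     b ^+ 12 * ((a ^+ 2 * agmonC L ^+ 12 * (m ^+ 6 * x ^+ 2)) ^+ 3 * (m ^+ 2 * x) ^+ 4).
    by rewrite /cubeC -/a -/b; ring.
  apply: le_trans (_ : (b * (F ^+ 2 * hnorm2 2 f)) ^+ 12 <= _).
    by apply: lerXn2r; rewrite ?nnegrE; [exact: y0|exact: le_trans y0 yF|exact: yF].
  rewrite (exprMn _ b) (exprMn _ (F ^+ 2)); apply: ler_wpM2l; first exact: exprn_ge0.
  have -> : (F ^+ 2) ^+ 12 = Z ^+ 3 by rewrite -F8 -!exprM.
  rewrite (exprM (hnorm2 2 f) 3 4); apply: ler_pM; [exact: exprn_ge0|by do 2 apply: exprn_ge0| |].
    by apply: lerXn2r => //; rewrite nnegrE; exact: le_trans Z0 ZB.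
  apply: lerXn2r => //; rewrite nnegrE; first exact: exprn_ge0.
  by apply: mulr_ge0 => //; exact: exprn_ge0.
have R0 : 0 <= cubeC * m ^+ 13 * x ^+ 5.
  apply: mulr_ge0; last exact: exprn_ge0.
  by apply: mulr_ge0; [exact: ltW cubeC_gt0|exact: exprn_ge0].
by move: N12; rewrite (exprM y 6 2) ler_pXn2r// nnegrE exprn_ge0.
Qed.

(** If [y > eta x], then [y^6 <= c x^5 <= c (y / eta)^5] bounds [y] by [c / eta^5]. *)
Lemma cube_eta f (m eta : R) : 0 < eta -> Vper N f -> hnorm2 1 f <= m ->
  norm2 (Lap4 h (fun i j k => f i j k ^+ 3)) <= eta * hnorm2 4 f + cubeC * m ^+ 13 / eta ^+ 5.
Proof.
move=> e0 pf m1; have := cube_power pf m1; set y := norm2 _; set x := hnorm2 4 f => H.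
have x0 : 0 <= x by exact: hnorm2_ge0.
have m0 : 0 <= m by apply: le_trans m1; exact: hnorm2_ge0.
have c0 : 0 <= cubeC * m ^+ 13 by rewrite mulr_ge0 ?exprn_ge0// ltW// cubeC_gt0.
have q0 : 0 <= cubeC * m ^+ 13 / eta ^+ 5 by rewrite divr_ge0// exprn_ge0// ltW.
have [yx|xy] := leP y (eta * x); first by apply: (le_trans yx); rewrite lerDl.
have y0 : 0 < y by apply: le_lt_trans xy; rewrite mulr_ge0// ltW.
apply: le_trans (_ : cubeC * m ^+ 13 / eta ^+ 5 <= _); last by rewrite lerDr mulr_ge0// ltW.
rewrite ler_pdivlMr ?exprn_gt0// -(ler_pM2r (exprn_gt0 5 y0)).
apply: le_trans (_ : cubeC * m ^+ 13 * (eta * x) ^+ 5 <= _); last first.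
  apply: ler_wpM2l => //; apply: lerXn2r; rewrite ?nnegrE; last exact: ltW.
    by apply: mulr_ge0 => //; exact: ltW.
  exact: ltW.
have -> : y * eta ^+ 5 * y ^+ 5 = eta ^+ 5 * y ^+ 6 by ring.
have -> : cubeC * m ^+ 13 * (eta * x) ^+ 5 = eta ^+ 5 * (cubeC * m ^+ 13 * x ^+ 5) by ring.
by apply: ler_wpM2l => //; rewrite exprn_ge0// ltW.
Qed.

End CubeEta.

(** * Decay of the modified energy *)
Section EnergyStep.
Variable R : realType.
Variables (L : R) (K : nat).
Hypothesis L0 : 0 < L.
Local Notation N := (gridN K).
Local Notation h := (gridh L K).
Local Notation norm2 := (norm2_sq h N).
Local Notation norm4 := (norm4_pow4 h N).
Local Notation ip := (inner h N).
Local Notation G := (grad4_sq h N).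
Local Notation Lap := (Lap4 h).
Implicit Types (f g p q r psi : grid R).

Lemma Lap4_lin (a b : R) f g i j k :
  Lap (fun i j k => a * f i j k + b * g i j k) i j k = a * Lap f i j k + b * Lap g i j k.
Proof. by rewrite /Lap4 /D2x4 /D2y4 /D2z4 /D2x /D2y /D2z; ring. Qed.

Lemma Lap4_linE (a b : R) f g :
  Lap (fun i j k => a * f i j k + b * g i j k) = fun i j k => a * Lap f i j k + b * Lap g i j k.
Proof. by apply: funext3 => i j k; exact: Lap4_lin. Qed.

Lemma inner_grid_sum f g : ip f g = h ^+ 3 * grid_sum K (fun i j k => f i j k * g i j k).
Proof. exact: innerE. Qed.

Lemma innerC f g : ip f g = ip g f.
Proof. by rewrite !inner_grid_sum; congr (_ * _); apply: eq_grid_sum => i j k; rewrite mulrC. Qed.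

Lemma inner_linl (a b : R) f g u :
  ip (fun i j k => a * f i j k + b * g i j k) u = a * ip f u + b * ip g u.
Proof.
rewrite !inner_grid_sum [a * _]mulrCA [b * _]mulrCA -mulrDr; congr (_ * _).
by rewrite -(grid_sumZ K a) -(grid_sumZ K b) -grid_sumD; apply: eq_grid_sum => i j k; ring.
Qed.

Lemma inner_linr (a b : R) f g u :
  ip u (fun i j k => a * f i j k + b * g i j k) = a * ip u f + b * ip u g.
Proof. by rewrite innerC inner_linl !(innerC u). Qed.

Lemma eq_inner f g u v : (forall i j k, f i j k * g i j k = u i j k * v i j k) -> ip f g = ip u v.
Proof. by move=> H; rewrite !inner_grid_sum; congr (_ * _); exact: eq_grid_sum. Qed.

(** Polarisation of [grad4_sq]. *)
Definition dirichlet f g : R := - ip f (Lap g).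

Lemma innerNr f g : ip f (fun i j k => - g i j k) = - ip f g.
Proof.
have := inner_linr (- 1) 0 g g f; rewrite mulN1r mul0r addr0 => <-.
by apply: eq_inner => i j k; ring.
Qed.

Lemma grad4_dirichlet f : G f = dirichlet f f. Proof. by rewrite /grad4_sq innerNr. Qed.

Lemma dirichletC f g : Vper N f -> Vper N g -> dirichlet f g = dirichlet g f.
Proof. by move=> pf pg; rewrite /dirichlet inner_Lap4// innerC. Qed.

Lemma grad4_lin (a b : R) f g : Vper N f -> Vper N g ->
  G (fun i j k => a * f i j k + b * g i j k) = a ^+ 2 * G f + 2 * a * b * dirichlet f g + b ^+ 2 * G g.
Proof.
move=> pf pg; rewrite !grad4_dirichlet {1}/dirichlet Lap4_linE inner_linl !inner_linr.
by have := dirichletC pf pg; rewrite /dirichlet => /eqP; rewrite eqr_opp => /eqP ->; ring.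
Qed.

Lemma Vper_lin (a b : R) f g : Vper N f -> Vper N g -> Vper N (fun i j k => a * f i j k + b * g i j k).
Proof. by move=> pf pg; apply: (Vper_map2 (fun x y => a * x + b * y)). Qed.

Lemma norm2_lin (a b : R) f g :
  norm2 (fun i j k => a * f i j k + b * g i j k) = a ^+ 2 * norm2 f + 2 * a * b * ip f g + b ^+ 2 * norm2 g.
Proof. by rewrite /norm2_sq inner_linl !inner_linr (innerC g f); ring. Qed.

(** Tangent inequality for the convex function [x^4 / 4]. *)
Lemma cube_convex p q : (norm4 p - norm4 q) / 4 <=
  ip (fun i j k => p i j k ^+ 3) (fun i j k => p i j k - q i j k).
Proof.
rewrite -subr_ge0.
have -> : ip (fun i j k => p i j k ^+ 3) (fun i j k => p i j k - q i j k) - (norm4 p - norm4 q) / 4 =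
   h ^+ 3 * grid_sum K (fun i j k => p i j k ^+ 3 * (p i j k - q i j k)
     + ((- 4^-1) * p i j k ^+ 4 + 4^-1 * q i j k ^+ 4)).
  rewrite !grid_sumD !grid_sumZ /norm4_pow4 !inner_grid_sum.
  have E u : grid_sum K (fun i j k => u i j k ^+ 4 * 1) = grid_sum K (fun i j k => u i j k ^+ 4).
    by apply: eq_grid_sum => i j k; rewrite mulr1.
  by rewrite !E; field.
apply: mulr_ge0; first by rewrite exprn_ge0// ltW// gridh_gt0.
apply: grid_sum_ge0 => i j k; set a := p i j k; set b := q i j k.
have -> : a ^+ 3 * (a - b) + (- 4^-1 * a ^+ 4 + 4^-1 * b ^+ 4) =
  4^-1 * ((a - b) ^+ 2 * (2 * a ^+ 2 + (a + b) ^+ 2)) by field.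
apply: mulr_ge0; first by rewrite invr_ge0.
apply: mulr_ge0; first exact: sqr_ge0.
by apply: addr_ge0; [apply: mulr_ge0 => //|]; exact: sqr_ge0.
Qed.

Variables (A eps dt : R).
Hypotheses (A0 : 1 / 16 <= A) (eps0 : 0 < eps) (dt0 : 0 < dt).

Local Notation mu := (mu_step h eps dt A).

Definition grid_sub p q : grid R := fun i j k => p i j k - q i j k.

Lemma grid_subE p q : grid_sub p q = fun i j k => 1 * p i j k + (- 1) * q i j k.
Proof. by apply: funext3 => i j k; rewrite /grid_sub; ring. Qed.

Lemma Vper_grid_sub p q : Vper N p -> Vper N q -> Vper N (grid_sub p q).
Proof. by move=> pp pq; rewrite grid_subE; exact: Vper_lin. Qed.

Definition bdf_step p q r := forall i j k,
  (3 / 2 * p i j k - 2 * q i j k + 1 / 2 * r i j k) / dt = Lap (mu p q r) i j k.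

(** The Dirichlet integral of [psi] is the squared discrete H^-1 norm of [p - q]. *)
Definition potential psi p q := forall i j k, p i j k - q i j k = - Lap psi i j k.

(** The scheme reads [3/2 (p - q) - 1/2 (q - r) = dt Lap mu]; solving it for [p - q]
and replacing [q - r] by [- Lap psi] gives this potential of [p - q]. *)
Definition next_potential psi p q r : grid R :=
  fun i j k => 3^-1 * psi i j k + (- (2 / 3 * dt)) * mu p q r i j k.

Definition mod_energy p q psi : R :=
  energy h N eps p + (4 * dt)^-1 * G psi + (2 * eps)^-1 * norm2 (grid_sub p q).

Lemma muE p q r : mu p q r = fun i j k => 1 * (fun i j k =>
   eps^-1 * p i j k ^+ 3 + eps^-1 * (-2 * q i j k + 1 * r i j k)) i j k +
   1 * (fun i j k => (- eps) * Lap p i j k + (- (A * eps ^- 2 * dt)) * Lap (grid_sub p q) i j k) i j k.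
Proof. by apply: funext3 => i j k; rewrite /mu_step /grid_sub; ring. Qed.

Lemma Vper_mu p q r : Vper N p -> Vper N q -> Vper N r -> Vper N (mu p q r).
Proof.
move=> pp pq pr; rewrite muE; apply: Vper_lin; apply: Vper_lin.
- exact: Vper_cube.
- exact: Vper_lin.
- exact: Vper_Lap4.
- by apply: Vper_Lap4; exact: Vper_grid_sub.
Qed.

Lemma next_potentialP psi p q r : bdf_step p q r -> potential psi q r ->
  potential (next_potential psi p q r) p q.
Proof.
move=> bs po i j k; rewrite /next_potential Lap4_lin -bs.
have -> : Lap psi i j k = - (q i j k - r i j k) by rewrite po opprK.
by field; rewrite gt_eqF.
Qed.

Lemma inner_grid_sub u p q : ip u (grid_sub p q) = ip u p - ip u q.
Proof. by rewrite grid_subE inner_linr; ring. Qed.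

Lemma inner_potential u psi p q : potential psi p q -> ip u (grid_sub p q) = dirichlet u psi.
Proof.
by move=> po; rewrite /dirichlet -innerNr; apply: eq_inner => i j k; rewrite /grid_sub po.
Qed.

(** The scheme is tested with the new potential [psi'].  Convexity handles the cube
and the surface diffusion.  The explicit term [- 2 q + r] leaves [||p - q||^2 / (2 eps)]
on the wrong side, which the H^-1 term and the stabilising term absorb. *)
Lemma energy_step psi p q r : Vper N p -> Vper N q -> Vper N r -> Vper N psi ->
  bdf_step p q r -> potential psi q r ->
  mod_energy p q (next_potential psi p q r) <= mod_energy q r psi.
Proof.
move=> pp pq pr ps bs po.
set psi' := next_potential psi p q r; set d := grid_sub q r; set d' := grid_sub p q.
have po' : potential psi' p q by exact: next_potentialP.
have pmu := Vper_mu pp pq pr.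
have ps' : Vper N psi' by exact: Vper_lin.
have pd : Vper N d by exact: Vper_grid_sub.
have pd' : Vper N d' by exact: Vper_grid_sub.
have Gge0 f : Vper N f -> 0 <= G f by move=> pf; exact: grad4_ge0.
have E1 : 3 / 2 * G psi' - 1 / 2 * dirichlet psi psi' = - dt * ip (mu p q r) d'.
  have <- : ip psi' d' = G psi' by rewrite (inner_potential _ po') grad4_dirichlet.
  have <- : ip psi d' = dirichlet psi psi' by rewrite (inner_potential _ po').
  by rewrite {1}/psi' /next_potential inner_linl; field.
have E2 : dirichlet psi psi' <= (G psi + G psi') / 2.
  have := Gge0 _ (Vper_lin 1 (- 1) ps ps'); rewrite grad4_lin//; lra.
have nd : norm2 d' = dirichlet d' psi' by rewrite /norm2_sq (inner_potential _ po').
(* Interpolation of [d'] between H^-1 and H^1, from the square of the gradient of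
   [psi' - dt / (4 eps) d'].  The parameter is chosen so that the first term is
   the one available; the second one then has the constant 1/16 of [A0]. *)
have E3 : dt / (2 * eps) * norm2 d' <= G psi' + dt ^+ 2 / (16 * eps ^+ 2) * G d'.
  have := Gge0 _ (Vper_lin 1 (- (dt / (4 * eps))) ps' pd').
  rewrite grad4_lin// (dirichletC ps' pd') -nd => H; rewrite -subr_ge0; apply: (le_trans H).
  by apply: eq_ler; field; rewrite gt_eqF.
have E4 : ip (mu p q r) d' = eps^-1 * (ip (fun i j k => p i j k ^+ 3) d' - ip q d' - ip d d')
    + eps * dirichlet p d' + A * eps ^- 2 * dt * G d'.
  rewrite muE inner_linl inner_linl inner_linl inner_linl grad4_dirichlet /dirichlet -!inner_Lap4//.
  have -> : ip d d' = ip q d' - ip r d' by rewrite !(innerC _ d') inner_grid_sub.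
  by rewrite !inner_Lap4// -/d'; ring.
have E5 := cube_convex p q; rewrite -/(grid_sub p q) -/d' in E5.
have E6 : ip q d' = (norm2 p - norm2 q - norm2 d') / 2.
  by rewrite /d' /norm2_sq inner_grid_sub grid_subE inner_linl !inner_linr (innerC q p); field.
have E7 : ip d d' <= (norm2 d + norm2 d') / 2.
  have H0 : 0 <= norm2 (fun i j k => 1 * d i j k + (- 1) * d' i j k) by exact: norm2_ge0.
  by move: H0; rewrite norm2_lin; lra.
have E8 : (G p - G q) / 2 <= dirichlet p d'.
  have -> : dirichlet p d' = G p - dirichlet p q.
    by rewrite grad4_dirichlet /dirichlet {1}/d' grid_subE Lap4_linE inner_linr; ring.
  have := Gge0 _ (Vper_lin 1 (- 1) pp pq); rewrite grad4_lin//; lra.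
have ei : 0 < eps^-1 by rewrite invr_gt0.
have F5 : eps^-1 * ((norm4 p - norm4 q) / 4 - (norm2 p - norm2 q - norm2 d') / 2 - (norm2 d + norm2 d') / 2)
   + eps * ((G p - G q) / 2) + A * eps ^- 2 * dt * G d' <= ip (mu p q r) d'.
  rewrite E4; apply: lerD => //; apply: lerD; (apply: ler_wpM2l; first exact: ltW) => //.
  by rewrite E6; lra.
have F6 : (5 / 4 * G psi' - 1 / 4 * G psi) / dt <= - ip (mu p q r) d'.
  have -> : - ip (mu p q r) d' = (3 / 2 * G psi' - 1 / 2 * dirichlet psi psi') / dt.
    by rewrite E1; field; rewrite gt_eqF.
  by apply: ler_wpM2r; [rewrite invr_ge0 ltW|lra].
have F7 : (2 * eps)^-1 * norm2 d' <= dt^-1 * G psi' + A * eps ^- 2 * dt * G d'.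
  have : dt^-1 * (dt / (2 * eps) * norm2 d') <= dt^-1 * (G psi' + dt ^+ 2 / (16 * eps ^+ 2) * G d').
    by apply: ler_wpM2l => //; rewrite invr_ge0 ltW.
  have -> : dt^-1 * (dt / (2 * eps) * norm2 d') = (2 * eps)^-1 * norm2 d' by field; rewrite !gt_eqF.
  move=> H; apply: (le_trans H); rewrite mulrDr lerD2l.
  have -> : dt^-1 * (dt ^+ 2 / (16 * eps ^+ 2) * G d') = 1 / 16 * (eps ^- 2 * dt * G d').
    by field; rewrite !gt_eqF.
  rewrite -!(mulrA A); apply: ler_wpM2r => //.
  by apply: mulr_ge0; [apply: mulr_ge0; rewrite ?invr_ge0 ?exprn_ge0// ltW|exact: Gge0].
rewrite /mod_energy -/d -/d' /energy.
have iE : (2 * eps)^-1 = eps^-1 / 2 by rewrite invfM mulrC.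
have jE : (4 * dt)^-1 = dt^-1 / 4 by rewrite invfM mulrC.
move: F5 F6 F7; rewrite iE jE.
set x := A * eps ^- 2 * dt * G d'; set y := ip (mu p q r) d'; lra.
Qed.

End EnergyStep.

(** * Damped recursion in the second order norm *)
Section H2Step.
Variable R : realType.
Variables (L : R) (K : nat).
Hypothesis L0 : 0 < L.
Local Notation N := (gridN K).
Local Notation h := (gridh L K).
Local Notation norm2 := (norm2_sq h N).
Local Notation ip := (inner h N).
Local Notation Lap := (Lap4 h).
Local Notation hnorm2 := (hnorm2 L K).
Implicit Types (f g p q r : grid R).
Variables (A eps dt : R).
Hypotheses (A0 : 0 <= A) (eps0 : 0 < eps) (eps1 : eps < 1) (dt0 : 0 < dt).
Hypotheses (Adt : A * dt ^+ 2 <= eps ^+ 2 / 8) (dte : dt * eps <= 2).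

Local Notation mu := (mu_step h eps dt A).

(** The first two terms are the G-norm of BDF2 and the third one comes from the
stabilising term.  The last one keeps part of the dissipation at two levels, to pay
for the terms of the scheme that are explicit. *)
Definition H2_functional p q : R := 1 / 4 * norm2 (Lap p) +
  1 / 4 * norm2 (fun i j k => 2 * Lap p i j k + (- 1) * Lap q i j k) +
  A * eps ^- 2 * dt ^+ 2 / 2 * norm2 (Lap (Lap p)) +
  dt * eps * (1 / 4 * norm2 (Lap (Lap p)) + 1 / 8 * norm2 (Lap (Lap q))).

(** [eps^4 / 192] is the parameter of both interpolations, the one of the cubic term
and the one of the explicit linear terms: with it they use up fixed fractions
of the dissipation [eps ||Lap^2||^2]. *)
Definition H2_source (m : R) : R :=
  m + 3 * eps ^- 3 * (cubeC L * m ^+ 13 / (eps ^+ 4 / 192) ^+ 5) +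
  15 * eps ^- 3 * m / (4 * (eps ^+ 4 / 192)).

Lemma young_inner (a b : R) f g : 2 * a * b * ip f g <= a ^+ 2 * norm2 f + b ^+ 2 * norm2 g.
Proof.
have H0 : 0 <= norm2 (fun i j k => a * f i j k + (- b) * g i j k) by exact: norm2_ge0.
by move: H0; rewrite norm2_lin//; lra.
Qed.

Lemma young_eps (c : R) f g : eps^-1 * (c * ip f g) <= 3 * eps ^- 3 * c ^+ 2 * norm2 f + eps / 12 * norm2 g.
Proof.
have H := young_inner (6 * eps^-1 * c) eps f g.
have e12 : 0 < eps^-1 / 12 by rewrite divr_gt0// invr_gt0.
rewrite -(ler_pM2l e12) in H; apply: le_trans (le_trans _ H) _.
  by apply: eq_ler; field; rewrite gt_eqF.
by apply: eq_ler; field; rewrite gt_eqF.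
Qed.

(** The difference of the two sides is a quarter of [||f - 2 g + u||^2]. *)
Lemma bdf_identity f g u : ip f f * (3 / 2) - 2 * ip g f + 1 / 2 * ip u f >=
  1 / 4 * (norm2 f - norm2 g + norm2 (fun i j k => 2 * f i j k + (- 1) * g i j k)
    - norm2 (fun i j k => 2 * g i j k + (- 1) * u i j k)).
Proof.
have H0 : 0 <= norm2 (fun i j k => 1 * f i j k + (- 1) * (fun i j k => 2 * g i j k + (- 1) * u i j k) i j k).
  exact: norm2_ge0.
move: H0; rewrite !norm2_lin// inner_linr (innerC L K f g) (innerC L K f u) /norm2_sq; lra.
Qed.

Lemma Lap_mu p q r i j k : Lap (mu p q r) i j k =
  eps^-1 * (Lap (fun i j k => p i j k ^+ 3) i j k - 2 * Lap q i j k + Lap r i j k)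
  - eps * Lap (Lap p) i j k - A * eps ^- 2 * dt * (Lap (Lap p) i j k - Lap (Lap q) i j k).
Proof.
by rewrite muE Lap4_lin Lap4_lin Lap4_lin Lap4_lin grid_subE Lap4_linE Lap4_lin; ring.
Qed.

Lemma norm2_2sub_le f g :
  norm2 (fun i j k => 2 * f i j k + (- 1) * g i j k) <= 8 * norm2 f + 2 * norm2 g.
Proof. by rewrite norm2_lin//; have := young_inner 2 (- 1) f g; lra. Qed.

(** The scheme is tested with [Lap (Lap p)].  The terms of [Lap mu] other than the
surface diffusion and the stabilising one are of lower order in [p], [q], [r], or subcritical,
and cost a fraction of the dissipation.  What remains of it dominates the
functional up to a constant, which gives the damping factor. *)
Lemma H2_step p q r m : Vper N p -> Vper N q -> Vper N r -> bdf_step L K A eps dt p q r ->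
  hnorm2 1 p <= m -> norm2 p <= m -> norm2 q <= m -> norm2 r <= m ->
  H2_functional p q * (1 + dt * eps / 16) <= H2_functional q r + dt * H2_source m.
Proof.
move=> pp pq pr bs m1 mp mq mr.
have ei : 0 < eps^-1 by rewrite invr_gt0.
have nge f : 0 <= norm2 f by exact: norm2_ge0.
pose c := Lap (fun i j k => p i j k ^+ 3).
pose u' := Lap p; pose u := Lap q; pose um := Lap r.
pose v' := Lap u'; pose v := Lap u; pose vm := Lap um.
have pu' : Vper N u' by exact: Vper_Lap4.
have pv' : Vper N v' by exact: Vper_Lap4.
have T1 : ip u' u' * (3 / 2) - 2 * ip u u' + 1 / 2 * ip um u' = dt * ip (Lap (mu p q r)) v'.
  have -> : ip (Lap (mu p q r)) v' = dt^-1 * (3 / 2 * ip p v' - 2 * ip q v' + 1 / 2 * ip r v').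
    rewrite (@eq_inner _ _ _ _ _ (fun i j k => dt^-1 * (fun i j k =>
      3 / 2 * p i j k + 1 * (fun i j k => (- 2) * q i j k + 1 / 2 * r i j k) i j k) i j k + 0 * p i j k) v').
      by rewrite !inner_linl//; ring.
    by move=> i j k; rewrite -bs; ring.
  have E f : Vper N f -> ip f v' = ip (Lap f) u' by move=> pf; rewrite /v' inner_Lap4.
  by rewrite !E// -/u' -/u -/um; field; rewrite gt_eqF.
have T2 : ip (Lap (mu p q r)) v' = eps^-1 * (1 * ip c v') + eps^-1 * (- 2 * ip u v') + eps^-1 * (1 * ip um v')
    - eps * norm2 v' - A * eps ^- 2 * dt * (norm2 v' - ip v v').
  rewrite (@eq_inner _ _ _ _ _ (fun i j k => eps^-1 * (fun i j k =>
      1 * c i j k + 1 * (fun i j k => (- 2) * u i j k + 1 * um i j k) i j k) i j k +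
      1 * (fun i j k => (- eps) * v' i j k + (- (A * eps ^- 2 * dt)) *
        (fun i j k => 1 * v' i j k + (- 1) * v i j k) i j k) i j k) v').
    by rewrite !inner_linl// /norm2_sq; ring.
  by move=> i j k; rewrite Lap_mu -/u -/um -/u' -/v -/v' -/c; ring.
(* each of the three terms may use [eps / 12] of the dissipation *)
have Y1 := young_eps 1 c v'; have Y2 := young_eps (- 2) u v'; have Y3 := young_eps 1 um v'.
have Y4 : ip v v' <= (norm2 v + norm2 v') / 2 by have := young_inner 1 1 v v'; lra.
pose eta := eps ^+ 4 / 192.
have eta0 : 0 < eta by rewrite divr_gt0// exprn_gt0.
have C1 : norm2 c <= eta * (8 * (m + norm2 v')) + cubeC L * m ^+ 13 / eta ^+ 5.
  apply: le_trans (cube_eta L0 eta0 pp m1) _; rewrite lerD2r; apply: ler_wpM2l; first exact: ltW.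
  by apply: le_trans (hnorm2_4_le L0 pp) _; rewrite -/u' -/v'; lra.
have I1 w f : 0 < w -> Vper N f -> norm2 f <= m -> norm2 (Lap f) <= w * norm2 (Lap (Lap f)) + (4 * w)^-1 * m.
  move=> w0 pf fm; apply: le_trans (norm2_Lap4_interp L0 w0 pf) _; rewrite lerD2l.
  by apply: ler_wpM2l => //; rewrite invr_ge0 mulr_ge0// ltW.
have I2 := I1 _ _ eta0 pq mq; have I3 := I1 _ _ eta0 pr mr.
have I4 := I1 1 _ ltac:(by []) pq mq; have I5 := I1 1 _ ltac:(by []) pp mp.
rewrite -/u -/um -/u' -/v -/vm -/v' in I2 I3 I4 I5.
have e3 : 0 <= 3 * eps ^- 3 by rewrite mulr_ge0// invr_ge0 exprn_ge0// ltW.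
have C1' : 3 * eps ^- 3 * norm2 c <= eps / 8 * (m + norm2 v') + 3 * eps ^- 3 * (cubeC L * m ^+ 13 / eta ^+ 5).
  apply: le_trans (ler_wpM2l e3 C1) _; rewrite mulrDr lerD2r; apply: eq_ler.
  by rewrite /eta; field; rewrite gt_eqF.
have I2' : 12 * eps ^- 3 * norm2 u <= eps / 16 * norm2 v + 12 * eps ^- 3 * m / (4 * eta).
  have e12 : 0 <= 12 * eps ^- 3 by lra.
  apply: le_trans (ler_wpM2l e12 I2) _; apply: eq_ler.
  by rewrite /eta; field; rewrite gt_eqF.
have I3' : 3 * eps ^- 3 * norm2 um <= eps / 64 * norm2 vm + 3 * eps ^- 3 * m / (4 * eta).
  apply: le_trans (ler_wpM2l e3 I3) _; apply: eq_ler.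
  by rewrite /eta; field; rewrite gt_eqF.
have m0 : 0 <= m by exact: le_trans mp.
have em : eps * m <= m by rewrite ler_piMl// ltW.
pose Q0 := eps / 8 * m + 3 * eps ^- 3 * (cubeC L * m ^+ 13 / eta ^+ 5) + 15 * eps ^- 3 * m / (4 * eta).
have QE : Q0 + eps * m / 16 <= H2_source m by rewrite /Q0 /H2_source -/eta; lra.
have V1 : ip (Lap (mu p q r)) v' <= eps * (- (5 / 8) * norm2 v' + 1 / 16 * norm2 v + 1 / 16 * norm2 vm) + Q0
    - A * eps ^- 2 * dt * ((norm2 v' - norm2 v) / 2).
  have a0 : 0 <= A * eps ^- 2 * dt.
    by apply: mulr_ge0; [apply: mulr_ge0 => //; rewrite invr_ge0 exprn_ge0// ltW|exact: ltW].
  have Y4' : A * eps ^- 2 * dt * ((norm2 v' - norm2 v) / 2) <= A * eps ^- 2 * dt * (norm2 v' - ip v v').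
    by apply: ler_wpM2l => //; lra.
  have ev : 0 <= eps * norm2 vm by rewrite mulr_ge0// ltW.
  rewrite T2 /Q0; move: Y1 Y2 Y3 Y4' C1' I2' I3'.
  have -> : 15 * eps ^- 3 * m / (4 * eta) = 12 * eps ^- 3 * m / (4 * eta) + 3 * eps ^- 3 * m / (4 * eta) by ring.
  rewrite expr1n sqrrN; lra.
have D := bdf_identity u' u um; rewrite T1 in D.
pose GA := A * eps ^- 2 * dt ^+ 2 / 2.
have GA1 : GA <= 1 / 16.
  rewrite /GA; have -> : A * eps ^- 2 * dt ^+ 2 / 2 = (A * dt ^+ 2) * (eps ^- 2 / 2) by ring.
  have -> : 1 / 16 = (eps ^+ 2 / 8) * (eps ^- 2 / 2) by field; rewrite gt_eqF.
  by apply: ler_wpM2r => //; rewrite divr_ge0// invr_ge0 exprn_ge0// ltW.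
have D1 := ler_wpM2l (ltW dt0) V1.
have step : H2_functional p q <= H2_functional q r + dt * eps * (- (3 / 8) * norm2 v' - 1 / 16 * norm2 v) + dt * Q0.
  rewrite /H2_functional -/u' -/u -/um -/v' -/v -/vm -/GA.
  have EGA : dt * (A * eps ^- 2 * dt * ((norm2 v' - norm2 v) / 2)) = GA * norm2 v' - GA * norm2 v.
    by rewrite /GA; ring.
  have pm : 0 <= dt * eps * norm2 vm by rewrite mulr_ge0// ltW// mulr_gt0.
  rewrite mulrBr EGA in D1.
  move: D D1 pm; set X := norm2 (fun i j k => _); set Y := norm2 (fun i j k => _); lra.
have GU : H2_functional p q <= 6 * norm2 v' + norm2 v + m.
  rewrite /H2_functional -/u' -/u -/um -/v' -/v -/vm -/GA.
  have := norm2_2sub_le u' u.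
  have : GA * norm2 v' <= 1 / 16 * norm2 v' by exact: ler_wpM2r.
  have : dt * eps * (1 / 4 * norm2 v' + 1 / 8 * norm2 v) <= 2 * (1 / 4 * norm2 v' + 1 / 8 * norm2 v).
    apply: ler_wpM2r => //; have := nge v'; have := nge v; lra.
  move: I4 I5; rewrite mulr1 !mul1r; have := nge v'; have := nge v; lra.
have de : 0 <= dt * eps / 16 by rewrite divr_ge0// mulr_ge0// ltW.
have GU' := ler_wpM2l de GU.
have QE' := ler_wpM2l (ltW dt0) QE.
by move: step GU' QE'; lra.
Qed.

(** The barrier [S] does not increase under the recursion, whence a bound that does
not depend on the number of steps. *)
Lemma damped_bound (g : nat -> R) (Q S : R) :
  g 0%N <= S -> 16 * eps^-1 * Q <= S ->
  (forall n, g n.+1 * (1 + dt * eps / 16) <= g n + dt * Q) -> forall n, g n <= S.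
Proof.
move=> g0 QS gS; elim=> [//|n IHn].
have pos : 0 < 1 + dt * eps / 16 by rewrite addr_gt0// divr_gt0// mulr_gt0.
rewrite -(ler_pM2r pos); apply: le_trans (gS n) _.
have : dt * Q <= dt * eps / 16 * S.
  have -> : dt * Q = dt * eps / 16 * (16 * eps^-1 * Q) by field; rewrite gt_eqF.
  by apply: ler_wpM2l => //; rewrite divr_ge0// mulr_ge0// ltW.
lra.
Qed.

End H2Step.

(** * From discrete norms to Sobolev norms of the extension *)
Section SobolevExtension.
Variable R : realType.

(** For [t = 2 u] the mean value theorem gives [sin t = 2 u cos u cos c] with
[0 < c < u], hence [sin t >= 2 u (cos u)^2], and [cos t >= 0] means that
[(cos u)^2 >= 1/2]. *)
Lemma sin_ge_half (t : R) : 0 <= t <= pi / 2 -> t / 2 <= sin t.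
Proof.
have [u ->] : exists u, t = u *+ 2 by exists (t / 2); rewrite -[RHS]mulr_natr divfK.
rewrite -(mulr_natr u) mulfK// => /andP[t0 tpi].
have [->|un0] := eqVneq u 0; first by rewrite mul0r sin0.
have u0 : 0 < u by rewrite lt_neqAle eq_sym un0; lra.
have pi0 := pi_gt0 R.
have [c cu E] : exists2 c, c \in `]0, u[ & sin u - sin 0 = cos c * (u - 0).
  apply: (@MVT R sin cos 0 u) => //.
  by apply: continuous_subspaceT; exact: continuous_sin.
move: cu; rewrite in_itv /= => /andP[c0 cu].
rewrite sin0 !subr0 in E.
have cc : cos u <= cos c.
  by rewrite ltW// ltr_cos ?in_itv/=//; apply/andP; split; lra.
have cu0 : 0 <= cos u by apply: cos_ge0_pihalf; apply/andP; split; lra.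
have c2 : 0 <= cos (u * 2) by apply: cos_ge0_pihalf; apply/andP; split; lra.
rewrite mulr_natr in c2 *; rewrite sin_mulr2n E -(mulr_natr (cos u * _)).
rewrite cos_mulr2n -(mulr_natr (cos u ^+ 2)) in c2.
have H : cos u ^+ 2 <= cos u * cos c by rewrite expr2 ler_wpM2l.
have : u <= 2 * (u * (cos u * cos c)) by rewrite mulrCA ler_peMr ?(ltW u0)//; lra.
lra.
Qed.

Variables (L : R) (K : nat).
Hypothesis L0 : 0 < L.
Local Notation N := (gridN K).
Local Notation h := (gridh L K).

Lemma modes_le l : l \in modes K -> (`|l| <= K)%N.
Proof. by move=> /mapP[j]; rewrite mem_iota /gridN => jK ->; lia. Qed.

(** Jordan's inequality applies to half of the angle [wavenum L l * h], because
[|l| <= K < N / 2] keeps its absolute value below [pi / 2]. *)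
Lemma wavenum_le_symb2 (l : int) : (`|l| <= K)%N ->
  wavenum L l ^+ 2 <= 4 * ((2 - 2 * cos (wavenum L l * h)) / h ^+ 2).
Proof.
move=> lK; have h0 : 0 < h by exact: gridh_gt0.
have N0 := gridN_gt0 R K; have pi0 := pi_gt0 R.
rewrite half_cosE; set th := wavenum L l * h.
have -> : wavenum L l = th / h by rewrite /th mulfK// gt_eqF.
have t1 : `|th / 2| <= pi / 2.
  rewrite /th wavenum_gridh//.
  have -> : 2 * pi * l%:~R / N%:R / 2 = (pi / 2) * (2 * l%:~R / N%:R) :> R by field; rewrite gt_eqF.
  rewrite normrM gtr0_norm ?divr_gt0// ler_piMr ?divr_ge0 ?(ltW pi0)//.
  rewrite normrM (gtr0_norm (x := _^-1)) ?invr_gt0// ler_pdivrMr// mul1r normrM ger0_norm//.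
  rewrite -intr_norm -abszE -pmulrn -natrM ler_nat /gridN; lia.
have := @sin_ge_half `|th / 2|; rewrite normr_ge0 t1 => /(_ isT) s1.
have s2 : (`|th / 2| / 2) ^+ 2 <= sin (th / 2) ^+ 2.
  have -> : sin (th / 2) ^+ 2 = sin `|th / 2| ^+ 2.
    by case: (ger0P (th / 2)) => _ //; rewrite sinN sqrrN.
  apply: lerXn2r => //; rewrite nnegrE ?divr_ge0//; apply: le_trans s1.
  by rewrite divr_ge0.
rewrite exprMn real_normK ?num_real// in s2.
rewrite exprMn exprVn mulrA; apply: ler_wpM2r; first by rewrite invr_ge0 exprn_ge0// ltW.
move: s2; rewrite exprMn exprVn; lra.
Qed.

Lemma freq_ex k : freq R K k ex = wavenum L k.1.1 * h.
Proof. by rewrite wavenum_gridh// /freq /= mulr1 !mulr0 !addr0. Qed.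
Lemma freq_ey k : freq R K k ey = wavenum L k.1.2 * h.
Proof. by rewrite wavenum_gridh// /freq /= mulr1 !mulr0 add0r addr0. Qed.
Lemma freq_ez k : freq R K k ez = wavenum L k.2 * h.
Proof. by rewrite wavenum_gridh// /freq /= mulr1 !mulr0 !add0r. Qed.

Lemma wavenum_le_symbLap k : k \in modes3 K ->
  [/\ wavenum L k.1.1 ^+ 2 <= 4 * (1 + symbLap L K k), wavenum L k.1.2 ^+ 2 <= 4 * (1 + symbLap L K k) &
      wavenum L k.2 ^+ 2 <= 4 * (1 + symbLap L K k)].
Proof.
move=> /mem_triples[/modes_le l1 /modes_le l2 /modes_le l3].
have T e : e \in [:: ex; ey; ez] -> 4 * symb2 L K e k <= 4 * (1 + symbLap L K k).
  move=> eE; have SL : symb2 L K e k <= symbLap L K k by exact: symb2_le_symbLap.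
  lra.
split.
- by apply: le_trans (wavenum_le_symb2 l1) _; rewrite -freq_ex; apply: T; rewrite !inE eqxx.
- by apply: le_trans (wavenum_le_symb2 l2) _; rewrite -freq_ey; apply: T; rewrite !inE eqxx orbT.
- by apply: le_trans (wavenum_le_symb2 l3) _; rewrite -freq_ez; apply: T; rewrite !inE eqxx !orbT.
Qed.

(** The weights of the derivatives are bounded by powers of [4 (1 + symbLap)]. *)
Lemma partial_extension_le (f : grid R) a b d : (a + b + d <= 2)%N ->
  integral_Omega L (fun x y z => partial a b d (extension L K f) x y z ^+ 2) <= 16 * hnorm2 L K 2 f.
Proof.
move=> abd; rewrite /extension partial_trig_poly.
apply: le_trans (integral_trig_poly_sqr _ _ L0) _.
rewrite /hnorm2 -wnorm2Z /wnorm2; apply: ler_wpM2l; first by rewrite exprn_ge0// ltW.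
rewrite [leLHS]big_seq [leRHS]big_seq; apply: ler_sum => k kK.
rewrite /coef3 -/(hat K L f k); move: (hat K L f k) => F.
rewrite !sqnormcM !sqnormc_iwavenumX [leLHS]mulrC; apply: ler_wpM2r; first exact: sqnormc_ge0.
have [k1 k2 k3] := wavenum_le_symbLap kK.
set X := 4 * (1 + symbLap L K k); have X1 : 1 <= X.
  by have := symbLap_ge0 L K k; rewrite /X; lra.
have X0 : 0 <= X by lra.
have P (u : R) j : u ^+ 2 <= X -> u ^+ (2 * j) <= X ^+ j.
  by move=> uX; rewrite exprM; apply: lerXn2r; rewrite ?nnegrE ?sqr_ge0.
have -> : 16 * (1 + symbLap L K k) ^+ 2 = X ^+ 2 by rewrite /X; ring.
apply: le_trans (_ : X ^+ (d + b + a) <= _); last by rewrite ler_weXn2l//; lia.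
have E0 (u : R) j : 0 <= u ^+ (2 * j) by rewrite exprM exprn_ge0// sqr_ge0.
rewrite (exprD X (d + b) a) (exprD X d b); apply: ler_pM; [by apply: mulr_ge0; exact: E0|exact: E0| |exact: P].
by apply: ler_pM; [exact: E0|exact: E0|exact: P|exact: P].
Qed.

(** [432 = 27 * 16], at most 27 derivatives being involved. *)
Lemma sobolev_extension (f : grid R) :
  sobolev_norm L 2 (extension L K f) ^+ 2 <= 432 * hnorm2 L K 2 f.
Proof.
have n0 : 0 <= hnorm2 L K 2 f by exact: hnorm2_ge0.
rewrite /sobolev_norm sqr_sqrtr; last first.
  by do 3 (apply: sumr_ge0 => ? _); apply: integral_Omega_ge0 => x y z; exact: sqr_ge0.
have -> : 432 * hnorm2 L K 2 f = \sum_(a < 3) \sum_(b < 3) \sum_(d < 3) (16 * hnorm2 L K 2 f).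
  by rewrite !sumr_const !card_ord; ring.
apply: ler_sum => a _; apply: ler_sum => b _.
rewrite big_mkcond; apply: ler_sum => d _; case: ifP => abd; first exact: partial_extension_le.
by rewrite mulr_ge0.
Qed.

End SobolevExtension.

(** * Uniform bounds on iterated differences *)
Section DifferenceBounds.
Variable R : realType.
Variables (L : R) (K : nat).
Hypothesis L0 : 0 < L.
Local Notation N := (gridN K).
Local Notation h := (gridh L K).
Local Notation fdiff := (fdiff L K).
Local Notation fdiff2 := (fdiff2 L K).
Local Notation fdiff4 := (fdiff4 L K).
Implicit Types (f g : grid R) (e : int * int * int).

(** Discrete C^r bounds serve for the initial data, since, contrary to the
quadratic norms, they are stable under products. *)
Fixpoint diff_bounded (r : nat) f (M : R) : Prop :=
  (forall i j k, `|f i j k| <= M) /\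
  if r is r'.+1 then forall e, e \in [:: ex; ey; ez] -> diff_bounded r' (fdiff e f) M else True.

Lemma diff_bounded_abs r f M : diff_bounded r f M -> forall i j k, `|f i j k| <= M.
Proof. by case: r => [|r] []. Qed.

Lemma diff_bounded_ge0 r f M : diff_bounded r f M -> 0 <= M.
Proof. by move=> /diff_bounded_abs/(_ 0 0 0); apply: le_trans. Qed.

Lemma diff_bounded_le r r' f M M' : (r' <= r)%N -> M <= M' -> diff_bounded r f M -> diff_bounded r' f M'.
Proof.
elim: r r' f => [|r IHr] [|r'] f //= rr MM [fM H]; split => //.
- by move=> i j k; exact: le_trans (fM i j k) MM.
- by move=> i j k; exact: le_trans (fM i j k) MM.
- by move=> i j k; exact: le_trans (fM i j k) MM.
- by move=> e eE; apply: IHr => //; exact: H.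
Qed.

Lemma fdiff_translate e e' f : fdiff e (translate e' f) = translate e' (fdiff e f).
Proof.
apply: funext3 => i j k; rewrite /fdiff /translate; congr ((f _ _ _ - _) / _); lia.
Qed.

Lemma diff_bounded_translate r e f M : diff_bounded r f M -> diff_bounded r (translate e f) M.
Proof.
elim: r f => [|r IHr] f /= [fM H]; split => //; try by move=> i j k; exact: fM.
by move=> e' eE; rewrite fdiff_translate; apply: IHr; exact: H.
Qed.

Lemma fdiff_lin (a b : R) e f g : fdiff e (fun i j k => a * f i j k + b * g i j k) =
  fun i j k => a * fdiff e f i j k + b * fdiff e g i j k.
Proof. by apply: funext3 => i j k; rewrite /fdiff /translate; ring. Qed.

Lemma diff_bounded_lin r (a b : R) f g M M' : diff_bounded r f M -> diff_bounded r g M' ->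
  diff_bounded r (fun i j k => a * f i j k + b * g i j k) (`|a| * M + `|b| * M').
Proof.
elim: r f g => [|r IHr] f g /= [fM Hf] [gM Hg]; (split => //; last first);
  try (by move=> i j k; apply: le_trans (ler_normD _ _) _; rewrite !normrM; apply: lerD; apply: ler_wpM2l).
by move=> e eE; rewrite fdiff_lin; apply: IHr; [exact: Hf|exact: Hg].
Qed.

Lemma fdiff_mul e f g : fdiff e (fun i j k => f i j k * g i j k) =
  fun i j k => 1 * (fdiff e f i j k * translate e g i j k) + 1 * (f i j k * fdiff e g i j k).
Proof. by apply: funext3 => i j k; rewrite /fdiff /translate; ring. Qed.

Lemma diff_bounded_mul r f g M M' : diff_bounded r f M -> diff_bounded r g M' ->
  diff_bounded r (fun i j k => f i j k * g i j k) (2 ^+ r * M * M').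
Proof.
elim: r f g => [|r IHr] f g bf bg.
  split => // i j k; rewrite normrM expr0 mul1r.
  by apply: ler_pM => //; [exact: (diff_bounded_abs bf)|exact: (diff_bounded_abs bg)].
have M0 := diff_bounded_ge0 bf; have M0' := diff_bounded_ge0 bg.
split.
  move=> i j k; rewrite normrM -mulrA.
  apply: le_trans (_ : M * M' <= _); first by apply: ler_pM => //; [exact: (diff_bounded_abs bf)|exact: (diff_bounded_abs bg)].
  by rewrite ler_peMl ?mulr_ge0// exprn_ege1// ler1n.
move=> e eE; rewrite fdiff_mul.
have b1 : diff_bounded r (fdiff e f) M by case: bf => _; apply.
have b2 : diff_bounded r (fdiff e g) M' by case: bg => _; apply.
have b3 : diff_bounded r f M by apply: diff_bounded_le bf.
have b4 : diff_bounded r (translate e g) M' by apply: diff_bounded_translate; apply: diff_bounded_le bg.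
have := diff_bounded_lin 1 1 (IHr _ _ b1 b4) (IHr _ _ b3 b2).
by rewrite normr1 !mul1r exprS; apply: diff_bounded_le => //; apply: eq_ler; ring.
Qed.

Lemma fdiff2E e f : fdiff2 e f = translate (opp3 e) (fdiff e (fdiff e f)).
Proof.
have h0 : h != 0 by rewrite gt_eqF// gridh_gt0.
apply: funext3 => i j k; rewrite /fdiff2 /fdiff /translate /= !subrK.
by field.
Qed.

Lemma diff_bounded_fdiff2 r e f M : e \in [:: ex; ey; ez] -> diff_bounded r.+2 f M -> diff_bounded r (fdiff2 e f) M.
Proof.
by move=> eE [_ /(_ _ eE)[_ /(_ _ eE) H]]; rewrite fdiff2E; exact: diff_bounded_translate.
Qed.

(** The factor [h^2] removes the loss of two differences, so that the correction term
of the long stencil costs no more differences than the short stencil. *)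
Lemma diff_bounded_h2fdiff2 r e f M : diff_bounded r f M -> diff_bounded r (fun i j k => h ^+ 2 * fdiff2 e f i j k) (4 * M).
Proof.
move=> bf; have h0 : h != 0 by rewrite gt_eqF// gridh_gt0.
have -> : (fun i j k => h ^+ 2 * fdiff2 e f i j k) = fun i j k =>
   1 * (fun i j k => 1 * translate e f i j k + 1 * translate (opp3 e) f i j k) i j k + (- 2) * f i j k.
  by apply: funext3 => i j k; rewrite /fdiff2; field.
have := diff_bounded_lin 1 (- 2) (diff_bounded_lin 1 1 (diff_bounded_translate e bf) (diff_bounded_translate (opp3 e) bf)) bf.
apply: diff_bounded_le => //; rewrite normr1 normrN normr_nat; lra.
Qed.

Lemma diff_bounded_fdiff4 r e f M : e \in [:: ex; ey; ez] -> diff_bounded r.+2 f M -> diff_bounded r (fdiff4 e f) (4 / 3 * M).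
Proof.
move=> eE bf; rewrite /fdiff4; apply: diff_bounded_fdiff2 => //.
have -> : (fun i j k => f i j k - h ^+ 2 / 12 * fdiff2 e f i j k) =
   fun i j k => 1 * f i j k + (- (12^-1)) * (fun i j k => h ^+ 2 * fdiff2 e f i j k) i j k.
  by apply: funext3 => i j k; field.
have := diff_bounded_lin 1 (- (12^-1)) bf (diff_bounded_h2fdiff2 e bf).
by apply: diff_bounded_le => //; rewrite normr1 normrN ger0_norm ?invr_ge0//; lra.
Qed.

Lemma diff_bounded_Lap4 r f M : diff_bounded r.+2 f M -> diff_bounded r (Lap4 h f) (4 * M).
Proof.
move=> bf; rewrite Lap4E.
have -> : (fun i j k => fdiff4 ex f i j k + fdiff4 ey f i j k + fdiff4 ez f i j k) =
  fun i j k => 1 * (fun i j k => 1 * fdiff4 ex f i j k + 1 * fdiff4 ey f i j k) i j k + 1 * fdiff4 ez f i j k.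
  by apply: funext3 => i j k; ring.
have bx : diff_bounded r (fdiff4 ex f) (4 / 3 * M) by apply: diff_bounded_fdiff4 => //; rewrite !inE eqxx.
have by_ : diff_bounded r (fdiff4 ey f) (4 / 3 * M) by apply: diff_bounded_fdiff4 => //; rewrite !inE eqxx orbT.
have bz : diff_bounded r (fdiff4 ez f) (4 / 3 * M) by apply: diff_bounded_fdiff4 => //; rewrite !inE eqxx !orbT.
have := diff_bounded_lin 1 1 (diff_bounded_lin 1 1 bx by_) bz.
by apply: diff_bounded_le => //; rewrite normr1; lra.
Qed.

Lemma norm2_sup f M : (forall i j k, `|f i j k| <= M) -> norm2_sq h N f <= L ^+ 3 * M ^+ 2.
Proof.
move=> fM; have h0 : 0 < h by exact: gridh_gt0.
have M0 : 0 <= M by apply: le_trans (fM 0 0 0).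
rewrite norm2E.
apply: le_trans (_ : h ^+ 3 * grid_sum K (fun _ _ _ => M ^+ 2) <= _).
  apply: ler_wpM2l; first by rewrite exprn_ge0// ltW.
  apply: le_grid_sum => i j k; rewrite -real_normK ?num_real//.
  by apply: lerXn2r; rewrite ?nnegrE.
by rewrite grid_sum_cst.
Qed.

End DifferenceBounds.

(** * Truncated Fourier series on the grid *)
Section TrigGrid.
Variable R : realType.
Variables (L : R) (K : nat).
Hypothesis L0 : 0 < L.
Local Notation N := (gridN K).
Local Notation h := (gridh L K).
Implicit Types (z w : R[i]) (c : int * int * int -> R[i]) (e : int * int * int).

Lemma normc_sqrt (z : R[i]) : normc z = Num.sqrt (sqnormc z).
Proof. by case: z. Qed.

Lemma normc_ge0 z : 0 <= normc z. Proof. by rewrite normc_sqrt sqrtr_ge0. Qed.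

Lemma normc_cis (t : R) : normc (cis t) = 1.
Proof. by rewrite normc_sqrt sqnormc_cis sqrtr1. Qed.

Lemma Re_le_normc z : `|complex.Re z| <= normc z.
Proof. by rewrite -sqrtr_sqr normc_sqrt ler_wsqrtr// /sqnormc lerDl sqr_ge0. Qed.

Definition trig_grid c : grid R := fun i j k =>
  complex.Re (\sum_(q <- modes3 K) c q * cis (node_phase K L q (i, j, k))).

Lemma trig_grid_le c i j k : `|trig_grid c i j k| <= \sum_(q <- modes3 K) normc (c q).
Proof.
rewrite /trig_grid Re_sum; apply: le_trans (ler_norm_sum _ _ _) _; apply: ler_sum => q _.
by apply: le_trans (Re_le_normc _) _; rewrite normcM normc_cis mulr1.
Qed.

(** Multiplier of [fdiff e]. *)
Definition diff_mult e (q : int * int * int) : R[i] := (h^-1)%:C * (cis (freq R K q e) - 1).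

Lemma Re_real (a : R) (z : R[i]) : complex.Re (a%:C * z) = a * complex.Re z.
Proof. by case: z => x y /=; ring. Qed.

Lemma fdiff_trig_grid e c : fdiff L K e (trig_grid c) = trig_grid (fun q => c q * diff_mult e q).
Proof.
apply: funext3 => i j k; rewrite /fdiff /translate /trig_grid.
transitivity (complex.Re ((h^-1)%:C * (\sum_(q <- modes3 K) c q * cis (node_phase K L q (add3 (i, j, k) e))
   - \sum_(q <- modes3 K) c q * cis (node_phase K L q (i, j, k))))).
  rewrite Re_real mulrC; congr (_ * _).
  by case: (\sum_(q <- _) _) => a b; case: (\sum_(q <- _) _) => a' b'.
congr complex.Re; rewrite -sumrB mulr_sumr; apply: eq_bigr => q _.
by rewrite node_phaseD// cisD /diff_mult; ring.
Qed.

Lemma abs_sin_le (t : R) : `|sin t| <= `|t|.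
Proof.
have pos (u : R) : 0 <= u -> `|sin u| <= u.
  move=> u0; have [->|un0] := eqVneq u 0; first by rewrite sin0 normr0.
  have up : 0 < u by rewrite lt_neqAle eq_sym un0.
  have [c _ E] : exists2 c, c \in `]0, u[ & sin u - sin 0 = cos c * (u - 0).
    apply: (@MVT R sin cos 0 u) => //.
    by apply: continuous_subspaceT; exact: continuous_sin.
  by rewrite sin0 !subr0 in E; rewrite E normrM (ger0_norm u0) ler_piMl// cos_max.
by case: (ger0P t) => t0; [exact: pos|rewrite -normrN -sinN pos// oppr_ge0 ltW].
Qed.

(** A product, for its inverse to be summable over the modes one index at a
time; it dominates the multipliers of the three differences. *)
Definition mode_weight (q : int * int * int) : R :=
  (1 + wavenum L q.1.1 ^+ 2) * (1 + wavenum L q.1.2 ^+ 2) * (1 + wavenum L q.2 ^+ 2).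

Lemma symb2_le_wavenum (l : int) : (2 - 2 * cos (wavenum L l * h)) / h ^+ 2 <= wavenum L l ^+ 2.
Proof.
have h0 : 0 < h by exact: gridh_gt0.
rewrite half_cosE ler_pdivrMr ?exprn_gt0// -exprMn.
set th := wavenum L l * h.
have : sin (th / 2) ^+ 2 <= (th / 2) ^+ 2.
  rewrite -[leLHS]real_normK ?num_real// -[leRHS]real_normK ?num_real//.
  by apply: lerXn2r; rewrite ?nnegrE// abs_sin_le.
by rewrite exprMn exprVn; lra.
Qed.

Lemma mode_weight_factors q : [/\ wavenum L q.1.1 ^+ 2 <= mode_weight q, wavenum L q.1.2 ^+ 2 <= mode_weight q,
  wavenum L q.2 ^+ 2 <= mode_weight q & 1 <= mode_weight q].
Proof.
rewrite /mode_weight; have := sqr_ge0 (wavenum L q.1.1); have := sqr_ge0 (wavenum L q.1.2).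
have := sqr_ge0 (wavenum L q.2).
set a := wavenum L q.1.1 ^+ 2; set b := wavenum L q.1.2 ^+ 2; set d := wavenum L q.2 ^+ 2 => d0 b0 a0.
have ab : 0 <= a * b by exact: mulr_ge0.
have ad : 0 <= a * d by exact: mulr_ge0.
have bd : 0 <= b * d by exact: mulr_ge0.
have abd : 0 <= a * b * d by exact: mulr_ge0.
have -> : (1 + a) * (1 + b) * (1 + d) = 1 + a + b + d + a * b + a * d + b * d + a * b * d by ring.
by split; lra.
Qed.

Lemma diff_mult_le e q : e \in [:: ex; ey; ez] -> normc (diff_mult e q) <= mode_weight q.
Proof.
move=> eE; have [r1 r2 r3 r0] := mode_weight_factors q.
have D : sqnormc (diff_mult e q) = (2 - 2 * cos (freq R K q e)) / h ^+ 2.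
  by rewrite /diff_mult sqnormc_real sqnormc_cisB1 exprVn mulrC.
have rr : mode_weight q <= mode_weight q ^+ 2 by rewrite expr2 ler_peMl// (le_trans _ r0).
rewrite normc_sqrt -[mode_weight q]ger0_norm ?(le_trans _ r0)// -sqrtr_sqr ler_wsqrtr// D.
move: eE; rewrite !inE => /or3P[] /eqP ->.
- by rewrite (freq_ex K L0); apply: le_trans (symb2_le_wavenum _) _; exact: le_trans r1 rr.
- by rewrite (freq_ey K L0); apply: le_trans (symb2_le_wavenum _) _; exact: le_trans r2 rr.
- by rewrite (freq_ez K L0); apply: le_trans (symb2_le_wavenum _) _; exact: le_trans r3 rr.
Qed.

Lemma diff_bounded_trig_grid r c : diff_bounded L K r (trig_grid c) (\sum_(q <- modes3 K) normc (c q) * mode_weight q ^+ r).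
Proof.
elim: r c => [|r IHr] c.
  split => // i j k; apply: le_trans (trig_grid_le _ _ _ _) _.
  by apply: ler_sum => q _; rewrite expr0 mulr1.
split.
  move=> i j k; apply: le_trans (trig_grid_le _ _ _ _) _; apply: ler_sum => q _.
  rewrite ler_peMr ?normc_ge0// exprn_ege1//; by have [] := mode_weight_factors q.
move=> e eE; rewrite fdiff_trig_grid; apply: diff_bounded_le (IHr _) => //; apply: ler_sum => q _.
rewrite normcM exprS -mulrA; apply: ler_wpM2l; first exact: normc_ge0.
apply: ler_wpM2r; last exact: diff_mult_le.
by apply: exprn_ge0; have [_ _ _] := mode_weight_factors q; apply: le_trans.
Qed.

Lemma Vper_trig_grid c : Vper N (trig_grid c).
Proof.
have T q i j k l1 l2 l3 : cis (node_phase K L q (i + l1 * N%:Z, j + l2 * N%:Z, k + l3 * N%:Z)) =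
    cis (node_phase K L q (i, j, k)).
  by rewrite -[X in node_phase _ _ _ X]/(add3 (i, j, k) (l1 * N%:Z, l2 * N%:Z, l3 * N%:Z)) node_phaseD// freq_int// cisD2pil.
move=> i j k; split; rewrite /trig_grid; congr complex.Re; apply: eq_bigr => q _; congr (_ * _).
- by have := T q i j k 1 0 0; rewrite mul1r !mul0r !addr0.
- by have := T q i j k 0 1 0; rewrite mul1r !mul0r !addr0.
- by have := T q i j k 0 0 1; rewrite mul1r !mul0r !addr0.
Qed.

Lemma grid_truncationE (u : fun3 R) :
  grid_restriction h (fourier_truncation L K u) = trig_grid (coef3 (fourier_coef L u)).
Proof.
apply: funext3 => i j k; rewrite /grid_restriction /fourier_truncation /trig_poly /trig_grid.
congr complex.Re.
exact: (sum_modes3 K (fun l m n => fourier_coef L u l m n *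
  cis (phase L l m n (node h i) (node h j) (node h k)))).
Qed.

End TrigGrid.

Section Decay.
Variable R : realType.
Variables (L : R).
Hypothesis L0 : 0 < L.

(** [1 / (1 + n^2) <= 2 / n - 2 / (n + 1)] makes the sum telescope; the term
subtracted from 5 is what the induction needs. *)
Lemma sum_modes_inv (K : nat) : \sum_(l <- modes K) (1 + l%:~R ^+ 2)^-1 <= 5 - 4 / K.+1%:R :> R.
Proof.
elim: K => [|K IHK].
  by rewrite /modes /= big_seq1 subr0 expr0n addr0 invr1; lra.
pose w (l : int) : R := (1 + l%:~R ^+ 2)^-1.
have E : \sum_(l <- modes K.+1) w l = w (- K.+1%:Z) + \sum_(l <- modes K) w l + w K.+1%:Z.
  have T : modes K.+1 = - K.+1%:Z :: rcons (modes K) K.+1%:Z.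
    rewrite /modes; have -> : gridN K.+1 = (gridN K).+2 by rewrite /gridN; lia.
    have -> : iota 0 (gridN K).+2 = 0%N :: rcons (iota 1 (gridN K)) (gridN K).+1.
      move: (gridN K) => n; rewrite -cats1.
      have E : iota 1 n.+1 = iota 1 n ++ [:: n.+1] by rewrite -{1}(addn1 n) iotaD.
      by rewrite -[iota 0 n.+2]/(0%N :: iota 1 n.+1) E.
    rewrite map_cons map_rcons; congr (_ :: rcons _ _); [by rewrite sub0r| |by rewrite /gridN; lia].
    by rewrite -[1%N]addn0 iotaDl -map_comp; apply: eq_map => t /=; lia.
  by rewrite T big_cons big_rcons /= -addrA [X in _ + X]addrC.
rewrite -/(w _) E.
have n0 : 0 < K.+1%:R :> R by rewrite ltr0n.
have wK : w K.+1%:Z <= 2 / K.+1%:R - 2 / K.+2%:R.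
  rewrite /w -pmulrn -[K.+2%:R]natr1; set x : R := K.+1%:R.
  have x0 : 0 < x by [].
  have -> : 2 / x - 2 / (x + 1) = (x * (x + 1) / 2)^-1 by field; rewrite !gt_eqF// ltr_wpDr.
  rewrite lef_pV2 ?posrE ?divr_gt0 ?mulr_gt0 ?addr_gt0 ?exprn_gt0//.
  have := sqr_ge0 (x - 1); nra.
have wN : w (- K.+1%:Z) = w K.+1%:Z by rewrite /w rmorphN /= sqrrN.
rewrite wN; have IH : \sum_(l <- modes K) w l <= 5 - 4 / K.+1%:R by exact: IHK.
move: IH wK; set S := \sum_(l <- _) _; set p := K.+1%:R^-1; set q := K.+2%:R^-1; lra.
Qed.

Definition lattice_const : R := 1 + (L / (2 * pi)) ^+ 2.

Lemma sum_modes_wavenum (K : nat) : \sum_(l <- modes K) (1 + wavenum L l ^+ 2)^-1 <= 5 * lattice_const.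
Proof.
have pi0 := pi_gt0 R.
apply: le_trans (_ : \sum_(l <- modes K) lattice_const * (1 + l%:~R ^+ 2)^-1 <= _).
  apply: ler_sum => l _.
  have p1 : 0 < lattice_const by rewrite /lattice_const addr_gt0// exprn_gt0// divr_gt0// mulr_gt0.
  have p2 : 0 < 1 + wavenum L l ^+ 2 by have := sqr_ge0 (wavenum L l); lra.
  have p3 : 0 < 1 + l%:~R ^+ 2 :> R by have := sqr_ge0 (l%:~R : R); lra.
  rewrite -ler_pdivrMl// -invfM lef_pV2 ?posrE//; last exact: mulr_gt0.
  have -> : lattice_const * (1 + wavenum L l ^+ 2) = 1 + l%:~R ^+ 2 + (L / (2 * pi)) ^+ 2 + wavenum L l ^+ 2.
    by rewrite /lattice_const /wavenum; move: (pi : R) pi0 => p p0; field; rewrite !gt_eqF.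
  by have := sqr_ge0 (L / (2 * pi)); have := sqr_ge0 (wavenum L l); lra.
rewrite -mulr_sumr mulrC; apply: ler_wpM2r.
  by rewrite /lattice_const addr_ge0// sqr_ge0.
by apply: le_trans (sum_modes_inv K) _; rewrite gerBl divr_ge0.
Qed.

Lemma expr1D_le (x : R) n : 0 <= x -> (1 + x) ^+ n <= 2 ^+ n * (1 + x ^+ n).
Proof.
move=> x0; have [x1|x1] := leP x 1.
  apply: le_trans (_ : 2 ^+ n * 1 <= _).
    by rewrite mulr1; apply: lerXn2r; rewrite ?nnegrE; lra.
  by apply: ler_wpM2l; [rewrite exprn_ge0|rewrite lerDl exprn_ge0].
apply: le_trans (_ : 2 ^+ n * x ^+ n <= _).
  by rewrite -exprMn; apply: lerXn2r; rewrite ?nnegrE; lra.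
by apply: ler_wpM2l; [rewrite exprn_ge0|rewrite lerDr].
Qed.

Definition decay_const (r : nat) (B : R) : R :=
  Num.sqrt (8 ^+ (2 * r.+1) * (8 * (2 * ((B ^+ 2 / L ^+ 3 + 1) / 2) ^+ 2))).

(** The square of the left hand side involves the power [2 (r + 1)] of the weight,
and each of its factors is a polynomial of degree [2 (r + 1)] in the square of one
wave number: mixed derivatives of total order [6 (r + 1)] are used. *)
Lemma fourier_mode_weight (r : nat) (u : fun3 R) (B : R) q :
  class_C (6 * r.+1) u -> periodic3 L u -> sobolev_norm L (6 * r.+1) u <= B ->
  normc (coef3 (fourier_coef L u) q) * mode_weight L q ^+ r.+1 <= decay_const r B.
Proof.
move=> cu pu uB; set n := (2 * r.+1)%N.
set D := 2 * ((B ^+ 2 / L ^+ 3 + 1) / 2) ^+ 2.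
have dec a b d : (a + b + d <= 6 * r.+1)%N -> wavenum L q.1.1 ^+ (2 * a) * wavenum L q.1.2 ^+ (2 * b) *
    wavenum L q.2 ^+ (2 * d) * sqnormc (coef3 (fourier_coef L u) q) <= D.
  by move=> abd; exact: (fourier_decay _ _ _ L0 cu pu uB abd).
set s := sqnormc _ in dec *; have s0 : 0 <= s by exact: sqnormc_ge0.
set x := wavenum L q.1.1 ^+ 2; set y := wavenum L q.1.2 ^+ 2; set z := wavenum L q.2 ^+ 2.
have x0 : 0 <= x by exact: sqr_ge0.
have y0 : 0 <= y by exact: sqr_ge0.
have z0 : 0 <= z by exact: sqr_ge0.
have {}dec a b d : (a <= n)%N -> (b <= n)%N -> (d <= n)%N -> x ^+ a * y ^+ b * z ^+ d * s <= D.
  move=> an bn dn; have := dec a b d ltac:(rewrite /n in an bn dn; lia).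
  by rewrite !exprM.
have E : (1 + x ^+ n) * (1 + y ^+ n) * (1 + z ^+ n) * s <= 8 * D.
  have d0 := dec 0%N 0%N 0%N; have d1 := dec n 0%N 0%N; have d2 := dec 0%N n 0%N.
  have d3 := dec 0%N 0%N n; have d4 := dec n n 0%N; have d5 := dec n 0%N n.
  have d6 := dec 0%N n n; have d7 := dec n n n.
  move: d0 d1 d2 d3 d4 d5 d6 d7; rewrite leqnn leq0n !expr0 ?mul1r ?mulr1.
  move: (x ^+ n) (y ^+ n) (z ^+ n) => X Y Z.
  do 8 (move=> /(_ isT isT isT) ?).
  have -> : (1 + X) * (1 + Y) * (1 + Z) * s = s + X * s + Y * s + Z * s + X * Y * s + X * Z * s + Y * Z * s + X * Y * Z * s by ring.
  lra.
have rho0 : 0 <= mode_weight L q by rewrite /mode_weight !mulr_ge0// addr_ge0.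
have rn : mode_weight L q ^+ n * s <= 8 ^+ n * (8 * D).
  apply: le_trans (_ : 8 ^+ n * ((1 + x ^+ n) * (1 + y ^+ n) * (1 + z ^+ n) * s) <= _); last first.
    by apply: ler_wpM2l => //; exact: exprn_ge0.
  rewrite mulrA; apply: ler_wpM2r => //; rewrite /mode_weight -/x -/y -/z.
  have p1 := expr1D_le n x0; have p2 := expr1D_le n y0; have p3 := expr1D_le n z0.
  have -> : 8 ^+ n * ((1 + x ^+ n) * (1 + y ^+ n) * (1 + z ^+ n)) =
     (2 ^+ n * (1 + x ^+ n)) * (2 ^+ n * (1 + y ^+ n)) * (2 ^+ n * (1 + z ^+ n)).
    have -> : 8 = 2 * 2 * 2 :> R by ring.
    by rewrite !exprMn; ring.
  have q0 (w : R) : 0 <= w -> 0 <= (1 + w) ^+ n by move=> w0; rewrite exprn_ge0// addr_ge0.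
  rewrite (exprMn _ (_ * _)) (exprMn _ (1 + x)); apply: ler_pM => //; [|exact: q0|].
    by apply: mulr_ge0; exact: q0.
  by apply: ler_pM => //; exact: q0.
rewrite normc_sqrt /decay_const -/n -/D -[mode_weight L q ^+ r.+1]ger0_norm ?exprn_ge0// -sqrtr_sqr -sqrtrM//.
by rewrite ler_wsqrtr// -exprM mulnC mulrC.
Qed.

Definition truncation_const (B : R) : R := decay_const 8 B * (5 * lattice_const) ^+ 3.

(** A supplementary power of the weight makes the sum over the modes converge, so
that 8 differences ask for [6 * (8 + 1) = 54] derivatives. *)
Lemma truncation_diff_bounded (u : fun3 R) (B : R) (K : nat) :
  class_C 54 u -> periodic3 L u -> sobolev_norm L 54 u <= B ->
  diff_bounded L K 8 (grid_restriction (gridh L K) (fourier_truncation L K u)) (truncation_const B).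
Proof.
move=> cu pu uB; rewrite grid_truncationE.
apply: diff_bounded_le (diff_bounded_trig_grid K L0 8 _) => //.
have d0 : 0 <= decay_const 8 B by exact: sqrtr_ge0.
apply: le_trans (_ : \sum_(q <- modes3 K) decay_const 8 B * ((1 + wavenum L q.1.1 ^+ 2)^-1 *
   (1 + wavenum L q.1.2 ^+ 2)^-1 * (1 + wavenum L q.2 ^+ 2)^-1) <= _).
  apply: ler_sum => q _; rewrite -!invfM -/(mode_weight L q).
  have r0 : 0 < mode_weight L q by have [_ _ _] := mode_weight_factors L q; apply: lt_le_trans.
  by rewrite ler_pdivlMr// -mulrA -exprSr; exact: fourier_mode_weight.
rewrite -mulr_sumr; apply: ler_wpM2l => //.
rewrite -(sum_modes3 K (fun l m n => (1 + wavenum L l ^+ 2)^-1 * (1 + wavenum L m ^+ 2)^-1 * (1 + wavenum L n ^+ 2)^-1)).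
under eq_bigr do under eq_bigr do rewrite -big_distrr /=.
under eq_bigr do rewrite -big_distrl -big_distrr /=.
rewrite -!big_distrl /= -expr2 -exprSr.
have P : 0 <= \sum_(l <- modes K) (1 + wavenum L l ^+ 2)^-1.
  by apply: sumr_ge0 => l _; rewrite invr_ge0 addr_ge0// sqr_ge0.
apply: lerXn2r; rewrite ?nnegrE//; last exact: sum_modes_wavenum.
exact: le_trans P (sum_modes_wavenum K).
Qed.

End Decay.

(** * Polynomial dependence on the inverse of the interface width *)
Section PolynomialBounds.
Variable R : realType.

Definition poly_bounded (f : R -> R) := exists (k : nat) (C : R),
  0 <= C /\ forall e, 1 <= e -> 0 <= f e <= C * e ^+ k.

Lemma poly_bounded_cst (c : R) : 0 <= c -> poly_bounded (fun=> c).
Proof. by move=> c0; exists 0%N, c; split => // e _; rewrite expr0 mulr1 c0 lexx. Qed.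

Lemma poly_bounded_id : poly_bounded id.
Proof. by exists 1%N, 1; split => // e e1; rewrite mul1r expr1 lexx (le_trans _ e1). Qed.

Lemma poly_boundedM f g : poly_bounded f -> poly_bounded g -> poly_bounded (fun e => f e * g e).
Proof.
move=> [k [C [C0 fC]]] [k' [C' [C0' gC]]]; exists (k + k')%N, (C * C'); split.
  exact: mulr_ge0.
move=> e e1; have /andP[f0 f1] := fC e e1; have /andP[g0 g1] := gC e e1.
by rewrite mulr_ge0//= exprD mulrACA ler_pM.
Qed.

Lemma poly_boundedD f g : poly_bounded f -> poly_bounded g -> poly_bounded (fun e => f e + g e).
Proof.
move=> [k [C [C0 fC]]] [k' [C' [C0' gC]]]; exists (k + k')%N, (C + C'); split.
  exact: addr_ge0.
move=> e e1; have /andP[f0 f1] := fC e e1; have /andP[g0 g1] := gC e e1.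
rewrite addr_ge0//= mulrDl lerD//.
  by apply: (le_trans f1); apply: ler_wpM2l => //; rewrite ler_weXn2l// leq_addr.
by apply: (le_trans g1); apply: ler_wpM2l => //; rewrite ler_weXn2l// leq_addl.
Qed.

Lemma poly_boundedX f n : poly_bounded f -> poly_bounded (fun e => f e ^+ n).
Proof.
move=> pf; elim: n => [|n IHn]; first exact: poly_bounded_cst.
have -> : (fun e => f e ^+ n.+1) = (fun e => f e * f e ^+ n) by apply/funext => e; rewrite exprS.
exact: poly_boundedM.
Qed.

End PolynomialBounds.

(** * Bounds along the iterates *)
Section Assembly.
Variable R : realType.
Variables (L A C0 B : R).
Hypotheses (L0 : 0 < L) (A0 : 1 / 16 <= A).
Implicit Types e : R.

(** Bounds obtained below, as functions of [e = 1 / eps]: for six differences of the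
initial chemical potential, four differences of phi^0 and phi^(-1), the squared
norms of these two up to second powers of the Laplacian, the initial modified
energy, the squared H^1 norms, the source of the recursion, its barrier, and
the H^2 norm of the extensions. *)
Definition mu_bound e : R := e * (2 ^+ 16 * truncation_const L B ^+ 3 + truncation_const L B) + 4 * truncation_const L B.
Definition prev_bound e : R := truncation_const L B + 8 * mu_bound e.
Definition start_bound e : R := L ^+ 3 * (16 * prev_bound e) ^+ 2.
Definition energy_bound e : R := 2 * (e * `|C0|) + e ^+ 2 * (L ^+ 3 / 4).
Definition H1_const e : R := 2 * (energy_bound e + L ^+ 3) + 2 * (e * (energy_bound e + e * (L ^+ 3 / 4))) + start_bound e.
Definition source_const e : R := H1_const e + 3 * (e ^+ 3 * (cubeC L * H1_const e ^+ 13 * (192 ^+ 5 * e ^+ 20))) +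
  15 * (e ^+ 3 * (H1_const e * (48 * e ^+ 4))).
Definition functional_const e : R := 4 * start_bound e + 16 * (e * source_const e).
Definition extension_const e : R := 1 + 432 * (2 * (H1_const e + 4 * functional_const e)).

Lemma truncation_const_ge0 : 0 <= truncation_const L B.
Proof.
apply: mulr_ge0; first exact: sqrtr_ge0.
by rewrite exprn_ge0// mulr_ge0// /lattice_const addr_ge0// sqr_ge0.
Qed.

Lemma poly_bounded_extension_const : poly_bounded extension_const.
Proof.
have i0 := truncation_const_ge0; have n0 := ltW (cubeC_gt0 L0); have L3 : 0 <= L ^+ 3 by rewrite exprn_ge0// ltW.
have L4 : 0 <= L ^+ 3 / 4 by rewrite divr_ge0.
have pid := poly_bounded_id R.
have nat0 n : 0 <= n%:R :> R by exact: ler0n.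
have pmu : poly_bounded mu_bound.
  apply: poly_boundedD; last by apply: poly_bounded_cst; exact: mulr_ge0.
  apply: poly_boundedM => //; apply: poly_bounded_cst; apply: addr_ge0 => //.
  by apply: mulr_ge0; exact: exprn_ge0.
have pprev : poly_bounded prev_bound.
  by apply: poly_boundedD; [exact: poly_bounded_cst|apply: poly_boundedM => //; exact: poly_bounded_cst].
have pinit : poly_bounded start_bound.
  by apply: poly_boundedM; [exact: poly_bounded_cst|apply: poly_boundedX; apply: poly_boundedM => //; exact: poly_bounded_cst].
have pF : poly_bounded energy_bound.
  apply: poly_boundedD; last by apply: poly_boundedM; [exact: poly_boundedX|exact: poly_bounded_cst].
  by apply: poly_boundedM; [exact: poly_bounded_cst|apply: poly_boundedM => //; exact: poly_bounded_cst].
have pm : poly_bounded H1_const.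
  apply: poly_boundedD => //; apply: poly_boundedD; apply: poly_boundedM; try exact: poly_bounded_cst.
    by apply: poly_boundedD => //; exact: poly_bounded_cst.
  apply: poly_boundedM => //; apply: poly_boundedD => //; apply: poly_boundedM => //; exact: poly_bounded_cst.
have pQ : poly_bounded source_const.
  apply: poly_boundedD; first apply: poly_boundedD => //; apply: poly_boundedM; try exact: poly_bounded_cst.
    apply: poly_boundedM; first exact: poly_boundedX.
    apply: poly_boundedM; first by apply: poly_boundedM; [exact: poly_bounded_cst|exact: poly_boundedX].
    by apply: poly_boundedM; [apply: poly_bounded_cst; exact: exprn_ge0|exact: poly_boundedX].
  apply: poly_boundedM; first exact: poly_boundedX.
  by apply: poly_boundedM => //; apply: poly_boundedM; [exact: poly_bounded_cst|exact: poly_boundedX].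
have pS : poly_bounded functional_const.
  apply: poly_boundedD; apply: poly_boundedM => //; try exact: poly_bounded_cst.
  exact: poly_boundedM.
apply: poly_boundedD; first exact: poly_bounded_cst.
apply: poly_boundedM; first exact: poly_bounded_cst.
apply: poly_boundedM; first exact: poly_bounded_cst.
by apply: poly_boundedD => //; apply: poly_boundedM => //; exact: poly_bounded_cst.
Qed.

Variable K : nat.
Local Notation N := (gridN K).
Local Notation h := (gridh L K).
Local Notation norm2 := (norm2_sq h N).
Local Notation norm4 := (norm4_pow4 h N).
Local Notation G := (grad4_sq h N).
Local Notation Lap := (Lap4 h).

(** [x^4/4 - x^2/2 + 1/4 = (x^2 - 1)^2 / 4] and [x^4/4 - x^2 + 1 = (x^2/2 - 1)^2]:
the first square bounds the energy from below, the second one extracts the L^2 norm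
from it. *)
Lemma double_well_lb (f : grid R) : - (L ^+ 3 / 4) <= norm4 f / 4 - norm2 f / 2 /\
  norm2 f / 2 - L ^+ 3 <= norm4 f / 4 - norm2 f / 2.
Proof.
have h0 : 0 < h by exact: gridh_gt0.
have h3 : 0 <= h ^+ 3 by rewrite exprn_ge0// ltW.
have E : L ^+ 3 = h ^+ 3 * grid_sum K (fun _ _ _ => 1) by rewrite grid_sum_cst mulr1.
have E4 : norm4 f = h ^+ 3 * grid_sum K (fun i j k => f i j k ^+ 4).
  by rewrite /norm4_pow4 inner_grid_sum; congr (_ * _); apply: eq_grid_sum => i j k; rewrite mulr1.
have P (c d : R) : (forall x : R, 0 <= 4^-1 * x ^+ 4 + c * x ^+ 2 + d * 1) ->
    0 <= norm4 f / 4 + c * norm2 f + d * L ^+ 3.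
  move=> H; rewrite norm2E E4 E.
  have -> : h ^+ 3 * grid_sum K (fun i j k => f i j k ^+ 4) / 4 + c * (h ^+ 3 * grid_sum K (fun i j k => f i j k ^+ 2)) +
     d * (h ^+ 3 * grid_sum K (fun _ _ _ => 1)) = h ^+ 3 * grid_sum K (fun i j k => 4^-1 * f i j k ^+ 4 + c * f i j k ^+ 2 + d * 1).
    by rewrite !grid_sumD !grid_sumZ; ring.
  by apply: mulr_ge0 => //; apply: grid_sum_ge0 => i j k; exact: H.
split.
  have := P (- 2^-1) 4^-1 _; move=> H; rewrite -subr_ge0.
  have : 0 <= norm4 f / 4 + - 2^-1 * norm2 f + 4^-1 * L ^+ 3.
    apply: H => x; have -> : 4^-1 * x ^+ 4 + - 2^-1 * x ^+ 2 + 4^-1 * 1 = 4^-1 * (x ^+ 2 - 1) ^+ 2 by field.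
    by apply: mulr_ge0; [rewrite invr_ge0|exact: sqr_ge0].
  by move=> {}H; lra.
have : 0 <= norm4 f / 4 + - 1 * norm2 f + 1 * L ^+ 3.
  apply: P => x; have -> : 4^-1 * x ^+ 4 + - 1 * x ^+ 2 + 1 * 1 = (x ^+ 2 / 2 - 1) ^+ 2 by field.
  exact: sqr_ge0.
lra.
Qed.

Variables (eps dt : R) (phi : int -> grid R) (phi0 : fun3 R).
Hypotheses (eps0 : 0 < eps) (eps1 : eps < 1) (dt0 : 0 < dt).
Hypothesis dtA : dt <= eps / (2 * Num.sqrt 2 * Num.sqrt A).
Hypotheses (cphi : class_C 54 phi0) (pphi : periodic3 L phi0) (Bphi : sobolev_norm L 54 phi0 <= B).
Hypothesis sol : bdf2_solution L K eps dt A phi0 phi.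
Hypothesis ini : initial_energy_bound h N eps dt C0 (phi 0).

Let e := eps^-1.
Let e_ge1 : 1 <= e. Proof. by rewrite /e -invr1 lef_pV2 ?posrE// ltW. Qed.
Let e0 : 0 < e. Proof. exact: lt_le_trans e_ge1. Qed.
Let A1 : 0 < A. Proof. by apply: lt_le_trans A0. Qed.

Lemma Adt_le : A * dt ^+ 2 <= eps ^+ 2 / 8.
Proof.
have s2 : 0 < Num.sqrt 2 :> R by rewrite sqrtr_gt0.
have sA : 0 < Num.sqrt A by rewrite sqrtr_gt0.
have D : 0 < 2 * Num.sqrt 2 * Num.sqrt A by rewrite !mulr_gt0.
have H : dt * (2 * Num.sqrt 2 * Num.sqrt A) <= eps by rewrite -ler_pdivlMr.
have : (dt * (2 * Num.sqrt 2 * Num.sqrt A)) ^+ 2 <= eps ^+ 2.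
  by apply: lerXn2r; rewrite ?nnegrE ?(ltW eps0)// mulr_ge0// ltW.
rewrite !exprMn !sqr_sqrtr//; last exact: ltW.
lra.
Qed.

Lemma dt_le2 : dt <= 2.
Proof.
have H := Adt_le; have eps2 : eps ^+ 2 <= 1 by rewrite expr_le1 ?ltW.
have : dt ^+ 2 <= 2 ^+ 2.
  have : 1 / 16 * dt ^+ 2 <= A * dt ^+ 2 by apply: ler_wpM2r => //; exact: sqr_ge0.
  lra.
by rewrite ler_pXn2r// nnegrE ?ltW.
Qed.

Lemma dte_le2 : dt * eps <= 2.
Proof. by apply: le_trans dt_le2; rewrite ler_piMr// ltW. Qed.

Let p0E : phi 0 = trig_grid L K (coef3 (fourier_coef L phi0)).
Proof. by case: sol => -> _ _; rewrite grid_truncationE. Qed.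

Let bd0 : diff_bounded L K 8 (phi 0) (truncation_const L B).
Proof. by case: sol => -> _ _; exact: truncation_diff_bounded. Qed.

Let Vp0 : Vper N (phi 0). Proof. by rewrite p0E; exact: Vper_trig_grid. Qed.

Local Notation mu0 := (mu_init h eps (phi 0)).

Let mu0E : mu0 = fun i j k => e * (fun i j k => 1 * (phi 0 i j k * phi 0 i j k * phi 0 i j k) + (- 1) * phi 0 i j k) i j k
   + (- eps) * Lap (phi 0) i j k.
Proof. by apply: funext3 => i j k; rewrite /mu_init /e; ring. Qed.

Let Vmu0 : Vper N mu0.
Proof.
rewrite mu0E; apply: Vper_lin; last exact: Vper_Lap4.
apply: Vper_lin => //; apply: (Vper_map1 (fun a => a * a * a)) => //.
Qed.

Let bdmu : diff_bounded L K 6 mu0 (mu_bound e).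
Proof.
have i0 := truncation_const_ge0.
have b3 := diff_bounded_mul L0 (diff_bounded_mul L0 bd0 bd0) bd0.
have b2 := diff_bounded_lin 1 (- 1) b3 bd0.
rewrite mu0E; have := diff_bounded_lin e (- eps) (diff_bounded_le (r' := 6) _ (lexx _) b2) (diff_bounded_Lap4 L0 bd0).
move=> /(_ isT); apply: diff_bounded_le => //.
rewrite normrN normr1 normrN (gtr0_norm e0) (gtr0_norm eps0) !mul1r /mu_bound.
apply: lerD; last by apply: ler_piMl; [exact: mulr_ge0|exact: ltW].
by apply: eq_ler; ring.
Qed.

Let mu_bound_ge0 : 0 <= mu_bound e. Proof. exact: diff_bounded_ge0 bdmu. Qed.

Let pm1E : phi (- 1) = fun i j k => 1 * phi 0 i j k + (- dt) * Lap mu0 i j k.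
Proof. by case: sol => _ -> _; apply: funext3 => i j k; ring. Qed.

Let Vpm1 : Vper N (phi (- 1)).
Proof. by rewrite pm1E; apply: Vper_lin => //; exact: Vper_Lap4. Qed.

Let bdm1 : diff_bounded L K 4 (phi (- 1)) (prev_bound e).
Proof.
rewrite pm1E; have := diff_bounded_lin 1 (- dt) (diff_bounded_le (r' := 4) _ (lexx _) bd0) (diff_bounded_Lap4 L0 bdmu).
move=> /(_ isT); apply: diff_bounded_le => //.
rewrite normr1 mul1r normrN (gtr0_norm dt0) /prev_bound lerD2l.
have -> : 8 * mu_bound e = 2 * (4 * mu_bound e) by ring.
by apply: ler_wpM2r; [rewrite mulr_ge0|exact: dt_le2].
Qed.

Let bd0' : diff_bounded L K 4 (phi 0) (prev_bound e).
Proof. by apply: diff_bounded_le bd0 => //; rewrite /prev_bound lerDl mulr_ge0. Qed.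

Lemma init_norms f : diff_bounded L K 4 f (prev_bound e) ->
  [/\ norm2 f <= start_bound e, norm2 (Lap f) <= start_bound e & norm2 (Lap (Lap f)) <= start_bound e].
Proof.
move=> bf; have b0 := diff_bounded_ge0 bf.
have b2 := diff_bounded_Lap4 L0 bf; have b4 := diff_bounded_Lap4 L0 b2.
have T M g r : 0 <= M -> M <= 16 * prev_bound e -> diff_bounded L K r g M -> norm2 g <= start_bound e.
  move=> M0 M16 bg.
  have H : norm2 g <= L ^+ 3 * M ^+ 2 by apply: norm2_sup => //; exact: (diff_bounded_abs bg).
  apply: (le_trans H).
  apply: ler_wpM2l; first by rewrite exprn_ge0// ltW.
  by apply: lerXn2r => //; rewrite nnegrE mulr_ge0.
by split; [apply: (T _ _ _ _ _ bf)|apply: (T _ _ _ _ _ b2)|apply: (T _ _ _ _ _ b4)]; lra.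
Qed.

Let VpS (n : nat) : Vper N (phi (n%:Z + 1)).
Proof. by case: sol => _ _ /(_ n)[]. Qed.

Let Vpn (n : nat) : Vper N (phi n%:Z).
Proof. by case: n => [//|n]; rewrite -addn1 PoszD. Qed.

Let Vpn1 (n : nat) : Vper N (phi (n%:Z - 1)).
Proof. by case: n => [|n]; [rewrite sub0r|rewrite -addn1 PoszD addrK]. Qed.

Let stepn (n : nat) : bdf_step L K A eps dt (phi (n%:Z + 1)) (phi n%:Z) (phi (n%:Z - 1)).
Proof. by case: sol => _ _ /(_ n)[]. Qed.

(* the modified energy of phi^0, phi^(-1) with the potential [- dt * mu0] *)
Let energy0 : R := energy h N eps (phi 0) + dt / 4 * G mu0 + dt ^+ 2 / (2 * eps) * norm2 (Lap mu0).

(** By definition of phi^(-1), [- dt * mu0] is a potential of phi^0 - phi^(-1). *)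
Lemma energy_all (n : nat) : exists psi, [/\ Vper N psi, potential L K psi (phi n%:Z) (phi (n%:Z - 1)) &
  mod_energy L K eps dt (phi n%:Z) (phi (n%:Z - 1)) psi <= energy0].
Proof.
elim: n => [|n [psi [Vpsi po EF]]].
  exists (fun i j k => (- dt) * mu0 i j k + 0 * mu0 i j k); split.
  - exact: Vper_lin.
  - by move=> i j k; rewrite sub0r pm1E Lap4_lin; ring.
  - rewrite /mod_energy grad4_lin// sub0r /energy0 -!addrA lerD2l.
    have -> : norm2 (grid_sub (phi 0) (phi (- 1))) = dt ^+ 2 * norm2 (Lap mu0).
      rewrite (_ : grid_sub _ _ = fun i j k => dt * Lap mu0 i j k + 0 * Lap mu0 i j k).
        by rewrite norm2_lin; ring.
      by apply: funext3 => i j k; rewrite /grid_sub pm1E; ring.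
    apply: eq_ler; field; rewrite !gt_eqF//.
exists (next_potential L K A eps dt psi (phi (n%:Z + 1)) (phi n%:Z) (phi (n%:Z - 1))).
rewrite -addn1 PoszD addrK; split.
- by apply: Vper_lin => //; exact: Vper_mu.
- exact: next_potentialP.
- by apply: le_trans EF; exact: energy_step.
Qed.

(** The norm of [Lap mu0] has the factor [1 / eps] that it lacks in the assumption
on the initial data.  The assumption bounds that norm because the energy is bounded
below, and the bound is then multiplied by [e]. *)
Lemma energy0_le : energy0 <= energy_bound e.
Proof.
have Gm := grad4_ge0 L0 Vmu0.
have [W1 _] := double_well_lb (phi 0).
have Gp := grad4_ge0 L0 Vp0.
have X0 : 0 <= dt ^+ 2 / 2 * norm2 (Lap mu0).
  by apply: mulr_ge0; [rewrite divr_ge0// sqr_ge0|exact: norm2_ge0].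
have dG : 0 <= dt / 4 * G mu0 by rewrite mulr_ge0// divr_ge0// ltW.
have EL : - (e * (L ^+ 3 / 4)) <= energy h N eps (phi 0).
  rewrite /energy -/e; have : e * (- (L ^+ 3 / 4)) <= e * (norm4 (phi 0) / 4 - norm2 (phi 0) / 2).
    by apply: ler_wpM2l => //; exact: ltW.
  have : 0 <= eps / 2 * G (phi 0) by rewrite mulr_ge0// divr_ge0// ltW.
  by rewrite mulrN; lra.
have I : energy h N eps (phi 0) + dt / 4 * G mu0 + dt ^+ 2 / 2 * norm2 (Lap mu0) <= C0 by exact: ini.
have CC : C0 <= `|C0| by exact: ler_norm.
have -> : energy0 = energy h N eps (phi 0) + dt / 4 * G mu0 + e * (dt ^+ 2 / 2 * norm2 (Lap mu0)).
  by rewrite /energy0 /e; congr (_ + _); field; rewrite gt_eqF.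
rewrite /energy_bound; move: I X0; set X := dt ^+ 2 / 2 * _ => I X0.
have XB : X <= `|C0| + e * (L ^+ 3 / 4) by lra.
have e10 : 0 <= e - 1 by rewrite subr_ge0.
have := ler_wpM2l e10 XB.
have CE : `|C0| <= e * `|C0| by rewrite ler_peMl.
have L4 : 0 <= e * (L ^+ 3 / 4) by rewrite mulr_ge0 ?divr_ge0 ?exprn_ge0// ltW.
rewrite mulrBl mul1r mulrBl mul1r mulrDr expr2; lra.
Qed.

Let start_bound_ge0 : 0 <= start_bound e.
Proof. by have [+ _ _] := init_norms bdm1; apply: le_trans; exact: norm2_ge0. Qed.

(** [start_bound] is added so that [H1_const] also bounds phi^(-1), which is not
covered by the decay of the energy. *)
Lemma H1_bound (n : nat) : norm2 (phi n%:Z) + G (phi n%:Z) + start_bound e <= H1_const e.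
Proof.
have [psi [Vpsi _ H]] := energy_all n; have Fb := energy0_le.
have En : energy h N eps (phi n%:Z) <= energy_bound e.
  apply: le_trans (le_trans H Fb); rewrite /mod_energy -addrA lerDl addr_ge0//.
    by apply: mulr_ge0; [rewrite invr_ge0 mulr_ge0// ltW|exact: grad4_ge0].
  by apply: mulr_ge0; [rewrite invr_ge0 mulr_ge0// ltW|exact: norm2_ge0].
have [W1 W2] := double_well_lb (phi n%:Z).
have Gn := grad4_ge0 L0 (Vpn n).
have L3 : 0 <= L ^+ 3 by rewrite exprn_ge0// ltW.
have bF0 : 0 <= energy_bound e.
  rewrite /energy_bound addr_ge0 ?mulr_ge0 ?normr_ge0 ?exprn_ge0 ?invr_ge0//; exact: ltW.
move: En; rewrite /energy -/e => En.
have a1 : norm2 (phi n%:Z) <= 2 * (energy_bound e + L ^+ 3).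
  have H1 : e * (norm2 (phi n%:Z) / 2 - L ^+ 3) <= energy_bound e.
    apply: le_trans En; rewrite -[leLHS]addr0; apply: lerD.
      by apply: ler_wpM2l => //; exact: ltW.
    by rewrite mulr_ge0// divr_ge0// ltW.
  have [neg|pos] := leP (norm2 (phi n%:Z) / 2 - L ^+ 3) 0; first by lra.
  have : norm2 (phi n%:Z) / 2 - L ^+ 3 <= e * (norm2 (phi n%:Z) / 2 - L ^+ 3).
    by rewrite ler_peMl// ltW.
  lra.
have a2 : G (phi n%:Z) <= 2 * (e * (energy_bound e + e * (L ^+ 3 / 4))).
  have H1 : eps / 2 * G (phi n%:Z) <= energy_bound e + e * (L ^+ 3 / 4).
    have : e * - (L ^+ 3 / 4) <= e * (norm4 (phi n%:Z) / 4 - norm2 (phi n%:Z) / 2).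
      by apply: ler_wpM2l => //; exact: ltW.
    by rewrite mulrN; lra.
  have e2 : 0 <= 2 * e by rewrite mulr_ge0// ltW.
  have := ler_wpM2l e2 H1.
  have -> : 2 * e * (eps / 2 * G (phi n%:Z)) = G (phi n%:Z) by rewrite /e; field; rewrite gt_eqF.
  by rewrite mulrA.
by rewrite /H1_const; lra.
Qed.

Let norm_bounds (n : nat) : [/\ hnorm2 L K 1 (phi n%:Z) <= H1_const e, norm2 (phi n%:Z) <= H1_const e &
  norm2 (phi (n%:Z - 1)) <= H1_const e].
Proof.
have T (j : nat) : hnorm2 L K 1 (phi j%:Z) <= H1_const e /\ norm2 (phi j%:Z) <= H1_const e.
  have H := H1_bound j; rewrite hnorm2_1//.
  have Gn := grad4_ge0 L0 (Vpn j); have b0 := start_bound_ge0.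
  by split; lra.
have [n1 n2] := T n; split => //.
case: n {n1 n2} => [|n]; last by rewrite -addn1 PoszD addrK; case: (T n).
rewrite sub0r; have [a _ _] := init_norms bdm1; apply: (le_trans a).
have H := H1_bound 0.
have := grad4_ge0 L0 (Vpn 0); have : 0 <= norm2 (phi 0%:Z) by exact: norm2_ge0.
lra.
Qed.

Lemma H2_sourceE m : H2_source L eps m = m + 3 * (e ^+ 3 * (cubeC L * m ^+ 13 * (192 ^+ 5 * e ^+ 20))) +
  15 * (e ^+ 3 * (m * (48 * e ^+ 4))).
Proof.
rewrite /H2_source /e; congr (_ + _ + _); last by field; rewrite gt_eqF.
have c0 : 192 != 0 :> R by rewrite pnatr_eq0.
move: (192 : R) c0 (cubeC L * m ^+ 13) => c c0 X; field.
by rewrite c0 gt_eqF.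
Qed.

(** The recursion of [H2_step] is started from phi^0 and phi^(-1). *)
Lemma H2_bound (n : nat) : norm2 (Lap (phi n%:Z)) <= 4 * functional_const e.
Proof.
pose g (j : nat) := H2_functional L K A eps dt (phi j%:Z) (phi (j%:Z - 1)).
have nge f : 0 <= norm2 f by exact: norm2_ge0.
have GA0 : 0 <= A * eps ^- 2 * dt ^+ 2 / 2.
  by rewrite divr_ge0// mulr_ge0 ?sqr_ge0// mulr_ge0 ?invr_ge0 ?sqr_ge0// ltW.
have de0 : 0 <= dt * eps by rewrite mulr_ge0// ltW.
have gS : forall j, g j <= functional_const e.
  apply: (@damped_bound R eps dt eps0 dt0 g (source_const e) (functional_const e)).
  - have [a1 a2 a3] := init_norms bd0'; have [b1 b2 b3] := init_norms bdm1.
    have -> : g 0%N = H2_functional L K A eps dt (phi 0) (phi (- 1)) by rewrite /g sub0r.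
    rewrite /H2_functional.
    have GA1 : A * eps ^- 2 * dt ^+ 2 / 2 * norm2 (Lap (Lap (phi 0))) <= 1 / 16 * start_bound e.
      apply: ler_pM => //.
      have -> : A * eps ^- 2 * dt ^+ 2 / 2 = (A * dt ^+ 2) * (eps ^- 2 / 2) by ring.
      have -> : 1 / 16 = (eps ^+ 2 / 8) * (eps ^- 2 / 2) by field; rewrite gt_eqF.
      by apply: ler_wpM2r; [rewrite divr_ge0// invr_ge0 sqr_ge0|exact: Adt_le].
    have : norm2 (fun i j k => 2 * Lap (phi 0) i j k + (- 1) * Lap (phi (- 1)) i j k) <=
        8 * norm2 (Lap (phi 0)) + 2 * norm2 (Lap (phi (- 1))) by exact: norm2_2sub_le.
    have : dt * eps * (1 / 4 * norm2 (Lap (Lap (phi 0))) + 1 / 8 * norm2 (Lap (Lap (phi (-1))))) <=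
       2 * (1 / 4 * start_bound e + 1 / 8 * start_bound e).
      apply: ler_pM => //; last by lra.
        by rewrite addr_ge0// mulr_ge0.
      exact: dte_le2.
    have Q0 : 0 <= 16 * (e * source_const e).
      have m0 : 0 <= H1_const e by have [_ + _] := norm_bounds 0; apply: le_trans.
      have en j : 0 <= e ^+ j by rewrite exprn_ge0// ltW.
      have c0 j : 0 <= 192 ^+ j :> R by rewrite exprn_ge0.
      have n0 := ltW (cubeC_gt0 L0).
      apply: mulr_ge0 => //; apply: mulr_ge0; first exact: ltW.
      apply: addr_ge0; first apply: addr_ge0 => //; apply: mulr_ge0 => //; apply: mulr_ge0 => //.
        by apply: mulr_ge0; [apply: mulr_ge0 => //; exact: exprn_ge0|exact: mulr_ge0].
      by apply: mulr_ge0 => //; exact: mulr_ge0.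
    have b0 := start_bound_ge0; rewrite /functional_const; lra.
  - by rewrite /functional_const -/e -mulrA lerDr mulr_ge0.
  - have PS (j : nat) : j.+1%:Z = j%:Z + 1 by rewrite -addn1 PoszD.
    move=> j; rewrite /g PS addrK.
    have [n1 n2 n3] := norm_bounds j.
    have [m1 m2 _] := norm_bounds j.+1; rewrite PS in m1 m2.
    have := H2_step L0 (ltW A1) eps0 eps1 dt0 Adt_le dte_le2 (VpS j) (Vpn j) (Vpn1 j) (stepn j) m1 m2 n2 n3.
    by rewrite H2_sourceE.
have := gS n; rewrite /g /H2_functional.
have h1 := nge (fun i j k => 2 * Lap (phi n) i j k + -1 * Lap (phi (n%:Z - 1)) i j k).
have h2 : 0 <= A * eps ^- 2 * dt ^+ 2 / 2 * norm2 (Lap (Lap (phi n))) by exact: mulr_ge0.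
have h3 : 0 <= dt * eps * (1 / 4 * norm2 (Lap (Lap (phi n))) + 1 / 8 * norm2 (Lap (Lap (phi (n%:Z - 1))))).
  by rewrite mulr_ge0// addr_ge0// mulr_ge0.
lra.
Qed.

Lemma extension_bound (n : nat) : sobolev_norm L 2 (extension L K (phi n%:Z)) <= extension_const e.
Proof.
have H : sobolev_norm L 2 (extension L K (phi n%:Z)) ^+ 2 <= 432 * hnorm2 L K 2 (phi n%:Z).
  exact: sobolev_extension.
have [_ m1 _] := norm_bounds n.
have N2 := hnorm2_2_le L0 (Vpn n); have U := H2_bound n.
set t := sobolev_norm _ _ _ in H *.
have t2 : t <= 1 + t ^+ 2 by have := sqr_ge0 (t - 1); have := sqr_ge0 t; nra.
apply: (le_trans t2); rewrite /extension_const lerD2l; apply: (le_trans H).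
apply: ler_wpM2l; first exact: ler0n.
by apply: (le_trans N2); apply: ler_wpM2l; [exact: ler0n|lra].
Qed.

End Assembly.

(* s: the order of smoothness asked of phi0 ("sufficiently smooth"); the
   constants depend on phi0 only through a bound B on its H^s norm. *)
Theorem theorem3p1 (R : realType) :
  exists s : nat,
  forall L A C0 B : R, 0 < L -> 1 / 16 <= A ->
  exists (k2 : nat) (C : R), (0 < k2)%N /\ 0 < C /\
  forall phi0 : fun3 R, class_C s phi0 -> periodic3 L phi0 -> sobolev_norm L s phi0 <= B ->
  forall (eps : R) (Phi : R -> fun3 R), 0 < eps -> eps < 1 ->
    cahn_hilliard_solution L eps phi0 Phi ->
  forall (K : nat) (dt T : R) (phi : int -> grid R), 0 < dt -> 0 < T ->
    bdf2_solution L K eps dt A (Phi 0) phi ->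
    initial_energy_bound (gridh L K) (gridN K) eps dt C0 (phi 0) ->
    dt <= eps / (2 * Num.sqrt 2 * Num.sqrt A) ->
  \big[Num.max/0]_(m < (Num.truncn (T / dt)).+1)
     sobolev_norm L 2 (extension L K (phi m%:Z)) <= C * eps ^- k2.
Proof.
exists 54%N => L A C0 B L0 A0.
have [k [C [C_ge0 PC]]] := poly_bounded_extension_const C0 B L0.
(* one more power of 1 / eps, and C + 1, make both constants positive *)
exists k.+1, (C + 1); split => //; split; first by rewrite ltr_wpDl.
move=> phi0 cphi pphi Bphi eps Phi eps0 eps1 [Phi0 _ _ _ _] K dt T phi dt0 T0 sol ini dtA.
rewrite Phi0 in sol.
have e1 : 1 <= eps^-1 by rewrite -invr1 lef_pV2 ?posrE// ltW.
have /andP[_ b1] := PC _ e1.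
have fin : extension_const L C0 B eps^-1 <= (C + 1) * eps ^- k.+1.
  apply: (le_trans b1); rewrite -exprVn; apply: ler_pM => //.
  - by rewrite exprn_ge0// (le_trans _ e1).
  - by rewrite lerDl.
  - by rewrite ler_weXn2l.
apply: le_trans fin; apply: bigmax_le => [|m _].
  by have /andP[] := PC _ e1.
exact: (extension_bound L0 A0 eps0 eps1 dt0 dtA cphi pphi Bphi sol ini).
Qed.
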